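(* Let $H\in(0,1)$, $\theta\ge1$, $\kappa>0$, and let $F\in C^1(\mathbb{R}^d;\mathbb{R}^d)$ have globally bounded derivative and be eventually strictly monotone, i.e. there exist $R_0>0$ and $C_4^F>0$ such that $\langle F(\xi_2)-F(\xi_1),\xi_2-\xi_1\rangle\le -C_4^F|\xi_2-\xi_1|^2$ for all $|\xi_1|,|\xi_2|\ge R_0$. For invertible $\sigma\in\mathbb{R}^{d\times d}$ let $\tilde p^\sigma_\infty$ denote the stationary density of the rescaled SDE $$\mathrm{d}Z_t^\sigma=\|\sigma\|^{-1}F(\|\sigma\|Z_t^\sigma)\,\mathrm{d}t+\|\sigma\|^{-1}\sigma\,\mathrm{d}B_t^H .$$ Then for every bounded set $B(0,R)\subset\mathbb{R}^d$ there exist constants $C_1,C_2>0$, depending on $\theta,H,\kappa$ and $R$, such that $$\sup_{\sigma\in T_{\theta,\kappa}}\tilde p^\sigma_\infty(y)\le C_1\exp(-C_2|y|^2)\qquad\text{for all } y\in B(0,R).$$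
   Context: **Matrices.** For an invertible $\sigma\in\mathbb{R}^{d\times d}$ with singular values $0<\beta_1\le\dots\le\beta_d$ one has $\|\sigma\|=\beta_d$. $T_\theta:=\{\sigma \text{ invertible}: \beta_d/\beta_1\le\theta\}$, $T_{\theta,\kappa}:=\{\sigma\in T_\theta:\|\sigma\|\ge\kappa\}$. $B(0,R)$ is the open ball of radius $R$ centred at $0$ in $\mathbb{R}^d$. **Noise.** $\mathcal{B}=\mathcal{B}_H$ is the closure of $C_0^\infty(\mathbb{R}^-,\mathbb{R}^d)$ (smooth compactly supported $\omega:\mathbb{R}^-\to\mathbb{R}^d$ with $\omega(0)=0$, $\mathbb{R}^-=(-\infty,0]$) under the norm $\|\omega\|_{\mathcal{B}_H}=\sup_{s\ne t\le 0}\frac{|\omega(t)-\omega(s)|}{\sqrt{1+|t|+|s|}\,|t-s|^{(1-H)/2}}$. $\mathbf{P}$ is the Gaussian measure on $\mathcal{B}$ whose canonical process is a time-reversed $d$-dimensional Brownian motion. For $t\ge0$: $P_t(\omega^-,\omega^+)(s)=\omega^+(-s-t)-\omega^+(-t)$ for $-t\le s\le0$, $P_t(\omega^-,\omega^+)(s)=\omega^-(s+t)-\omega^+(-t)$ for $s\le -t$. The operator $\mathcal{D}_H:\mathcal{B}_H\to\mathcal{B}_{1-H}$ is the continuous extension of $\mathcal{D}_H\omega(t)=\frac1{\alpha_H}\int_{-\infty}^0(-r)^{H-\frac12}(\dot\omega(t+r)-\dot\omega(r))\,\mathrm{d}r$, $\alpha_H=\big(\frac1{2H}+\int_0^\infty((1+s)^{H-\frac12}-s^{H-\frac12})^2\mathrm{d}s\big)^{1/2}$.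 On $\mathcal{B}\times\mathcal{B}$ with $\mathbf{P}\times\mathbf{P}$, $B^H_t:=-(\mathcal{D}_HP_t(\omega^-,\omega^+))(-t)$, $t\ge0$, is a fractional Brownian motion with Hurst parameter $H$. **Invariant measure and stationary density.** The pathwise solution of the rescaled SDE started at $x$ depends on the noise only through $P_t(\omega^-,\omega^+)$; write it $\varphi^t_{P_t(\omega^-,\omega^+)}(x)$. Let $\mathcal{Q}_t((x,\omega^-);\Gamma)=\int_{\mathcal{B}}\chi_\Gamma(\varphi^t_{P_t(\omega^-,\omega^+)}(x),P_t(\omega^-,\omega^+))\,\mathbf{P}(\mathrm{d}\omega^+)$. Under the hypotheses there is a unique probability measure $\tilde\mu^\sigma$ on $\mathbb{R}^d\times\mathcal{B}$ with $\mathcal{B}$-marginal $\mathbf{P}$ invariant for $(\mathcal{Q}_t)_{t\ge0}$. Its marginal on $\mathbb{R}^d$ is $\tilde\pi^\sigma$; it is the limit in total variation, as $t\to\infty$, of the law of the solution of the rescaled SDE started from any $x\in\mathbb{R}^d$. It is absolutely continuous with respect to Lebesgue measure, and $\tilde p^\sigma_\infty$ denotes its density. As a density is determined up to Lebesgue-null sets, the bound is understood for a suitable version of each density. *)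

(* Defs.v *)
From HB Require Import structures.
From mathcomp Require Import all_boot all_order all_algebra.
From mathcomp Require Import all_classical all_reals all_analysis.
Import Order.TTheory GRing.Theory Num.Theory.
Import numFieldNormedType.Exports.

Set Implicit Arguments.
Unset Strict Implicit.
Unset Printing Implicit Defensive.

Local Open Scope classical_set_scope.
Local Open Scope ring_scope.

(* R^d is the type 'rV[R]_d of row vectors, so that the library's jacobian     *)
(* applies; a matrix s : 'M[R]_d acts on x as the column product s x, which    *)
(* in row notation is x *m s^T. The library norm `|x| on matrices is the sup   *)
(* norm, hence the Euclidean norm enorm below.                                 *)

Section euclidean_space.
Context {R : realType} {d : nat}.
Implicit Types (x y : 'rV[R]_d) (s : 'M[R]_d).

Definition edot x y : R := \sum_(i < d) x ord0 i * y ord0 i.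

Definition enorm x : R := Num.sqrt (edot x x).

Definition opnorm s : R :=
  sup [set enorm (x *m s^T) | x in [set x | enorm x <= 1]].

Definition singular_values s : set R :=
  [set b | 0 <= b /\ eigenvalue (s^T *m s) (b ^+ 2)].

Definition Ttheta (theta : R) : set 'M[R]_d :=
  [set s | s \in unitmx /\
           sup (singular_values s) / inf (singular_values s) <= theta].

Definition Tthetakappa (theta kappa : R) : set 'M[R]_d :=
  [set s | Ttheta theta s /\ kappa <= opnorm s].

End euclidean_space.

(* The Borel sigma-algebra of R^n, generated by the coordinates.               *)

Definition rV_display : measure_display -> measure_display.
Proof. exact. Qed.

Section measurable_rV.
Context {d} {T : measurableType d} (n : nat).

Let coords (i : 'I_n) (x : 'rV[T]_n) : T := x ord0 i.

HB.instance Definition _ := @isMeasurable.Build (rV_display d) 'rV[T]_n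
  (g_sigma_preimage coords) (@sigma_algebra0 _ setT _)
  (@sigma_algebraC 'rV[T]_n _) (@sigma_algebra_bigcup _ setT _).

Lemma measurable_coord (i : 'I_n) : measurable_fun setT (coords i).
Proof.
move=> _ Y mY; rewrite setTI; apply: sub_sigma_algebra => /=.
rewrite -bigcup_seq/=; exists i => /=; first by rewrite mem_index_enum.
by exists Y => //; rewrite setTI.
Qed.

Lemma measurable_fun_rV d' (T' : measurableType d') (f : T' -> 'rV[T]_n) :
  (forall i, measurable_fun setT (fun x => f x ord0 i)) ->
  measurable_fun setT f.
Proof.
move=> mf; apply: (@measurability _ _ _ _ _ _
  (\big[setU/set0]_(i < n) preimage_set_system setT (coords i) measurable)) => //.
move=> _ [A + <-]; rewrite -bigcup_seq/= => -[i _ [B mB <-]].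
by have := mf i measurableT B mB; rewrite !setTI.
Qed.

End measurable_rV.

Section lebesgue_rV.
Context {R : realType}.
Local Open Scope ereal_scope.

Definition rV_cons n (z : measurableTypeR R * 'rV[R]_n) : 'rV[R]_n.+1 :=
  row_mx (z.1)%:M z.2.

Definition rV_uncons n (x : 'rV[R]_n.+1) : measurableTypeR R * 'rV[R]_n :=
  (x ord0 ord0, \row_i x ord0 (lift ord0 i)).

Lemma rV_consE0 n (z : measurableTypeR R * 'rV[R]_n) : rV_cons z ord0 ord0 = z.1.
Proof.
rewrite /rV_cons (_ : ord0 = lshift n ord0 :> 'I_(1 + n)); last exact/val_inj.
by rewrite (row_mxEl (z.1)%:M) mxE eqxx mulr1n.
Qed.

Lemma rV_consES n (z : measurableTypeR R * 'rV[R]_n) i :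
  rV_cons z ord0 (lift ord0 i) = z.2 ord0 i.
Proof.
rewrite /rV_cons (_ : lift ord0 i = rshift 1 i :> 'I_(1 + n)).
  by rewrite (row_mxEr (z.1)%:M).
exact/val_inj.
Qed.

Lemma rV_unconsK n : cancel (@rV_uncons n) (@rV_cons n).
Proof.
move=> x; apply/rowP => i; case: (unliftP ord0 i) => [j ->|->].
  by rewrite rV_consES mxE.
by rewrite rV_consE0.
Qed.

Lemma rV_consK n : cancel (@rV_cons n) (@rV_uncons n).
Proof.
move=> z; rewrite /rV_uncons rV_consE0 [RHS]surjective_pairing; congr pair.
by apply/rowP => i; rewrite mxE rV_consES.
Qed.

Lemma measurable_rV_cons n : measurable_fun setT (@rV_cons n).
Proof.
apply: measurable_fun_rV => i; case: (unliftP ord0 i) => [j ->|->].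
  under eq_fun do rewrite rV_consES.
  exact: (measurableT_comp (measurable_coord j) measurable_snd).
under eq_fun do rewrite rV_consE0.
exact: measurable_fst.
Qed.

Lemma measurable_rV_uncons n : measurable_fun setT (@rV_uncons n).
Proof.
apply: measurable_fun_pair => /=; first exact: measurable_coord.
apply: measurable_fun_rV => i; under eq_fun do rewrite mxE.
exact: measurable_coord.
Qed.

Section rV_cons_measure.
Context n (mu : {sigma_finite_measure set 'rV[R]_n -> \bar R}).

Let prod : {measure set (measurableTypeR R * 'rV[R]_n)%type -> \bar R} :=
  (@lebesgue_measure R) \x mu.

Definition rV_cons_measure (A : set 'rV[R]_n.+1) := prod (@rV_cons n @^-1` A).

Let mpreimage A : measurable A -> measurable (@rV_cons n @^-1` A).
Proof. by move=> mA; rewrite -[X in measurable X]setTI; exact: measurable_rV_cons. Qed.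

Let rcm0 : rV_cons_measure set0 = 0.
Proof. by rewrite /rV_cons_measure preimage_set0 measure0. Qed.

Let rcm_ge0 A : 0 <= rV_cons_measure A.
Proof. exact: measure_ge0. Qed.

Let rcm_sigma_additive : semi_sigma_additive rV_cons_measure.
Proof.
move=> F mF tF mUF; rewrite /rV_cons_measure preimage_bigcup.
apply: measure_semi_sigma_additive.
- by move=> k; exact: mpreimage.
- apply/trivIsetP => /= i j _ _ ij; rewrite -preimage_setI.
  by move/trivIsetP : tF => /(_ _ _ _ _ ij) ->//; rewrite preimage_set0.
- by rewrite -preimage_bigcup; exact: mpreimage.
Qed.

HB.instance Definition _ := isMeasure.Build _ _ _ rV_cons_measure
  rcm0 rcm_ge0 rcm_sigma_additive.

Let rcm_sigma_finite : sigma_finite setT rV_cons_measure.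
Proof.
have /sigma_finiteP[F [TF ndF Foo]] := sigma_finiteT (@lebesgue_measure R).
have /sigma_finiteP[G [TG ndG Goo]] := sigma_finiteT mu.
exists (fun k => @rV_uncons n @^-1` (F k `*` G k)).
  apply/seteqP; split => // x _.
  have [i _ Fi] : (\bigcup_i F i) (rV_uncons x).1 by rewrite -TF.
  have [j _ Gj] : (\bigcup_i G i) (rV_uncons x).2 by rewrite -TG.
  exists (maxn i j) => //; split.
    by move: Fi; exact/subsetPset/ndF/leq_maxl.
  by move: Gj; exact/subsetPset/ndG/leq_maxr.
move=> k; have [mF Fk] := Foo k; have [mG Gk] := Goo k.
have mFG : measurable (F k `*` G k) by exact: measurableX.
split.
  by rewrite -[X in measurable X]setTI; exact: measurable_rV_uncons.
rewrite /rV_cons_measure (_ : _ @^-1` _ = F k `*` G k).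
  by rewrite /prod/= product_measure1E// lte_mul_pinfty// ge0_fin_numE.
by rewrite -comp_preimage (_ : _ \o _ = id) ?preimage_id//; apply/funext => z;
  exact: rV_consK.
Qed.

HB.instance Definition _ := Measure_isSigmaFinite.Build _ _ _ rV_cons_measure
  rcm_sigma_finite.

End rV_cons_measure.

(* Lebesgue measure on R^n: the n-fold product of lebesgue_measure.           *)
Fixpoint lebesgue_rV n : {sigma_finite_measure set 'rV[R]_n -> \bar R} :=
  match n return {sigma_finite_measure set 'rV[R]_n -> \bar R} with
  | 0%N => @dirac _ 'rV[R]_0 0%R R
  | m.+1 => rV_cons_measure (lebesgue_rV m)
  end.

Lemma lebesgue_rV_box n (A : 'I_n -> set R) :
  (forall i, measurable (A i)) ->
  lebesgue_rV n [set x | forall i, A i (x ord0 i)] =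
  \prod_(i < n) lebesgue_measure (A i).
Proof.
elim: n A => [|n IH] A mA.
  rewrite big_ord0 (_ : [set x | _] = setT) ?[LHS]diracT//.
  by apply/seteqP; split => // x _ [].
rewrite big_ord_recl -(IH (fun i => A (lift ord0 i)))//.
pose B : set 'rV[R]_n := [set x | forall i, A (lift ord0 i) (x ord0 i)].
have mB : measurable B.
  rewrite (_ : B = \bigcap_(i in [set: 'I_n])
      ((fun x : 'rV[R]_n => x ord0 i) @^-1` A (lift ord0 i))).
    apply: fin_bigcap_measurable => // i _.
    by rewrite -[X in measurable X]setTI; exact: measurable_coord.
  by apply/seteqP; split => x /= + i => /(_ i)//; apply.
rewrite -[X in _ * lebesgue_rV _ X]/B -product_measure1E//.
suff -> : A ord0 `*` B = @rV_cons n @^-1` [set x | forall i, A i (x ord0 i)].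
  by [].
apply/seteqP; split => z /= Az; last first.
  split => [|i]; first by have := Az ord0; rewrite rV_consE0.
  by have := Az (lift ord0 i); rewrite rV_consES.
move=> i; case: (unliftP ord0 i) => [j ->|->].
  by rewrite rV_consES; exact: Az.2.
by rewrite rV_consE0; exact: Az.1.
exact: mA.
Qed.

End lebesgue_rV.

(* Paths on R^- = (-oo, 0] vanish at 0; they are encoded as functions on R     *)
(* extended by 0 to the positive half-line.                                    *)

Section noise_space.
Context {R : realType} {d : nat}.
Implicit Types (H : R) (w : R -> 'rV[R]_d).

Definition extended_path w := w 0 = 0 /\ forall t, 0 < t -> w t = 0.

(* Smoothness is up to the boundary point 0: w is the restriction to R^- of a  *)
(* smooth function on R.                                                       *)
Definition test_path w :=
  [/\ extended_path w,
      exists M, forall t, t < M -> w t = 0 &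
      exists2 g : R -> 'rV[R]_d,
        forall (i : 'I_d) n t, derivable (derive1n n (fun u => g u ord0 i)) t 1 &
        forall t, t <= 0 -> w t = g t].

Definition noise_norm H w : \bar R :=
  ereal_sup [set (enorm (w ts.1 - w ts.2) /
      (Num.sqrt (1 + `|ts.1| + `|ts.2|) *
       `|ts.1 - ts.2| `^ ((1 - H) / 2)))%:E |
    ts in [set ts : R * R | [/\ ts.1 <= 0, ts.2 <= 0 & ts.1 != ts.2]]].

(* w lies in the noise_norm-closure of the test paths.                         *)
Definition noise_path H w :=
  extended_path w /\
  forall e, 0 < e ->
    exists2 u, test_path u & (noise_norm H (w \- u)%R < e%:E)%E.

Lemma noise_path0 H : noise_path H (cst 0).
Proof.
have ext0 : extended_path (cst 0) by [].
split => // e e0; exists (cst 0).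
  split => //; first by exists 0.
  exists (cst 0) => // i n t.
  rewrite (_ : (fun _ => _) = cst 0); last by apply/funext => u; rewrite mxE.
  elim: n t => [|n IH] t; first exact: derivable_cst.
  rewrite (_ : derive1n n.+1 _ = cst 0); first exact: derivable_cst.
  elim: n {IH t} => [|n IH]; apply/funext => t.
    by rewrite derive1n1 derive1_cst.
  by rewrite derive1nS IH derive1_cst.
apply: (@le_lt_trans _ _ 0%E); last by rewrite lte_fin.
apply: ge_ereal_sup => _ [ts _ <-]; rewrite lee_fin.
rewrite /= !subr0 (_ : enorm 0 = 0) ?mul0r//.
rewrite /enorm /edot big1 ?sqrtr0// => i _; rewrite mxE mul0r//.
Qed.

End noise_space.

Record noise {R : realType} (d : nat) (H : R) := Noise {
  path :> R -> 'rV[R]_d ;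
  noiseP : noise_path H path }.

Definition noise_display {R : realType} (d : nat) (H : R) : measure_display.
Proof. exact: default_measure_display. Qed.

Section noise_measurable.
Context {R : realType} (d : nat) (H : R).

HB.instance Definition _ := gen_eqMixin (noise d H).
HB.instance Definition _ := gen_choiceMixin (noise d H).
HB.instance Definition _ :=
  isPointed.Build (noise d H) (Noise (@noise_path0 R d H)).

(* The sigma-algebra of the canonical process; the noise space is separable    *)
(* for noise_norm, and this is its Borel sigma-algebra.                        *)
Definition noise_cylinders : set (set (noise d H)) :=
  [set A | exists (t : R) (B : set 'rV[R]_d),
    measurable B /\ A = [set w | B (path w t)]].

HB.instance Definition _ := @isMeasurable.Build (noise_display d H)
  (noise d H) <<s noise_cylinders >>
  (@sigma_algebra0 _ setT _) (@sigma_algebraC (noise d H) _)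
  (@sigma_algebra_bigcup _ setT _).

(* The time-reversed canonical process t |-> w (- t), t >= 0, is a standard    *)
(* d-dimensional Brownian motion: independent increments, those over [s, t]    *)
(* having independent N(0, t - s) components (w 0 = 0 and continuity of paths  *)
(* are built into noise d H).                                                  *)
Definition wiener (W : probability (noise d H) R) :=
  forall (n : nat) (t : nat -> R) (A : 'I_n -> 'I_d -> set R),
    0 <= t 0%N -> (forall k, (k < n)%N -> t k < t k.+1) ->
    (forall k i, measurable (A k i)) ->
    W [set w : noise d H | forall (k : 'I_n) (i : 'I_d),
         A k i (w (- t k.+1) ord0 i - w (- t k) ord0 i)] =
    (\prod_(k < n) \prod_(i < d)
       normal_prob 0 (Num.sqrt (t k.+1 - t k))%R (A k i))%E.

(* A path that is not in the noise space is sent to the null path; this case   *)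
(* does not arise for shift_path below, which stays in the noise space.        *)
Definition to_noise (w : R -> 'rV[R]_d) : noise d H :=
  if pselect (noise_path H w) is left wP then Noise wP else point.

Definition shift_path (t : R) (wm wp : noise d H) (s : R) : 'rV[R]_d :=
  if 0 < s then 0
  else if - t <= s then wp (- s - t) - wp (- t)
  else wm (s + t) - wp (- t).

(* The operator P_t. *)
Definition shift (t : R) (wm wp : noise d H) : noise d H :=
  to_noise (shift_path t wm wp).

End noise_measurable.

Section fractional_operator.
Context {R : realType} (d : nat) (H : R).
Let leb : set (measurableTypeR R) -> \bar R := lebesgue_measure.

Definition alphaH : R :=
  Num.sqrt ((2 * H)^-1 +
    \int[leb]_(s in `]0, +oo[)
      ((1 + s) `^ (H - 2^-1) - s `^ (H - 2^-1)) ^+ 2).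

Definition DH_test (w : R -> 'rV[R]_d) (t : R) : 'rV[R]_d :=
  if 0 < t then 0 else
  \row_i (alphaH^-1 * \int[leb]_(r in `]-oo, 0[)
    ((- r) `^ (H - 2^-1) *
     (derive1 (fun u => w u ord0 i) (t + r) - derive1 (fun u => w u ord0 i) r))).

Definition noise_continuous (D : noise d H -> noise d (1 - H)) :=
  forall w e, 0 < e -> exists2 del, 0 < del &
    forall w', (noise_norm H (path w' \- path w)%R < del%:E)%E ->
      (noise_norm (1 - H) (path (D w') \- path (D w))%R < e%:E)%E.

(* D is the continuous extension of DH_test. *)
Definition is_DH (D : noise d H -> noise d (1 - H)) :=
  noise_continuous D /\
  forall w : noise d H, test_path w -> path (D w) = DH_test w.

End fractional_operator.

Section sde.
Context {R : realType} {d : nat} {H : R}.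
Variables (W : probability (noise d H) R) (D : noise d H -> noise d (1 - H)).
Let leb : set (measurableTypeR R) -> \bar R := lebesgue_measure.
Implicit Types (x : 'rV[R]_d) (wm wp : noise d H).

Definition fBm wm wp (t : R) : 'rV[R]_d := - D (shift t wm wp) (- t).

(* Z solves dZ = G(Z) dt + A db on [0, +oo), Z_0 = x, for a path b, b_0 = 0.   *)
Definition solves (G : 'rV[R]_d -> 'rV[R]_d) (A : 'M[R]_d)
    (b : R -> 'rV[R]_d) x (Z : R -> 'rV[R]_d) :=
  {within `[0, +oo[, continuous Z} /\
  forall t, 0 <= t ->
    Z t = x + \row_i (\int[leb]_(s in `[0, t]) G (Z s) ord0 i) + b t *m A^T.

Variables (F : 'rV[R]_d -> 'rV[R]_d) (s : 'M[R]_d).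

Definition rescaled_drift x : 'rV[R]_d := (opnorm s)^-1 *: F (opnorm s *: x).

Definition rescaled_noise : 'M[R]_d := (opnorm s)^-1 *: s.

(* For globally Lipschitz F the solution exists and is unique on [0, +oo), so   *)
(* only its irrelevant values at negative times depend on the choice of get.   *)
Definition solution x wm wp : R -> 'rV[R]_d :=
  get [set Z | solves rescaled_drift rescaled_noise (fBm wm wp) x Z].

(* The kernel Q_t. *)
Definition sds_kernel (t : R) (z : 'rV[R]_d * noise d H)
    (Gam : set ('rV[R]_d * noise d H)) : \bar R :=
  (\int[W]_wp (\1_Gam (solution z.1 z.2 wp t, shift t z.2 wp))%:E)%E.

Definition invariant_measure (mu : probability ('rV[R]_d * noise d H)%type R) :=
  (forall B, measurable B -> mu (setT `*` B) = W B) /\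
  (forall t, 0 <= t -> forall Gam, measurable Gam ->
     (\int[mu]_z sds_kernel t z Gam)%E = mu Gam).

Definition stationary_density (p : 'rV[R]_d -> R) :=
  [/\ measurable_fun setT p, forall y, 0 <= p y &
      exists2 mu, invariant_measure mu &
        forall A, measurable A ->
          mu (A `*` setT) = (\int[lebesgue_rV d]_(y in A) (p y)%:E)%E].

End sde.

Section drift_hypotheses.
Context {R : realType} {d : nat}.
Implicit Type F : 'rV[R]_d -> 'rV[R]_d.

Definition C1_bounded_derivative F :=
  [/\ forall x, differentiable F x, continuous (jacobian F) &
      exists K, forall x, `|jacobian F x| <= K].

Definition eventually_strictly_monotone F :=
  exists R0 C4, [/\ 0 < R0, 0 < C4 &
    forall x y, R0 <= enorm x -> R0 <= enorm y ->
      edot (F y - F x) (y - x) <= - C4 * enorm (y - x) ^+ 2].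

End drift_hypotheses.

(* Main.v *)
(* Adding to the innovation path the ramp of slope c on [-T, 0] changes the driving
   fractional Brownian motion at time t in (0, T] by an explicit positive multiple
   of -c which is nondecreasing in t. For T small, uniformly over sigma in T_theta,
   two such changes c, c' therefore move the solution at time T apart by at least a
   fixed multiple of |c - c'|. By the Cameron-Martin formula, averaging over c in
   [-1, 1]^d then shows that, whatever the past, the solution at time T lies in a
   given cube of side rho with probability O(rho^d). Invariance at the single time T
   gives the same bound for the stationary law, which is thus dominated by C times
   Lebesgue measure on dyadic cubes, hence on all Borel sets. So all the stationary
   densities are almost everywhere at most C, and on a bounded ball a constant is
   dominated by a Gaussian. *)

From HB Require Import structures.
Require Import Defs.
From mathcomp Require Import all_boot all_order all_algebra.
From mathcomp Require Import all_classical all_reals all_analysis.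
From mathcomp Require Import measurable_realfun ring lra.
Import Order.TTheory GRing.Theory Num.Theory.
Import numFieldNormedType.Exports.

Set Implicit Arguments.
Unset Strict Implicit.
Unset Printing Implicit Defensive.

Local Open Scope classical_set_scope.
Local Open Scope ring_scope.

(* The name [path] is shadowed by [seq.path]. *)
Local Notation npath := (@Defs.path _ _ _).

(** * Smooth functions *)

Section smooth_functions.
Context {R : realType}.
Implicit Types (f g h : R -> R) (t x : R).

(** Two features of the definitions shape the proof. [D] is given only as the continuous extension
    of an integral formula on smooth paths vanishing near [-oo], whereas a ramp has a kink and tends
    to a nonzero constant. Ramps and shifted paths are therefore approximated by test paths in the
    noise norm, and [D] of a ramp is a limit of the formula; additivity of [D] is obtained by
    approximation as well. Moreover [solution] is a mere choice of path, and neither its existence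
    nor its measurability in the noise is proved. Hence the estimate is made for every measurable
    set of noises inside the event, which suffices because an integral is a supremum over simple
    functions; and the value at [T] of the default path is removed from the cube, at no cost since
    the stationary law has a density. Since the effect of a ramp grows with t, it is largest at T,
    and a drift with Lipschitz constant L such that L T <= 1/4 cannot cancel it. Uniformity in sigma
    holds because the rescaling preserves L, while T_theta bounds from below how much the normalised
    matrix stretches a vector. *)

Fixpoint Ck n f :=
  if n is m.+1 then (forall t, derivable f t 1) /\ Ck m (derive1 f) else True.

Definition smooth f := forall n, Ck n f.

(** [Ck n] asks for [n] successive derivatives, without continuity of the last. It peels off the
    first derivative, so that product and chain rules pass through an induction; the iterated form
    here is that of [test_path]. *)
Lemma CkP n f :
  Ck n f <-> forall m, (m < n)%N -> forall t, derivable (derive1n m f) t 1.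
Proof.
elim: n f => [|n IH] f; first by split.
have E m : derive1n m.+1 f = derive1n m (derive1 f) by rewrite /derive1n iterSr.
split => [[d0 /IH dS] [|m] mn//|H]; first by rewrite E; exact: dS.
by split; [exact: (H 0%N)|apply/IH => m mn; rewrite -E; exact: H].
Qed.

Lemma smoothP f : smooth f <-> forall n t, derivable (derive1n n f) t 1.
Proof.
by split=> [H n|H n]; [apply: (proj1 (CkP n.+1 f) _)|apply/CkP => m _].
Qed.

Lemma smooth_derivable f t : smooth f -> derivable f t 1.
Proof. by move=> /(_ 1%N)[]. Qed.

Lemma smooth_derive f : smooth f -> smooth (derive1 f).
Proof. by move=> Hf n; have [] := Hf n.+1. Qed.

Lemma smooth_continuous f : smooth f -> continuous f.
Proof.
move=> sf x; apply/differentiable_continuous/derivable1_diffP.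
exact: smooth_derivable.
Qed.

Lemma CkS n f : Ck n.+1 f -> Ck n f.
Proof. by elim: n f => [|n IH] f// [df /IH]. Qed.

Lemma Ck_derive n f df :
  (forall x, is_derive x 1 f (df x)) -> Ck n df -> Ck n.+1 f.
Proof.
move=> fdf cdf; split => [t|]; first exact: ex_derive.
by rewrite (_ : (derive1 f) = df)//; apply/funext => t; rewrite derive1E derive_val.
Qed.

Lemma Ck_is_derive n f x : Ck n.+1 f -> is_derive x 1 f ((derive1 f) x).
Proof. by move=> [df _]; rewrite derive1E; exact: derivableP. Qed.

Lemma Ck_cst n (c : R) : Ck n (cst c).
Proof.
elim: n c => [//|n IH] c.
by apply: (@Ck_derive _ _ (cst 0)) => // x; exact: is_derive_cst.
Qed.

Lemma CkD n f g : Ck n f -> Ck n g -> Ck n (f + g).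
Proof.
elim: n f g => [//|n IH] f g cf cg.
apply: (@Ck_derive _ _ ((derive1 f) + (derive1 g))).
  by move=> x; apply: is_deriveD; [exact: (Ck_is_derive _ cf)|exact: (Ck_is_derive _ cg)].
by apply: IH; [case: cf|case: cg].
Qed.

Lemma CkM n f g : Ck n f -> Ck n g -> Ck n (f * g).
Proof.
elim: n f g => [//|n IH] f g cf cg.
apply: (@Ck_derive _ _ (f * (derive1 g) + g * (derive1 f))).
  by move=> x; apply: is_deriveM; [exact: (Ck_is_derive _ cf)|exact: (Ck_is_derive _ cg)].
by apply: CkD; apply: IH; try exact: CkS; [case: cg|case: cf].
Qed.

Lemma CkN n f : Ck n f -> Ck n (- f).
Proof.
move=> cf; rewrite (_ : - f = cst (-1) * f); first by apply: CkM => //; exact: Ck_cst.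
by apply/funext => x; rewrite !fctE /= mulN1r.
Qed.

Lemma CkV n f : (forall x, f x != 0) -> Ck n f -> Ck n (fun x => (f x)^-1).
Proof.
move=> f0; elim: n => [//|n IH] cf.
apply: (@Ck_derive _ _ (fun x => - (f x) ^- 2 * (derive1 f) x)).
  by move=> x; apply: is_deriveV => //; exact: (Ck_is_derive _ cf).
have := IH (CkS cf) => cV.
rewrite (_ : (fun x => _) = - ((fun x => (f x)^-1) * (fun x => (f x)^-1)) * (derive1 f)).
  by apply: CkM; [apply: CkN; exact: CkM|case: cf].
by apply/funext => x; rewrite !fctE /= -expr2 exprVn.
Qed.

Lemma Ck_affine n f (a b : R) : Ck n f -> Ck n (fun x => f (a * x + b)).
Proof.
elim: n f => [//|n IH] f cf.
apply: (@Ck_derive _ _ (fun x => (derive1 f) (a * x + b) * a)).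
  move=> x; have H1 : is_derive x 1 (fun x : R => a * x + b) a.
    apply: (@is_derive_eq _ _ _ _ _ _ _ _ (is_deriveD
      (is_deriveM (is_derive_cst a x 1) (is_derive_id x 1)) (is_derive_cst b x 1))).
    by rewrite /GRing.scale/= mulr0 !addr0 mulr1.
  have H2 := Ck_is_derive (a * x + b) cf.
  exact: (@is_derive1_comp _ f (fun x : R => a * x + b)).
have [_ /IH c'] := cf.
by apply: (@CkM _ (fun x => (derive1 f) (a * x + b)) (cst a)) => //; exact: Ck_cst.
Qed.

(** Agreement near a point passes to the derivatives near it. This serves for functions glued from
    several formulas, such as [kink_approx]. *)
Lemma Ck_local n f :
  (forall t, exists2 g, Ck n g & \forall x \near t, f x = g x) -> Ck n f.
Proof.
elim: n f => [//|n IH] f H; split => [t|].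
  have [g [dg _] fg] := H t.
  by apply: (@near_eq_derivable _ _ _ g) => //; near do apply/esym.
apply: IH => t; have [g [_ cg] fg] := H t.
exists (derive1 g) => //.
have : \forall x \near t, \forall y \near x, f y = g y by exact: near_join.
apply: filterS => x fgx; rewrite !derive1E; exact: near_eq_derive.
Unshelve. all: by end_near. Qed.

Lemma smooth_cst (c : R) : smooth (cst c).
Proof. by move=> n; exact: Ck_cst. Qed.

Lemma smoothD f g : smooth f -> smooth g -> smooth (f + g).
Proof. by move=> sf sg n; exact: CkD. Qed.

Lemma smoothM f g : smooth f -> smooth g -> smooth (f * g).
Proof. by move=> sf sg n; exact: CkM. Qed.

Lemma smooth_affine f (a b : R) : smooth f -> smooth (fun x => f (a * x + b)).
Proof. by move=> sf n; exact: Ck_affine. Qed.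

Lemma smooth_local f :
  (forall t, exists2 g, smooth g & \forall x \near t, f x = g x) -> smooth f.
Proof. by move=> H n; apply: Ck_local => t; have [g] := H t; exists g. Qed.

Lemma smooth_id : smooth id.
Proof.
by move=> [//|n]; apply: (@Ck_derive _ _ (cst 1)); exact: Ck_cst.
Qed.

(* The derivative of [x |-> p (1 / x) exp (- 1 / x)] is again of this form, for
   another polynomial [p], so that these functions are smooth at [0]. *)
Definition flat (p : {poly R}) x :=
  if 0 < x then p.[x^-1] * expR (- x^-1) else 0.

(** A term of high enough degree of the exponential series beats [p] by one power. The remaining
    [y^-1] becomes [|x|] for [y = 1 / x], which is all that differentiability at 0 requires. *)
Lemma horner_expRN_le (p : {poly R}) :
  exists2 C : R, 0 <= C & forall y, 1 <= y -> `|p.[y] * expR (- y)| <= C * y^-1.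
Proof.
pose n := size p; pose S : R := \sum_(i < n) `|p`_i|.
exists (S * n.+1`!%:R); first by rewrite mulr_ge0// sumr_ge0.
move=> y y1; have y0 : 0 < y by exact: lt_le_trans y1.
have py : `|p.[y]| <= S * y ^+ n.
  rewrite horner_coef (le_trans (ler_norm_sum _ _ _))// mulr_suml ler_sum// => i _.
  rewrite normrM ler_wpM2l// ger0_norm ?exprn_ge0 ?(ltW y0)//.
  by rewrite ler_weXn2l// (ltnW (ltn_ord i)).
have ey : expR (- y) <= n.+1`!%:R / y ^+ n.+1.
  rewrite expRN -[leRHS]invrK lef_pV2 ?posrE ?expR_gt0 ?invr_gt0//; last first.
    by rewrite divr_gt0// ?exprn_gt0// ltr0n fact_gt0.
  by rewrite invf_div (le_trans _ (expR_ge1Dxn n (ltW y0)))// lerDr.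
rewrite normrM (ger0_norm (expR_ge0 _)).
rewrite (le_trans (ler_pM _ _ py ey)) ?expR_ge0//.
rewrite exprS invfM; set z : R := y ^+ n.
rewrite [leLHS](_ : _ = S * n.+1`!%:R * y^-1 * (z * z^-1)); last by ring.
by rewrite divff ?mulr1// gt_eqF// exprn_gt0.
Qed.

Lemma flat_le (p : {poly R}) :
  exists2 C : R, 0 <= C & forall x, x <= 1 -> `|flat p x| <= C * `|x|.
Proof.
have [C C0 HC] := horner_expRN_le p; exists C => // x x1.
rewrite /flat; case: ifPn => x0; last by rewrite normr0 mulr_ge0.
rewrite (gtr0_norm x0) -[x in leRHS]invrK; apply: HC.
by rewrite -[leLHS]invr1 lef_pV2 ?posrE.
Qed.

Lemma is_derive_flat (p : {poly R}) x :
  is_derive x 1 (flat p) (flat ('X^2 * (p - p^`())) x).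
Proof.
have [x0|x0|<-] := ltrgtP 0 x.
- rewrite /flat x0.
  pose g := fun x : R => p.[x^-1] * expR (- x^-1).
  apply: (@near_eq_is_derive _ _ _ g).
    near=> y; rewrite /flat /g ifT//; near: y; exact: lt_nbhsr.
  have dV : is_derive x 1 (fun y : R => y^-1) (- x ^- 2).
    apply: (@is_derive_eq _ _ _ _ _ _ _ _ (@is_deriveV _ id x 1 1 _ _)).
      by rewrite gt_eqF.
    by rewrite /GRing.scale/= mulr1.
  have dVN : is_derive x 1 (fun y : R => - y^-1) (x ^- 2).
    apply: (@is_derive_eq _ _ _ _ _ _ _ _ (@is_deriveN _ _ _ _ _ _ _ dV)).
    by rewrite opprK.
  have d1 := @is_derive1_comp _ (horner p) (fun y : R => y^-1) x _ _
    (is_derive_poly p x^-1) dV.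
  have d2 := @is_derive1_comp _ expR (fun y : R => - y^-1) x _ _
    (is_derive_expR (- x^-1)) dVN.
  apply: (@is_derive_eq _ _ _ _ _ _ _ _ (is_deriveM d1 d2)).
  rewrite /GRing.scale/= !hornerE /=; field; exact/lt0r_neq0.
- rewrite /flat ifF; last by rewrite ltNge ltW.
  apply: (@near_eq_is_derive _ _ _ (cst 0 : R -> R)).
  near=> y; rewrite /flat ifF//; apply/negbTE; rewrite -leNgt.
  apply: ltW; near: y; exact: lt_nbhsl.
(* At 0 the difference quotient [h^-1 * flat p h] is itself a flat function, for the polynomial
   ['X * p], so it tends to 0. *)
have [C C0 HC] := flat_le ('X * p).
have q (h : R) : h^-1 * flat p h = flat ('X * p) h.
  by rewrite /flat; case: ifP => h0; [rewrite !hornerE/=; ring|rewrite mulr0].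
have cv : (fun h : R => h^-1 *: ((flat p \o shift 0) (h *: (1 : R)) - flat p 0)) @ 0^'
    --> (0 : R).
  apply/cvgrPdist_le => e e0.
  near=> h; rewrite sub0r normrN /= /GRing.scale/= addr0 mulr1.
  rewrite [flat p 0]/flat ltxx subr0 q.
  rewrite (le_trans (HC _ _))//.
    apply: ltW; near: h; apply: nbhs_dnbhs; exact: lt_nbhsl.
  rewrite (@le_trans _ _ ((C + 1) * `|h|)) ?ler_wpM2r ?lerDl//.
  rewrite -ler_pdivlMl ?ltr_wpDl//.
  near: h; apply: dnbhs0_le; by rewrite mulr_gt0// invr_gt0 ltr_wpDl.
rewrite [X in is_derive _ _ _ X]/flat ltxx.
apply: DeriveDef; first by apply/cvg_ex; exists 0.
exact/cvg_lim.
Unshelve. all: by end_near. Qed.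

Lemma smooth_flat (p : {poly R}) : smooth (flat p).
Proof.
move=> n; elim: n p => [//|n IH] p.
exact: (Ck_derive (is_derive_flat p) (IH _)).
Qed.

(** The usual quotient f(x) / (f(x) + f(1 - x)), with f(x) = exp(- 1 / x) for x > 0 and 0 otherwise;
    the denominator is positive because x or 1 - x is. *)
Lemma smooth_step : exists S : R -> R, [/\ smooth S,
  forall x, x <= 0 -> S x = 0, forall x, 1 <= x -> S x = 1 &
  forall x, 0 <= S x <= 1].
Proof.
pose f := flat 1; pose g x := f (-1 * x + 1).
have fge0 x : 0 <= f x by rewrite /f /flat; case: ifP => // _; rewrite hornerE mul1r expR_ge0.
have fgt0 x : 0 < x -> 0 < f x.
  by move=> x0; rewrite /f /flat x0 hornerE mul1r expR_gt0.
have f0 x : x <= 0 -> f x = 0 by rewrite leNgt /f /flat => /negbTE ->.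
have fg0 x : 0 < f x + g x.
  have [x0|x0] := ltP 0 x; first by rewrite ltr_wpDr ?fgt0 ?fge0.
  by rewrite ltr_wpDl ?fge0// fgt0//; lra.
exists (f * (fun x => ((f + g) x)^-1)); split.
- have sg : smooth g by apply: smooth_affine; exact: smooth_flat.
  apply: smoothM; first exact: smooth_flat.
  move=> n; apply: CkV => [x|]; first exact/lt0r_neq0/fg0.
  exact: (smoothD (smooth_flat _) sg).
- by move=> x x0; rewrite !fctE f0// mul0r.
- move=> x x1; rewrite !fctE [g x]f0 ?addr0 ?divff//; last by lra.
  by rewrite gt_eqF// fgt0//; lra.
- move=> x; have := fg0 x; rewrite !fctE => H.
  apply/andP; split; first exact: divr_ge0 (fge0 _) (ltW H).
  by rewrite ler_pdivrMr// mul1r lerDl; exact: fge0.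
Qed.

End smooth_functions.

(** * The Euclidean and noise norms *)

Section euclidean_norm.
Context {R : realType} {d : nat}.
Implicit Types (x y : 'rV[R]_d).

Lemma edotC x y : edot x y = edot y x.
Proof. by apply: eq_bigr => i _; rewrite mulrC. Qed.

Lemma edotDl x y z : edot (x + y) z = edot x z + edot y z.
Proof. by rewrite -big_split/=; apply: eq_bigr => i _; rewrite !mxE mulrDl. Qed.

Lemma edotZl (a : R) x y : edot (a *: x) y = a * edot x y.
Proof. by rewrite /edot mulr_sumr; apply: eq_bigr => i _; rewrite !mxE mulrA. Qed.

Lemma edotDr x y z : edot z (x + y) = edot z x + edot z y.
Proof. by rewrite edotC edotDl !(edotC z). Qed.

Lemma edotZr (a : R) x y : edot y (a *: x) = a * edot y x.
Proof. by rewrite edotC edotZl edotC. Qed.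

Lemma edot_ge0 x : 0 <= edot x x.
Proof. by apply: sumr_ge0 => i _; rewrite -expr2 sqr_ge0. Qed.

Lemma enorm_ge0 x : 0 <= enorm x.
Proof. exact: sqrtr_ge0. Qed.

Lemma sqr_enorm x : enorm x ^+ 2 = edot x x.
Proof. by rewrite sqr_sqrtr// edot_ge0. Qed.

Lemma enorm_leP x (c : R) : 0 <= c -> (enorm x <= c) = (edot x x <= c ^+ 2).
Proof.
by move=> c0; rewrite -(ler_pXn2r (n := 2)) ?nnegrE ?enorm_ge0// sqr_enorm.
Qed.

Lemma coord_le_enorm x i : `|x ord0 i| <= enorm x.
Proof.
rewrite -sqrtr_sqr ler_wsqrtr// /edot (bigD1 i)//= -expr2 lerDl.
by apply: sumr_ge0 => j _; rewrite -expr2 sqr_ge0.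
Qed.

Lemma enorm_le_sum x : enorm x <= \sum_i `|x ord0 i|.
Proof.
have s0 : 0 <= \sum_i `|x ord0 i| by exact: sumr_ge0.
rewrite enorm_leP// expr2 mulr_suml /edot ler_sum// => i _.
rewrite -expr2 -real_normK ?num_real// expr2 ler_wpM2l//.
by rewrite (bigD1 i)//= lerDl sumr_ge0.
Qed.

Lemma enorm_eq0 x : (enorm x == 0) = (x == 0).
Proof.
apply/eqP/eqP => [x0|->]; last first.
  by rewrite /enorm /edot big1 ?sqrtr0// => i _; rewrite mxE mul0r.
apply/rowP => i; rewrite mxE; apply/eqP; rewrite -normr_le0 -x0.
exact: coord_le_enorm.
Qed.

Lemma enorm0 : enorm (0 : 'rV[R]_d) = 0.
Proof. by apply/eqP; rewrite enorm_eq0. Qed.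

Lemma enormZ (a : R) x : enorm (a *: x) = `|a| * enorm x.
Proof.
rewrite /enorm edotZl edotZr mulrA -expr2 sqrtrM ?sqr_ge0//.
by rewrite sqrtr_sqr.
Qed.

Lemma enormN x : enorm (- x) = enorm x.
Proof. by rewrite -scaleN1r enormZ normrN1 mul1r. Qed.

Lemma enormBC x y : enorm (x - y) = enorm (y - x).
Proof. by rewrite -enormN opprB. Qed.

Lemma edot_le_enorm x y : edot x y <= enorm x * enorm y.
Proof.
have [->|y0] := eqVneq y 0.
  by rewrite enorm0 mulr0 -(scale0r 0) edotZr mul0r.
have ypos : 0 < edot y y.
  by rewrite -sqr_enorm exprn_gt0// lt_neqAle enorm_ge0 eq_sym enorm_eq0 y0.
have [xy0|xy0] := leP (edot x y) 0.
  by rewrite (le_trans xy0)// mulr_ge0 ?enorm_ge0.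
rewrite -(ler_pXn2r (n := 2)) ?nnegrE ?(ltW xy0) ?mulr_ge0 ?enorm_ge0//.
rewrite exprMn !sqr_enorm.
(* The component of [x] orthogonal to [y], multiplied by [|y|^2] to avoid a division. *)
have := edot_ge0 (edot y y *: x - edot x y *: y).
rewrite -scaleNr !(edotDl, edotDr, edotZl, edotZr) (edotC y x).
set a := edot x x; set b := edot x y; set c := edot y y.
rewrite (_ : _ + _ = c * (a * c - b ^+ 2)); last by ring.
by rewrite pmulr_rge0// subr_ge0.
Qed.

Lemma enormD x y : enorm (x + y) <= enorm x + enorm y.
Proof.
rewrite enorm_leP ?addr_ge0 ?enorm_ge0//.
rewrite sqrrD !sqr_enorm !(edotDl, edotDr) (edotC y x).
have := edot_le_enorm x y; set p := edot x y; set q := _ * _ => pq.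
rewrite mulr2n; lra.
Qed.

Lemma mx_norm_leP x (c : R) : 0 <= c ->
  (`|x| <= c <-> forall i, `|x ord0 i| <= c).
Proof.
move=> c0; rewrite /Num.norm/= mx_normrE; split => [H i|H].
  rewrite (le_trans _ H)//.
  exact: (@le_bigmax _ _ _ 0 (fun ij => `|x ij.1 ij.2|) (ord0, i)).
by apply/bigmax_leP; split=> [|[i j] _]; [exact: c0|rewrite /= [i]ord1; exact: H].
Qed.

Lemma coord_le_mx_norm x i : `|x ord0 i| <= `|x|.
Proof. exact: (proj1 (mx_norm_leP x (normr_ge0 x)) (lexx _)). Qed.

Lemma mx_norm_le_enorm x : `|x| <= enorm x.
Proof.
by apply/mx_norm_leP; [exact: enorm_ge0|move=> i; exact: coord_le_enorm].
Qed.

Lemma enorm_le_mx_norm x : enorm x <= d%:R * `|x|.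
Proof.
rewrite (le_trans (enorm_le_sum x))//.
rewrite (le_trans (ler_sum _ (fun i _ => coord_le_mx_norm x i)))//.
by rewrite sumr_const card_ord mulr_natl lexx.
Qed.

End euclidean_norm.

Section noise_norm.
Context {R : realType} {d : nat} (H : R).
Implicit Types (w u : R -> 'rV[R]_d) (s t e : R).

Definition noise_weight s t :=
  Num.sqrt (1 + `|s| + `|t|) * `|s - t| `^ ((1 - H) / 2).

(** A division-free form of [noise_norm H w <= e], in which the diagonal needs no separate treatment
    and increments can be split at an intermediate time. *)
Definition noise_le w e := forall s t, s <= 0 -> t <= 0 ->
  enorm (w s - w t) <= e * noise_weight s t.

Lemma noise_weight_ge0 s t : 0 <= noise_weight s t.
Proof. by rewrite mulr_ge0 ?sqrtr_ge0 ?powR_ge0. Qed.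

Lemma noise_weight_gt0 s t : s != t -> 0 < noise_weight s t.
Proof.
by move=> st; rewrite mulr_gt0 ?powR_gt0 ?normr_gt0 ?subr_eq0.
Qed.

Lemma noise_weightC s t : noise_weight s t = noise_weight t s.
Proof. by rewrite /noise_weight distrC addrAC. Qed.

Lemma noise_norm_leP w e : 0 <= e -> (noise_norm H w <= e%:E)%E <-> noise_le w e.
Proof.
move=> e0; split => [He s t s0 t0|He].
  have [->|st] := eqVneq s t; first by rewrite subrr enorm0 mulr_ge0 ?noise_weight_ge0.
  rewrite -ler_pdivrMr ?noise_weight_gt0// -lee_fin (le_trans _ He)//.
  by apply: ereal_sup_ubound; exists (s, t).
apply: ge_ereal_sup => _ [[s t]/= [s0 t0 st] <-]; rewrite lee_fin.
by rewrite ler_pdivrMr ?He ?noise_weight_gt0.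
Qed.

Lemma noise_norm_lt w e : noise_le w (e / 2) -> 0 < e -> (noise_norm H w < e%:E)%E.
Proof.
move=> we e0; have e2 : 0 <= e / 2 by rewrite divr_ge0// ltW.
have := (proj2 (noise_norm_leP w e2) we) => /le_lt_trans; apply.
by rewrite lte_fin; lra.
Qed.

Lemma noise_leW w e e' : e <= e' -> noise_le w e -> noise_le w e'.
Proof.
move=> ee' we s t s0 t0; rewrite (le_trans (we s t s0 t0))//.
by rewrite ler_wpM2r ?noise_weight_ge0.
Qed.

Lemma noise_leD w u e e' : noise_le w e -> noise_le u e' ->
  noise_le (w \+ u) (e + e').
Proof.
move=> we ue s t s0 t0; rewrite /= opprD addrACA.
by rewrite (le_trans (enormD _ _))// mulrDl lerD ?we ?ue.
Qed.

Lemma noise_leN w e : noise_le w e -> noise_le (fun s => - w s) e.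
Proof. by move=> we s t s0 t0; rewrite -opprD enormN; exact: we. Qed.

Lemma noise_leBC w u e : noise_le (w \- u) e -> noise_le (u \- w) e.
Proof.
move=> /noise_leN; congr noise_le.
by apply/funext => s /=; rewrite opprB.
Qed.

Lemma noise_leB_trans w u v e e' : noise_le (w \- u) e -> noise_le (u \- v) e' ->
  noise_le (w \- v) (e + e').
Proof.
move=> wu uv; have := noise_leD wu uv; congr noise_le.
by apply/funext => s /=; rewrite addrA subrK.
Qed.

Lemma noise_le_coord w e : 0 <= e ->
  (forall i s t, s <= 0 -> t <= 0 ->
     `|w s ord0 i - w t ord0 i| <= e * noise_weight s t) ->
  noise_le w (d%:R * e).
Proof.
move=> e0 we s t s0 t0; rewrite (le_trans (enorm_le_mx_norm _))//.
rewrite -mulrA ler_wpM2l//; apply/mx_norm_leP.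
  by rewrite mulr_ge0// noise_weight_ge0.
by move=> i; rewrite !mxE; exact: we.
Qed.

Lemma noise_le0 w e : extended_path w -> noise_le w e ->
  forall t, t <= 0 -> enorm (w t) <= e * noise_weight t 0.
Proof. by move=> [w0 _] we t t0; rewrite -[w t]subr0 -w0; exact: we. Qed.

Lemma noise_le_eq w u : extended_path w -> extended_path u ->
  (forall e, 0 < e -> noise_le (w \- u) e) -> w = u.
Proof.
move=> [w0 wp] [u0 up] wu; apply/funext => t.
have [t0|t0] := ltP 0 t; first by rewrite wp// up.
have [->|t1] := eqVneq t 0; first by rewrite w0 u0.
apply/eqP; rewrite -subr_eq0 -enorm_eq0 -normr_le0 (ger0_norm (enorm_ge0 _)).
apply/ler_addgt0Pr => e e0; rewrite add0r.
have W := noise_weight_gt0 t1.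
have := wu (e / noise_weight t 0) _ t 0 t0 (lexx _).
by rewrite /= w0 u0 !subr0 divfK ?gt_eqF//; apply; rewrite divr_gt0.
Qed.

Lemma noise_pathP w : noise_path H w <->
  extended_path w /\ forall e, 0 < e -> exists2 u, test_path u & noise_le (w \- u) e.
Proof.
split => -[ew He]; split => // e e0.
  have [u tu /ltW] := He e e0.
  by move=> /noise_norm_leP => /(_ (ltW e0)); exists u.
have [|u tu wu] := He (e / 2); first by rewrite divr_gt0.
by exists u => //; exact: noise_norm_lt.
Qed.

Lemma extended_pathD w u : extended_path w -> extended_path u ->
  extended_path (w \+ u).
Proof.
move=> [w0 wp] [u0 up]; split => [|t t0] /=; first by rewrite w0 u0 addr0.
by rewrite wp// up// addr0.
Qed.

Lemma test_pathD w u : test_path w -> test_path u -> test_path (w \+ u).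
Proof.
move=> [ew [M wM] [g sg wg]] [eu [N uN] [h sh uh]]; split.
- exact: extended_pathD.
- exists (Num.min M N) => t; rewrite lt_min => /andP[tM tN] /=.
  by rewrite wM// uN// addr0.
- exists (g \+ h) => [i|t t0]; last by rewrite /= wg// uh.
  apply/smoothP; rewrite (_ : (fun _ => _) = (fun s => g s ord0 i) + (fun s => h s ord0 i)).
    by apply: smoothD; exact/smoothP.
  by apply/funext => s; rewrite /= mxE.
Qed.

Lemma test_path_noise w : test_path w -> noise_path H w.
Proof.
move=> tw; apply/noise_pathP; split=> [|e e0]; first by case: tw.
exists w => // s t _ _; rewrite /= !subrr enorm0 mulr_ge0 ?(ltW e0)//.
exact: noise_weight_ge0.
Qed.

Lemma noise_path_closed w : extended_path w ->
  (forall e, 0 < e -> exists2 u, noise_path H u & noise_le (w \- u) e) ->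
  noise_path H w.
Proof.
move=> ew Hw; apply/noise_pathP; split => // e e0.
have e2 : 0 < e / 2 by rewrite divr_gt0.
have [u /noise_pathP[eu Hu] wu] := Hw _ e2.
have [v tv uv] := Hu _ e2.
by exists v => //; rewrite (splitr e); exact: noise_leB_trans wu uv.
Qed.

Lemma noise_leD2 w u w' u' e e' : noise_le (w \- w') e -> noise_le (u \- u') e' ->
  noise_le ((w \+ u) \- (w' \+ u')) (e + e').
Proof.
move=> we ue; have := noise_leD we ue; congr noise_le.
by apply/funext => s /=; rewrite opprD addrACA.
Qed.

Lemma noise_pathD w u : noise_path H w -> noise_path H u -> noise_path H (w \+ u).
Proof.
move=> /noise_pathP[ew Hw] /noise_pathP[eu Hu]; apply/noise_pathP.
split => [|e e0]; first exact: extended_pathD.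
have e2 : 0 < e / 2 by rewrite divr_gt0.
have [w' tw' ww'] := Hw _ e2; have [u' tu' uu'] := Hu _ e2.
exists (w' \+ u'); first exact: test_pathD.
by rewrite (splitr e); exact: noise_leD2.
Qed.

End noise_norm.

(** * Smoothing a kink *)

Section lipschitz.
Context {R : realType}.
Implicit Types (f : R -> R) (a b x y : R).

Lemma smooth_lipschitz f a b : smooth f -> exists2 L, 0 <= L &
  forall x y, a <= x <= b -> a <= y <= b -> `|f x - f y| <= L * `|x - y|.
Proof.
move=> sf; have [ba|ab] := ltP b a.
  by exists 0 => // x y /andP[ax xb]; lra.
have cf : {within `[a, b], continuous (fun x => `|derive1 f x|)}.
  apply: continuous_subspaceT => x; apply: continuous_comp.
    exact: smooth_continuous (smooth_derive sf) x.
  exact: norm_continuous.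
have [c cab Hc] := EVT_max ab cf.
exists `|derive1 f c| => // x y; wlog xy : x y / x <= y => [W|] axb ayb.
  by have [/W|/ltW/W] := leP x y; [exact|rewrite distrC (distrC x); exact].
have df z : z \in `]x, y[%R -> is_derive z 1 f (derive1 f z).
  by move=> _; rewrite derive1E; apply: derivableP; exact: smooth_derivable.
have cxy : {within `[x, y], continuous f}.
  by apply: continuous_subspaceT; exact: smooth_continuous.
have [z zxy fxy] := MVT_segment xy df cxy.
rewrite distrC fxy normrM (distrC x) ler_wpM2r//; apply: Hc.
by move: zxy axb ayb; rewrite !in_itv/=; lra.
Qed.

Lemma smooth_lipschitz_cst f a b : a <= b -> smooth f ->
  (forall x, x <= a -> f x = f a) -> (forall x, b <= x -> f x = f b) ->
  exists2 L, 0 <= L & forall x y, `|f x - f y| <= L * `|x - y|.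
Proof.
move=> ab sf fa fb; have [L L0 HL] := smooth_lipschitz a b sf.
exists L => // x y.
(* Clamping to [[a, b]] does not change the value of [f] and does not increase distances, so the
   local constant is global. *)
pose c x := Num.max a (Num.min x b).
have cab z : a <= c z <= b.
  by rewrite /c le_max lexx/= ge_max ab/= ge_min lexx orbT.
have fc z : f z = f (c z).
  rewrite /c; have [zb|zb] := ltP z b; have [za|za] := leP a _ => //.
  - by rewrite fa// ltW.
  - by rewrite fb.
  - by rewrite fb//; congr f; apply/eqP; rewrite eq_le ab ltW.
have cc : `|c x - c y| <= `|x - y|.
  rewrite /c; wlog xy : x y / x <= y => [W|].
    by have [/W//|/ltW/W] := leP x y; rewrite distrC (distrC x).
  rewrite (distrC x) (distrC (Num.max _ _)) (ger0_norm (_ : 0 <= y - x)); last by lra.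
  by case: (leP y b) => yb; case: (leP x b) => xb;
    case: (leP a x) => ax; case: (leP a y) => ay; move: (ab); case: (leP a b) => // _ _;
    rewrite ler_norml; lra.
rewrite fc (fc y) (le_trans (HL _ _ (cab _) (cab _)))//.
by rewrite ler_wpM2l.
Qed.

(** Up to [h = e] the Lipschitz bound is used, beyond it the uniform bound. A Lipschitz function of
    size O(e) thus has a b-Hölder constant of order e^(1-b). *)
Lemma holder_interp (b e a h L B : R) : 0 < b < 1 -> 0 < e -> 0 <= h ->
  0 <= L -> 0 <= B -> a <= L * h -> a <= B ->
  a <= (L + B / e) * e `^ (1 - b) * h `^ b.
Proof.
move=> /andP[b0 b1] e0 h0 L0 B0 aL aB.
have e1 : 0 < e `^ (1 - b) by exact: powR_gt0.
have hb : 0 <= h `^ b by exact: powR_ge0.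
have Be : 0 <= B / e by rewrite divr_ge0// ltW.
rewrite 2!mulrDl; have [he|eh] := leP h e.
  have Lh : L * h <= L * e `^ (1 - b) * h `^ b.
    rewrite -mulrA ler_wpM2l//.
    have [->|hn0] := eqVneq h 0; first by rewrite mulr_ge0// ltW.
    have hE : h = h `^ (1 - b) * h `^ b.
      by rewrite -powRD ?subrK ?powRr1// hn0 implybT.
    rewrite [leLHS]hE ler_wpM2r// ge0_ler_powR ?nnegrE ?(ltW e0)//.
    by rewrite subr_ge0 ltW.
  rewrite (le_trans aL)// (le_trans Lh)// lerDl.
  exact: mulr_ge0 (mulr_ge0 Be (ltW e1)) hb.
have Bh : B <= B / e * e `^ (1 - b) * h `^ b.
  have eE : e = e `^ (1 - b) * e `^ b.
    by rewrite -powRD ?subrK ?powRr1 ?(ltW e0)// (gt_eqF e0) implybT.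
  have -> : B / e * e `^ (1 - b) * h `^ b =
      B / e * e `^ (1 - b) * e `^ b * (h `^ b / e `^ b).
    by rewrite [RHS]mulrACA divff ?mulr1 ?mulrA// gt_eqF// powR_gt0.
  rewrite -[_ * e `^ b]mulrA -eE divfK ?gt_eqF//.
  rewrite ler_peMr// ler_pdivlMr ?powR_gt0// mul1r.
  by rewrite ge0_ler_powR ?nnegrE ?(ltW eh) ?(ltW e0) ?(ltW b0).
rewrite (le_trans aB)// (le_trans Bh)// lerDr.
exact: mulr_ge0 (mulr_ge0 L0 (ltW e1)) hb.
Qed.

End lipschitz.

Section kink.
Context {R : realType} (S : R -> R).
Implicit Types (x y s e N : R).
Hypotheses (sS : smooth S) (S0 : forall x, x <= 0 -> S x = 0)
  (S1 : forall x, 1 <= x -> S x = 1) (S01 : forall x, 0 <= S x <= 1).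

(** The complement of a bump: 0 on [-1, 1] and 1 beyond distance 2. Multiplying by a rescaled [hump]
    erases a kink. *)
Definition hump x := S (x - 1) + S (- x - 1).

Lemma hump0 x : -1 <= x <= 1 -> hump x = 0.
Proof. by move=> /andP[x0 x1]; rewrite /hump !S0 ?addr0//; lra. Qed.

Lemma hump1 x : 2 <= `|x| -> hump x = 1.
Proof.
rewrite /hump; have [x0|x0] := leP 0 x => x2.
  by rewrite ger0_norm// in x2; rewrite S1 ?S0 ?addr0//; lra.
by rewrite ltr0_norm// in x2; rewrite S0 ?S1 ?add0r//; lra.
Qed.

Lemma hump01 x : 0 <= hump x <= 1.
Proof.
rewrite /hump; have [x0|x0] := leP 0 x.
  by rewrite (S0 (x := - x - 1)) ?addr0//; lra.
by rewrite (S0 (x := x - 1)) ?add0r//; lra.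
Qed.

Lemma smooth_hump : smooth hump.
Proof.
have := smoothD (smooth_affine 1 (-1) sS) (smooth_affine (-1) (-1) sS).
by congr smooth; apply/funext => x; rewrite !fctE /hump mul1r mulN1r.
Qed.

Lemma step_lipschitz : exists2 L, 0 <= L & forall x y, `|S x - S y| <= L * `|x - y|.
Proof.
apply: (@smooth_lipschitz_cst _ _ 0 1) => //.
  by move=> x x0; rewrite !S0.
by move=> x x1; rewrite !S1.
Qed.

Lemma hump_lipschitz : exists2 L, 0 <= L & forall x y, `|hump x - hump y| <= L * `|x - y|.
Proof.
apply: (@smooth_lipschitz_cst _ _ (-2) 2) => //; first by lra.
- exact: smooth_hump.
- move=> x x2; rewrite !hump1//; first by rewrite normrN ger0_norm.
  by rewrite ler0_norm; lra.
- move=> x x2; rewrite !hump1//; first by rewrite ger0_norm.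
  by rewrite ger0_norm; lra.
Qed.

Variables (t : R) (v g m : R -> R) (M : R).
Hypotheses (t0 : 0 < t) (v0 : v 0 = 0) (sg : smooth g) (sm : smooth m)
  (vg : forall s, - t <= s <= 0 -> v s = g s) (vm : forall s, s <= - t -> v s = m s)
  (mM : forall s, s < M -> m s = v (- t)).

Let glue (s : R) : R := if - t <= s then g s else m s.

Let glueE s : s <= 0 -> glue s = v s.
Proof.
move=> s0; rewrite /glue; case: leP => st; first by rewrite vg// st.
by rewrite vm// ltW.
Qed.

(* Within distance [e] of [- t] the kink is replaced by the constant [v (- t)],
   which is itself cut off between [- 2 N] and [- N]. *)
Definition kink_approx e N s :=
  v (- t) * S (2 + s / N) + hump ((s + t) / e) * (glue s - v (- t)).

Lemma kink_approxE e N s : s <= 0 ->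
  kink_approx e N s = v (- t) * S (2 + s / N) + hump ((s + t) / e) * (v s - v (- t)).
Proof. by move=> s0; rewrite /kink_approx glueE. Qed.

Lemma smooth_kink_approx e N : 0 < e -> smooth (kink_approx e N).
Proof.
move=> e0.
have s1 : smooth (fun s => v (- t) * S (2 + s / N)).
  have := smoothM (smooth_cst (v (- t))) (smooth_affine N^-1 2 sS).
  by congr smooth; apply/funext => s; rewrite !fctE (mulrC N^-1) (addrC 2).
have s2 : smooth (fun s => hump ((s + t) / e)).
  have := smooth_affine e^-1 (t / e) smooth_hump.
  by congr smooth; apply/funext => s; congr hump; rewrite mulrDl mulrC.
have sy (f : R -> R) : smooth f -> smooth (fun s => f s - v (- t)).
  move=> sf; exact: (smoothD sf (smooth_cst (- v (- t)))).
(* Off [- t] only one of [g] and [m] is seen nearby; within distance [e] of [- t] the hump vanishes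
   and neither is. *)
apply: smooth_local => s; have [st|st|st] := ltrgtP s (- t).
- exists ((fun s => v (- t) * S (2 + s / N)) +
    (fun s => hump ((s + t) / e)) * (fun s => m s - v (- t))).
    by apply: smoothD => //; apply: smoothM => //; exact: sy.
  near=> z; rewrite /kink_approx /glue ifF//; apply/negbTE; rewrite -ltNge.
  near: z; exact: lt_nbhsl.
- exists ((fun s => v (- t) * S (2 + s / N)) +
    (fun s => hump ((s + t) / e)) * (fun s => g s - v (- t))).
    by apply: smoothD => //; apply: smoothM => //; exact: sy.
  near=> z; rewrite /kink_approx /glue ifT//; apply: ltW.
  near: z; exact: lt_nbhsr.
- exists (fun s => v (- t) * S (2 + s / N)) => //.
  near=> z; rewrite /kink_approx hump0 ?mul0r ?addr0//.
  rewrite -ler_norml normrM normfV (gtr0_norm e0) ler_pdivrMr// mul1r.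
  rewrite -[t]opprK -st distrC; apply: ltW.
  by near: z; exact: (@nbhsx_ballx R R^o s e e0).
Unshelve. all: by end_near. Qed.

Let vMt s : s < Num.min M (- t) -> v s = v (- t).
Proof. by rewrite lt_min => /andP[sM st]; rewrite vm ?mM// ltW. Qed.

Lemma kink_lipschitz : exists2 L, 0 <= L &
  forall s s', s <= 0 -> s' <= 0 -> `|v s - v s'| <= L * `|s - s'|.
Proof.
pose M' := Num.min M (- t) - 1.
have [Lg Lg0 HLg] := smooth_lipschitz (- t) 0 sg.
have [Lm Lm0 HLm] := smooth_lipschitz M' (- t) sm.
have M't : M' <= - t.
  by have : Num.min M (- t) <= - t; [rewrite ge_min lexx orbT|rewrite /M'; lra].
have vM' : v M' = v (- t) by apply: vMt; rewrite /M'; lra.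
have Lm2 s s' : s <= s' -> s' <= - t -> `|v s - v s'| <= Lm * `|s - s'|.
  move=> ss' st'; have st : s <= - t by exact: le_trans st'.
  have [Ms|sM] := leP M' s.
    by rewrite !vm//; apply: HLm; rewrite ?Ms// st' andbT (le_trans Ms).
  have vsE : v s = v M' by rewrite vM' vMt//; move: sM; rewrite /M'; lra.
  have [Ms'|sM'] := leP M' s'; last first.
    rewrite vsE (_ : v s' = v M') ?subrr ?normr0 ?mulr_ge0//.
    by rewrite vM' vMt//; move: sM'; rewrite /M'; lra.
  rewrite vsE !vm//; apply: le_trans (HLm _ _ _ _) _; rewrite ?lexx ?M't ?Ms'//.
  by rewrite ler_wpM2l// distrC (distrC s) !ger0_norm; lra.
exists (Lg + Lm) => [|s s']; first exact: addr_ge0.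
wlog ss' : s s' / s <= s' => [W|s0 s0'].
  have [/W//|/ltW ss'] := leP s s'.
  by move=> s0 s0'; rewrite distrC (distrC s); exact: W.
have n0 := normr_ge0 (s - s').
have [st'|st'] := leP s' (- t).
  by rewrite (le_trans (Lm2 _ _ ss' st'))// ler_wpM2r// lerDr.
have [st|st] := leP (- t) s.
  rewrite !vg ?st//; last by rewrite (le_trans st).
  by rewrite (le_trans (HLg _ _ _ _)) ?st ?s0 ?s0'//= ?(le_trans st)// ler_wpM2r// lerDl.
rewrite -(subrKA (v (- t))) (le_trans (ler_normD _ _))//.
have H1 := Lm2 _ _ (ltW st) (lexx _).
have H2 : `|v (- t) - v s'| <= Lg * `|- t - s'|.
  by rewrite !vg; [apply: HLg| |]; rewrite ?lexx ?(ltW st') ?oppr_le0 ?(ltW t0) ?s0'.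
rewrite (le_trans (lerD H1 H2))// !ltr0_norm ?subr_lt0//; last exact: lt_trans st'.
have A1 : Lm * (s' - - t) >= 0 by rewrite mulr_ge0// subr_ge0 ltW.
have A2 : Lg * (- t - s) >= 0 by rewrite mulr_ge0// subr_ge0 ltW.
by rewrite -subr_ge0 (_ : _ - _ = Lm * (s' - - t) + Lg * (- t - s)) ?addr_ge0//; ring.
Qed.

(** The error is [A + Y]. The cut-off error [A] is bounded with Lipschitz constant O(1/N), the kink
    error [Y] is Lipschitz of size O(e); [holder_interp] at the scales [N] and [e] gives the two
    powers. *)
Lemma kink_approx_close (b : R) : 0 < b < 1 -> exists2 K, 0 <= K &
  forall e N s s', 0 < e -> 0 < N -> s <= 0 -> s' <= 0 ->
  `|(v s - kink_approx e N s) - (v s' - kink_approx e N s')| <=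
   K * (e `^ (1 - b) + N `^ (- b)) * `|s - s'| `^ b.
Proof.
move=> b01; have [L L0 HL] := kink_lipschitz.
have [LS LS0 HLS] := step_lipschitz; have [Lh Lh0 HLh] := hump_lipschitz.
pose K1 := `|v (- t)| * LS + `|v (- t)|; pose K2 := L + Lh * (2 * L) + 4 * L.
have K10 : 0 <= K1 by rewrite addr_ge0// mulr_ge0.
have K20 : 0 <= K2 by rewrite !addr_ge0// ?mulr_ge0// mulr_ge0.
exists (K1 + K2) => [|e N s s' e0 N0 s0 s0']; first exact: addr_ge0.
pose A s := v (- t) * (1 - S (2 + s / N)).
pose Y s := (1 - hump ((s + t) / e)) * (v s - v (- t)).
have E z : z <= 0 -> v z - kink_approx e N z = A z + Y z.
  by move=> z0; rewrite kink_approxE// /A /Y; ring.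
have HA : `|A s - A s'| <= K1 * N `^ (- b) * `|s - s'| `^ b.
  have -> : K1 * N `^ (- b) = (`|v (- t)| * LS / N + `|v (- t)| / N) * N `^ (1 - b).
    by rewrite powRD ?(gt_eqF N0) ?implybT// powRr1 ?(ltW N0)// /K1; field; rewrite gt_eqF.
  apply: holder_interp => //; rewrite ?divr_ge0 ?mulr_ge0 ?(ltW N0)//.
    have -> : A s - A s' = v (- t) * (S (2 + s' / N) - S (2 + s / N)) by rewrite /A; ring.
    rewrite normrM -!mulrA ler_wpM2l// (le_trans (HLS _ _))// ler_wpM2l//.
    rewrite (_ : 2 + s' / N - (2 + s / N) = (s' - s) / N); last by ring.
    by rewrite normrM distrC normfV (gtr0_norm N0) mulrC lexx.
  have -> : A s - A s' = v (- t) * (S (2 + s' / N) - S (2 + s / N)) by rewrite /A; ring.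
  rewrite normrM ler_piMr// ler_norml.
  by have := S01 (2 + s / N); have := S01 (2 + s' / N); lra.
have Ysup z : z <= 0 -> `|Y z| <= 2 * L * e.
  move=> z0; have [ze|ze] := leP 2 `|(z + t) / e|.
    by rewrite /Y hump1// subrr mul0r normr0 !mulr_ge0// ltW.
  rewrite /Y normrM (@le_trans _ _ (1 * (L * `|z + t|)))//.
    apply: ler_pM => //.
      by rewrite ler_norml; have := hump01 ((z + t) / e); lra.
    by rewrite (le_trans (HL _ _ z0 _)) ?opprK// oppr_le0 ltW.
  rewrite mul1r mulrAC mulrC ler_wpM2r//.
  by move: ze; rewrite normrM normfV (gtr0_norm e0) ltr_pdivrMr// => /ltW.
have YL : `|Y s - Y s'| <= (L + Lh * (2 * L)) * `|s - s'|.
  (* The rescaled hump has slope O(1/e). To compensate it, the factor [v - v (- t)] is taken at the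
     point nearer to [- t], where it is O(e) unless both humps equal 1. *)
  clear HA; move: s0 s0'; wlog ss' : s s' / `|s' + t| <= `|s + t| => [W|] s0 s0'.
    have [/W//|/ltW/W] := leP `|s' + t| `|s + t|; first exact.
    by rewrite distrC (distrC s); exact.
  have [se|se] := leP 2 `|(s' + t) / e|.
    have se' : 2 <= `|(s + t) / e|.
      rewrite (le_trans se)// !normrM ler_wpM2r//.
    by rewrite /Y !hump1// subrr !mul0r subrr normr0 mulr_ge0// addr_ge0// !mulr_ge0.
  have -> : Y s - Y s' = (1 - hump ((s + t) / e)) * (v s - v s') +
      (hump ((s' + t) / e) - hump ((s + t) / e)) * (v s' - v (- t)).
    by rewrite /Y; ring.
  rewrite (le_trans (ler_normD _ _))// [leRHS]mulrDl lerD//.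
    rewrite normrM -[leRHS]mul1r ler_pM// ?HL//.
    by rewrite ler_norml; have := hump01 ((s + t) / e); lra.
  rewrite normrM (@le_trans _ _ ((Lh * (`|s - s'| / e)) * (L * (2 * e))))//.
    apply: ler_pM => //.
      rewrite (le_trans (HLh _ _))// ler_wpM2l// -mulrBl normrM normfV (gtr0_norm e0).
      by rewrite ler_wpM2r ?invr_ge0 ?(ltW e0)// opprD addrACA subrr addr0 distrC.
    rewrite (le_trans (HL _ _ s0' _)) ?opprK// ?oppr_le0 ?(ltW t0)// ler_wpM2l//.
    by move: se; rewrite normrM normfV (gtr0_norm e0) ltr_pdivrMr// => /ltW.
  rewrite [leLHS](_ : _ = Lh * (2 * L) * `|s - s'| * (e / e)); last by ring.
  by rewrite divff ?mulr1// gt_eqF.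
have HY : `|Y s - Y s'| <= K2 * e `^ (1 - b) * `|s - s'| `^ b.
  rewrite (_ : K2 = L + Lh * (2 * L) + 4 * L * e / e); last first.
    by rewrite mulfK// gt_eqF.
  apply: holder_interp => //; rewrite ?addr_ge0 ?mulr_ge0 ?mulr_ge0 ?(ltW e0)//.
  rewrite (le_trans (ler_normB _ _))//.
  by have := Ysup _ s0; have := Ysup _ s0'; lra.
rewrite !E// opprD addrACA (le_trans (ler_normD _ _))// (le_trans (lerD HA HY))//.
rewrite -mulrDl ler_wpM2r ?powR_ge0//.
have p1 := powR_ge0 e (1 - b); have p2 := powR_ge0 N (- b).
have := mulr_ge0 K10 p1; have := mulr_ge0 K20 p2; lra.
Qed.

Lemma kink_approx_0 e N : 0 < e -> e <= t / 2 -> kink_approx e N 0 = 0.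
Proof.
move=> e0 et; rewrite kink_approxE// mul0r addr0 S1; last by lra.
rewrite add0r hump1 ?v0; first by ring.
rewrite ger0_norm ?divr_ge0 ?(ltW t0) ?(ltW e0)// ler_pdivlMr//; lra.
Qed.

Lemma kink_approx_Noo e N s : 0 < N -> s < Num.min (Num.min M (- t)) (- (2 * N)) ->
  kink_approx e N s = 0.
Proof.
move=> N0; rewrite lt_min => /andP[sM sN].
have s0 : s <= 0 by rewrite (le_trans (ltW sN))// oppr_le0 mulr_ge0// ltW.
rewrite kink_approxE// vMt// subrr mulr0 addr0 S0 ?mulr0//.
have : s / N <= - 2; last by lra.
by rewrite ler_pdivrMr//; lra.
Qed.

End kink.

(** * Shifted paths and ramps are noise paths *)

Section kinked_paths.
Context {R : realType} {d : nat} (H : R).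
Hypothesis hH : 0 < H < 1.
Implicit Types (v w u : R -> 'rV[R]_d) (t s e N : R).

Let b : R := (1 - H) / 2.

Let b01 : 0 < b < 1.
Proof. by rewrite /b; case/andP: hH => h0 h1; apply/andP; split; lra. Qed.

(* The form of a path obtained by gluing two test paths at [- t], as in [shift_path]:
   smooth on both sides of [- t] and equal to [v (- t)] near [-oo]. *)
Definition kinked t v := extended_path v /\
  exists (g m : 'I_d -> R -> R) (M : R), [/\ forall i, smooth (g i),
    forall i, smooth (m i),
    forall i s, - t <= s <= 0 -> v s ord0 i = g i s,
    forall i s, s <= - t -> v s ord0 i = m i s &
    forall i s, s < M -> m i s = v (- t) ord0 i].

Definition kink_path (S : R -> R) t v e N s : 'rV[R]_d :=
  if 0 < s then 0 else
  \row_i (v (- t) ord0 i * S (2 + s / N) +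
          hump S ((s + t) / e) * (v s ord0 i - v (- t) ord0 i)).

Definition is_step (S : R -> R) := [/\ smooth S, forall x, x <= 0 -> S x = 0,
  forall x, 1 <= x -> S x = 1 & forall x, 0 <= S x <= 1].

Lemma kink_path_test S t v e N : is_step S -> 0 < t -> kinked t v ->
  0 < e -> e <= t / 2 -> 0 < N -> test_path (kink_path S t v e N).
Proof.
move=> [sS S0 S1 S01] t0 [[v0 vp] [g [m [M [sg sm vg vm mM]]]]] e0 et N0.
have v0i i : v 0 ord0 i = 0 by rewrite v0 mxE.
pose u i := kink_approx S t (fun s => v s ord0 i) (g i) (m i) e N.
have uE i s : s <= 0 -> kink_path S t v e N s ord0 i = u i s.
  move=> s0; rewrite /kink_path ltNge s0/= mxE /u.
  by rewrite (kink_approxE S (vg i) (vm i)).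
have u0 i : u i 0 = 0 by exact: (kink_approx_0 S0 S1 t0 (v0i i) (vg i) (vm i)).
have k0 : kink_path S t v e N 0 = 0.
  by apply/rowP => i; rewrite uE// u0 mxE.
split.
- by split => // s s0; rewrite /kink_path s0.
- exists (Num.min (Num.min M (- t)) (- (2 * N))) => s sM.
  apply/rowP => i; rewrite mxE uE.
    exact: (kink_approx_Noo S0 (vg i) (vm i) (mM i) e N0 sM).
  have := sM; rewrite lt_min => /andP[_ /ltW /le_trans]; apply.
  by rewrite oppr_le0 mulr_ge0// ltW.
- exists (fun s => \row_i u i s) => [i|s s0].
    rewrite (_ : (fun s => _) = u i); last by apply/funext => s; rewrite mxE.
    exact/smoothP/(smooth_kink_approx sS S0 _ _ (sg i) (sm i)).
  by apply/rowP => i; rewrite mxE uE.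
Qed.

(** The square root in the weight is at least 1, so a Hölder bound of exponent [b] is a bound in the
    noise norm. *)
Lemma powR_le_noise_weight s s' : `|s - s'| `^ b <= noise_weight H s s'.
Proof.
rewrite /noise_weight ler_peMl ?powR_ge0// -[leLHS]sqrtr1 ler_wsqrtr//.
by rewrite -addrA lerDl addr_ge0.
Qed.

Lemma kink_path_close S t v : is_step S -> 0 < t -> kinked t v ->
  exists2 K, 0 <= K & forall e N, 0 < e -> 0 < N ->
  noise_le H (v \- kink_path S t v e N) (K * (e `^ (1 - b) + N `^ (- b))).
Proof.
move=> [sS S0 S1 S01] t0 [[v0 vp] [g [m [M [sg sm vg vm mM]]]]].
have v0i i : v 0 ord0 i = 0 by rewrite v0 mxE.
have /choice[K HK] i : exists K, 0 <= K /\ forall e N s s', 0 < e -> 0 < N ->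
    s <= 0 -> s' <= 0 ->
    `|(v s ord0 i - kink_path S t v e N s ord0 i) -
      (v s' ord0 i - kink_path S t v e N s' ord0 i)| <=
    K * (e `^ (1 - b) + N `^ (- b)) * `|s - s'| `^ b.
  have [K K0 HK] := kink_approx_close sS S0 S1 S01 t0 (sg i) (sm i)
    (vg i) (vm i) (mM i) b01.
  exists K; split => // e N s s' e0 N0 s0 s0'.
  have := HK e N s s' e0 N0 s0 s0'.
  rewrite !(kink_approxE S (vg i) (vm i))// /kink_path.
  by rewrite !(ltNge 0) s0 s0' !mxE.
exists (d%:R * \sum_i K i) => [|e N e0 N0].
  by rewrite mulr_ge0// sumr_ge0// => i _; case: (HK i).
have p0 : 0 <= e `^ (1 - b) + N `^ (- b) by rewrite addr_ge0 ?powR_ge0.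
rewrite -mulrA; apply: noise_le_coord.
  by rewrite mulr_ge0// sumr_ge0// => i _; case: (HK i).
move=> i s s' s0 s0'; have [Ki HKi] := HK i.
rewrite !mxE (le_trans (HKi e N s s' e0 N0 s0 s0'))//.
rewrite ler_pM ?mulr_ge0 ?powR_ge0 ?powR_le_noise_weight//.
rewrite ler_wpM2r// (bigD1 i)//= lerDl sumr_ge0// => j _.
by case: (HK j).
Qed.

(** Both powers tend to 0 as [0 < b < 1]: the exponent [1 - b] lets a Lipschitz kink be smoothed in
    a Hölder norm, the exponent [- b] lets a nonzero constant be cut off far away. *)
Lemma kink_params_small K eta : 0 <= K -> 0 < eta ->
  exists e0 N0, [/\ 0 < e0, 0 < N0 & forall e N, 0 < e -> e <= e0 -> N0 <= N ->
    K * (e `^ (1 - b) + N `^ (- b)) <= eta].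
Proof.
move=> K0 eta0; have [b0 b1] := andP b01.
pose x := eta / (2 * (K + 1)).
have x0 : 0 < x by rewrite divr_gt0// mulr_gt0// ltr_wpDl.
have c0 : 0 < 1 - b by rewrite subr_gt0.
exists (x `^ (1 - b)^-1), (x `^ (- b)^-1); split; [exact: powR_gt0..|].
move=> e N e0 ee NN.
have N0 : 0 < N by apply: lt_le_trans NN; exact: powR_gt0.
have H1 : e `^ (1 - b) <= x.
  have -> : x = (x `^ (1 - b)^-1) `^ (1 - b).
    by rewrite -powRrM mulVf ?powRr1 ?(ltW x0)// lt0r_neq0.
  by rewrite ge0_ler_powR ?nnegrE ?powR_ge0 ?(ltW c0) ?(ltW e0).
have H2 : N `^ (- b) <= x.
  rewrite powRN -[leRHS]invrK lef_pV2 ?posrE ?invr_gt0 ?powR_gt0//.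
  have -> : x^-1 = (x `^ (- b)^-1) `^ b.
    by rewrite -powRrM invrN mulNr mulVf ?gt_eqF// powRN powRr1 ?(ltW x0).
  by rewrite ge0_ler_powR ?nnegrE ?powR_ge0 ?(ltW N0) ?(ltW b0).
rewrite (@le_trans _ _ (K * (2 * x)))//.
  by rewrite ler_wpM2l//; lra.
rewrite (@le_trans _ _ ((K + 1) * (2 * x)))//.
  by rewrite ler_wpM2r ?lerDl// mulr_ge0// ltW.
by rewrite /x le_eqVlt; apply/orP; left; apply/eqP; field; rewrite gt_eqF// ltr_wpDl.
Qed.

Lemma kinked_noise t v : 0 < t -> kinked t v -> noise_path H v.
Proof.
move=> t0 kv; have [S iS] := @smooth_step R.
have [K K0 HK] := kink_path_close iS t0 kv.
apply/noise_pathP; split => [|eta eta0]; first by case: kv.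
have [e0 [N0 [e00 N00 Hs]]] := kink_params_small K0 eta0.
pose e := Num.min e0 (t / 2).
have ep : 0 < e by rewrite lt_min e00 divr_gt0.
exists (kink_path S t v e N0).
  by apply: kink_path_test; rewrite // ge_min lexx orbT.
by apply: noise_leW (HK e N0 ep N00); apply: Hs; rewrite // ge_min lexx.
Qed.

(* [shift_path] on functions, so that it can be applied to test paths and ramps. *)
Definition shift_fun t w u s : 'rV[R]_d :=
  if 0 < s then 0
  else if - t <= s then u (- s - t) - u (- t)
  else w (s + t) - u (- t).

Lemma shift_fun_ext t w u : 0 < t -> extended_path (shift_fun t w u).
Proof.
move=> t0; split => [|s s0]; last by rewrite /shift_fun s0.
by rewrite /shift_fun ltxx oppr_le0 (ltW t0) oppr0 sub0r subrr.
Qed.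

Lemma shift_funB t w u w' u' :
  shift_fun t w u \- shift_fun t w' u' = shift_fun t (w \- w') (u \- u').
Proof.
apply/funext => s; rewrite /shift_fun /=; case: ifP => _; first by rewrite subrr.
by case: ifP => _; rewrite !opprD !opprK addrACA.
Qed.

Lemma noise_weight_le a a' s s' (k : R) : 0 <= k ->
  1 + `|a| + `|a'| <= k ^+ 2 * (1 + `|s| + `|s'|) -> `|a - a'| <= `|s - s'| ->
  noise_weight H a a' <= k * noise_weight H s s'.
Proof.
move=> k0 ak aa; rewrite /noise_weight mulrA ler_pM ?sqrtr_ge0 ?powR_ge0//.
  have kE : k = Num.sqrt (k ^+ 2) by rewrite sqrtr_sqr ger0_norm.
  by rewrite [k in leRHS]kE -sqrtrM ?sqr_ge0// ler_wsqrtr.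
by rewrite ge0_ler_powR ?nnegrE//; have [b0 _] := andP b01; exact: ltW.
Qed.

(** An increment across [- t] splits there into one of [w] and one of [u]. A shift by [t] enlarges
    [1 + |s| + |s'|] by at most [2 t], whence the square root of [1 + 2 t]. *)
Lemma shift_fun_le t w u e e' : 0 < t -> extended_path w -> extended_path u ->
  0 <= e -> 0 <= e' -> noise_le H w e -> noise_le H u e' ->
  noise_le H (shift_fun t w u) (Num.sqrt (1 + 2 * t) * (e + e')).
Proof.
move=> t0 [w0 _] [u0 _] e0 e0' we ue.
set k := Num.sqrt _; have k0 : 0 <= k by exact: sqrtr_ge0.
have k2 : k ^+ 2 = 1 + 2 * t by rewrite sqr_sqrtr//; lra.
have Ww (a a' s s' x : R) : 0 <= x ->
    1 + `|a| + `|a'| <= (1 + 2 * t) * (1 + `|s| + `|s'|) -> `|a - a'| <= `|s - s'| ->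
    x * noise_weight H a a' <= k * x * noise_weight H s s'.
  move=> x0 h1 h2; rewrite (mulrC k) -mulrA ler_wpM2l//.
  by apply: noise_weight_le; rewrite ?k2.
have nw s s' := noise_weight_ge0 H s s'.
have lin s s' : (1 + 2 * t) * (1 + `|s| + `|s'|) >= 1 + 2 * t + `|s| + `|s'|.
  have := normr_ge0 s; have := normr_ge0 s' => n1 n2.
  have : 0 <= 2 * t * (`|s| + `|s'|) by rewrite mulr_ge0 ?addr_ge0 ?mulr_ge0 ?(ltW t0).
  lra.
move=> s s'; wlog ss' : s s' / s <= s' => [W s0 s0'|s0 s0'].
  have [ss|/ltW ss] := leP s s'; first exact: W.
  by rewrite enormBC noise_weightC; exact: W.
rewrite mulrDr mulrDl.
have A1 : 0 <= k * e * noise_weight H s s' by rewrite mulr_ge0// mulr_ge0.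
have A2 : 0 <= k * e' * noise_weight H s s' by rewrite mulr_ge0// mulr_ge0.
rewrite /shift_fun !(ltNge 0) s0 s0'/=.
have [ts|st] := leP (- t) s.
  rewrite (le_trans ts ss')/= opprB addrA subrK.
  apply: ler_wpDl => //; apply: le_trans (ue _ _ _ _) _; try lra.
  have ss : - s - t - (- s' - t) = s' - s by ring.
  apply: Ww => //; last by rewrite ss distrC.
  apply: le_trans (lin _ _); rewrite (ler0_norm s0) (ler0_norm s0').
  by rewrite !ler0_norm; lra.
have [ts'|st'] := leP (- t) s'; last first.
  rewrite opprB addrA subrK; apply: ler_wpDr => //; apply: le_trans (we _ _ _ _) _; try lra.
  have ss : s + t - (s' + t) = s - s' by ring.
  apply: Ww => //; last by rewrite ss.
  apply: le_trans (lin _ _); rewrite (ler0_norm s0) (ler0_norm s0').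
  by rewrite !ler0_norm; lra.
rewrite opprB addrA subrK -[w (s + t)]subr0 -w0.
rewrite -(add0r (- u (- s' - t))) -u0.
apply: le_trans (enormD _ _) _; apply: lerD.
  apply: le_trans (we _ _ _ _) _; try lra.
  apply: Ww => //.
    apply: le_trans (lin _ _); rewrite (ler0_norm s0) (ler0_norm s0') normr0.
    by rewrite !ler0_norm; lra.
  by rewrite subr0 !ler0_norm; lra.
apply: le_trans (ue _ _ _ _) _; try lra.
apply: Ww => //.
  apply: le_trans (lin _ _); rewrite (ler0_norm s0) (ler0_norm s0') normr0.
  by rewrite !ler0_norm; lra.
by rewrite sub0r normrN !ler0_norm; lra.
Qed.

(** Far in the past the shifted path is the constant [- u (- t)], its value at [- t], and at [- t]
    the one-sided derivatives need not match; [kinked] allows exactly these two defects. *)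
Lemma test_shift_kinked t w u : 0 < t -> test_path w -> test_path u ->
  kinked t (shift_fun t w u).
Proof.
move=> t0 [ew [M wM] [g sg wg]] [eu _ [h sh uh]].
have vt : shift_fun t w u (- t) = - u (- t).
  rewrite /shift_fun lexx opprK subrr (ltNge 0) oppr_le0 (ltW t0)/=.
  by case: eu => -> _; rewrite sub0r.
split; first exact: shift_fun_ext.
exists (fun i s => h (- s - t) ord0 i - u (- t) ord0 i),
  (fun i s => g (s + t) ord0 i - u (- t) ord0 i), (Num.min (M - t) (- t)).
split.
- move=> i; have sh' : smooth (fun s => h s ord0 i) by exact/smoothP.
  have := smoothD (smooth_affine (-1) (- t) sh') (smooth_cst (- u (- t) ord0 i)).
  by congr smooth; apply/funext => s; rewrite !fctE mulN1r.
- move=> i; have sg' : smooth (fun s => g s ord0 i) by exact/smoothP.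
  have := smoothD (smooth_affine 1 t sg') (smooth_cst (- u (- t) ord0 i)).
  by congr smooth; apply/funext => s; rewrite !fctE mul1r.
- move=> i s /andP[ts s0]; rewrite /shift_fun ts (ltNge 0) s0/= uh ?mxE//.
  by lra.
- move=> i s; rewrite le_eqVlt => /predU1P[->|st].
    rewrite vt addNr -wg//; case: ew => -> _.
    by rewrite !mxE add0r.
  have s0 : s <= 0 by lra.
  by rewrite /shift_fun (ltNge 0) s0/= (leNgt _ s) st/= wg ?mxE//; lra.
- move=> i s; rewrite lt_min => /andP[sM st]; rewrite vt -wg; last by lra.
  by rewrite wM ?mxE ?add0r//; lra.
Qed.

(** Shifted test paths are kinked, hence noise paths, and [shift_fun_le] carries this to the
    closure. It follows that [shift] at a positive time never falls back on the null path of
    [to_noise]. *)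
Lemma shift_fun_noise t w u : 0 < t -> noise_path H w -> noise_path H u ->
  noise_path H (shift_fun t w u).
Proof.
move=> t0 /noise_pathP[ew Hw] /noise_pathP[eu Hu].
apply: noise_path_closed => [|e e0]; first exact: shift_fun_ext.
set k := Num.sqrt (1 + 2 * t).
have k0 : 0 < k by rewrite sqrtr_gt0; lra.
have ek : 0 < e / k / 2 by rewrite !divr_gt0.
have [w' tw' ww'] := Hw _ ek; have [u' tu' uu'] := Hu _ ek.
exists (shift_fun t w' u').
  exact: kinked_noise t0 (test_shift_kinked t0 tw' tu').
rewrite shift_funB.
have -> : e = k * (e / k / 2 + e / k / 2) by field; rewrite gt_eqF.
have extB (f f' : R -> 'rV[R]_d) : extended_path f -> extended_path f' ->
    extended_path (f \- f').
  by move=> [f0 fp] [f0' fp']; split => [|x x0] /=; rewrite ?f0 ?f0' ?fp ?fp' ?subrr.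
by apply: shift_fun_le => //; try exact: ltW; apply: extB => //; [case: tw'|case: tu'].
Qed.

Definition ramp t (c : 'rV[R]_d) s : 'rV[R]_d :=
  if 0 < s then 0 else Num.max s (- t) *: c.

Lemma ramp_kinked t c : 0 < t -> kinked t (ramp t c).
Proof.
move=> t0; split.
  split=> [|s s0]; last by rewrite /ramp s0.
  by rewrite /ramp ltxx max_l ?scale0r// oppr_le0 ltW.
exists (fun i s => s * c ord0 i), (fun i => cst (- t * c ord0 i)), (- t); split.
- by move=> i; exact: (smoothM smooth_id (smooth_cst (c ord0 i))).
- by move=> i; exact: smooth_cst.
- by move=> i s /andP[ts s0]; rewrite /ramp (ltNge 0) s0/= max_l// mxE.
- by move=> i s st; rewrite /ramp (ltNge 0) (le_trans st) ?oppr_le0 ?(ltW t0)//= max_r// mxE.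
- by move=> i s _; rewrite /ramp (ltNge 0) oppr_le0 (ltW t0)/= max_l// mxE.
Qed.

Lemma ramp_noise t c : 0 < t -> noise_path H (ramp t c).
Proof. by move=> t0; apply: (kinked_noise t0); exact: ramp_kinked. Qed.

(** Time reversal turns the slope [c] into [- c], and the part of the ramp before [- t] is not seen
    by the shift by [t]. *)
Lemma shift_fun_ramp t T w u c : 0 < t -> t <= T ->
  shift_fun t w (u \+ ramp T c) = shift_fun t w u \+ ramp t (- c).
Proof.
move=> t0 tT; apply/funext => s; rewrite /shift_fun /ramp /=.
have T0 : 0 < T by exact: lt_le_trans tT.
have [s0|s0] := ltP 0 s; first by rewrite addr0.
rewrite (ltNge 0 (- t)) oppr_le0 (ltW t0)/= (@max_l _ _ (- t) (- T)); last by lra.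
have [ts|st] := leP (- t) s.
  rewrite (ltNge 0 (- s - t)) (_ : - s - t <= 0)/=; last by lra.
  rewrite (max_l (_ : - T <= - s - t)); last by lra.
  rewrite opprD addrACA -scaleNr -scalerDl scalerN -scaleNr; congr (_ + _ *: _).
  by ring.
by rewrite opprD addrA -scaleNr scalerN -scaleNr opprK.
Qed.

End kinked_paths.

(** * The fractional operator is additive *)

Section power_kernel.
Context {R : realType} (a : R).
Hypothesis pa0 : 0 < a + 1.
Local Notation mu := (@lebesgue_measure R).
Implicit Types (r x K : R).

Let prim r : R := - (- r) `^ (a + 1) / (a + 1).

Let is_derive_prim r : r < 0 -> is_derive r 1 prim ((- r) `^ a).
Proof.
move=> r0; have nr0 : 0 < - r by rewrite oppr_gt0.
have d1 : is_derive (- r) 1 (fun x : R => x `^ (a + 1)) ((a + 1) * (- r) `^ (a + 1 - 1)).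
  exact: is_derive1_powR.
have d2 : is_derive r 1 (fun x : R => - x) (-1).
  exact: (is_deriveN (is_derive_id r 1)).
have d3 := is_derive1_comp d1 d2.
have d4 := is_deriveM d3 (is_derive_cst (- (a + 1)^-1) r 1).
have -> : prim = ((fun x : R => x `^ (a + 1)) \o (fun x : R => - x)) * cst (- (a + 1)^-1).
  by apply/funext => x; rewrite /prim !fctE /= mulrN mulNr.
apply: is_derive_eq d4 _.
by rewrite /GRing.scale/= mulr0 add0r addrK mulrN1 mulrNN mulKf// lt0r_neq0.
Qed.

Lemma measurable_powRN (D : set R) : measurable_fun D (fun r : R => (- r) `^ a).
Proof.
apply: measurable_funTS.
apply: (@measurableT_comp _ _ _ _ _ _ (@powR R ^~ a) _ (fun r : R => - r)).
  exact: measurable_powR.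
exact: oppr_measurable.
Qed.

(** For [a < 0] the kernel is singular at 0. The interval is exhausted by compact ones away from 0,
    on which the primitive [prim] gives a bound uniform in [n] because [0 < a + 1]. *)
Lemma powRN_integral_lty K : 0 < K ->
  (\int[mu]_(r in `[(- K)%R, 0%R[) ((- r) `^ a)%:E < +oo)%E.
Proof.
move=> K0.
pose F (n : nat) : set R := `[- K, - (n.+1%:R)^-1]%classic.
have UF : \bigcup_n F n = `[- K, 0[%classic.
  apply/seteqP; split => [x [n _]|x].
    rewrite /F /= !in_itv/= => /andP[-> xn]/=.
    by rewrite (le_lt_trans xn)// oppr_lt0 invr_gt0.
  rewrite /= in_itv/= => /andP[Kx x0].
  have nx : 0 < - x by rewrite oppr_gt0.
  have [n _ Hn] := near_infty_natSinv_lt (PosNum nx).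
  exists n => //; rewrite /F /= in_itv/= Kx/=.
  by have := Hn n (leqnn n); rewrite /= => /ltW; rewrite lerNr.
have nn n : (0 : R) < n.+1%:R^-1 by rewrite invr_gt0.
have bnd n : (\int[mu]_(r in F n) ((- r) `^ a)%:E <= (K `^ (a + 1) / (a + 1))%:E)%E.
  have B0 : 0 <= K `^ (a + 1) / (a + 1) by rewrite divr_ge0 ?powR_ge0// ltW.
  have [nK|] := ltP (- K) (- n.+1%:R^-1); last first.
    rewrite le_eqVlt => /predU1P[E|nK]; last first.
      by rewrite /F set_itv_ge ?integral_set0 ?lee_fin// -ltNge.
    by rewrite /F E set_itv1 integral_set1 lee_fin.
  have cF : {in `[- K, - n.+1%:R^-1], forall x : R, x < 0}.
    by move=> x; rewrite in_itv/= => /andP[_ xn]; rewrite (le_lt_trans xn)// oppr_lt0.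
  have cp (x : R) : x < 0 -> {for x, continuous (fun r => (- r) `^ a)}.
    move=> x0; have d : derivable (fun x : R => x `^ a) (- x) 1.
      by apply: derivable_powR; rewrite in_itv/= oppr_gt0 x0.
    apply: (@continuous_comp _ _ _ (fun r : R => - r) (fun x : R => x `^ a)).
      exact: opp_continuous.
    exact/differentiable_continuous/derivable1_diffP.
  have cprim (x : R) : x < 0 -> {for x, continuous prim}.
    move=> x0; have := is_derive_prim x0 => -[dx _].
    exact/differentiable_continuous/derivable1_diffP.
  rewrite (continuous_FTC2 nK (F := prim)).
  - rewrite -EFinB lee_fin /prim opprK mulNr mulNr opprK.
    by rewrite opprK gerDr oppr_le0 divr_ge0 ?powR_ge0// ltW.
  - by apply: continuous_in_subspaceT => x /[1!inE] /cF; exact: cp.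
  - split => [x||].
    + rewrite in_itv/= => /andP[_ xn].
      have x0 : x < 0 by rewrite (lt_trans xn)// oppr_lt0.
      by have [] := is_derive_prim x0.
    + by apply: cvg_at_right_filter; apply: cprim; rewrite oppr_lt0.
    + by apply: cvg_at_left_filter; apply: cprim; rewrite oppr_lt0.
  - move=> x; rewrite in_itv/= => /andP[_ xn].
    have x0 : x < 0 by rewrite (lt_trans xn)// oppr_lt0.
    by rewrite derive1E; have [_ ->] := is_derive_prim x0.
rewrite -UF.
have : ((\int[mu]_(r in F n) ((- r) `^ a)%:E) @[n --> \oo] -->
    \int[mu]_(r in \bigcup_n F n) ((- r) `^ a)%:E)%E.
  apply: ge0_nondecreasing_set_cvg_integral => //.
  - apply/nondecreasing_seqP => n; apply/subsetPset => x.
    rewrite /F /= !in_itv/= => /andP[-> xn]/=; rewrite (le_trans xn)// lerN2.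
    by rewrite lef_pV2 ?posrE// ler_nat.
  - by move=> n; exact: measurable_itv.
  - by move=> n; apply/measurable_EFinP; exact: measurable_powRN.
  - by move=> n x _; rewrite lee_fin powR_ge0.
move=> /cvg_lim <-//.
apply: (@le_lt_trans _ _ (K `^ (a + 1) / (a + 1))%:E); last by rewrite ltry.
apply: lime_le; last by apply: nearW => n; exact: bnd.
apply: ereal_nondecreasing_is_cvgn.
apply: ge0_nondecreasing_set_nondecreasing_integral => //.
  - apply/nondecreasing_seqP => n; apply/subsetPset => x.
    rewrite /F /= !in_itv/= => /andP[-> xn]/=; rewrite (le_trans xn)// lerN2.
    by rewrite lef_pV2 ?posrE// ler_nat.
  - by move=> n; exact: measurable_itv.
  - by move=> n; apply/measurable_EFinP; exact: measurable_powRN.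
  - by move=> n x _; rewrite lee_fin powR_ge0.
Qed.

Lemma powRN_integrable K : mu.-integrable `[- K, 0[ (EFin \o (fun r => (- r) `^ a)).
Proof.
have [K0|K0] := leP K 0.
  rewrite set_itv_ge; first exact: integrable_set0.
  by rewrite -leNgt /Order.le/= oppr_ge0.
apply/integrableP; split; first by apply/measurable_EFinP; exact: measurable_powRN.
under eq_integral do rewrite /= ger0_norm ?powR_ge0//.
exact: powRN_integral_lty.
Qed.

Lemma bounded_powRN_integrable (f : R -> R) (B K : R) :
  measurable_fun (`]-oo, 0[ : set R) f -> 0 <= B ->
  (forall r, r < 0 -> `|f r| <= B) -> (forall r, r < - K -> f r = 0) ->
  mu.-integrable `]-oo, 0[ (EFin \o (fun r => (- r) `^ a * f r)).
Proof.
move=> mf B0 fB fK.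
have sub : `[- K, 0[%classic `<=` (`]-oo, 0[%classic : set R).
  by move=> x /=; rewrite !in_itv/= => /andP[].
have mfa (D : set R) : D `<=` `]-oo, 0[ -> measurable D -> measurable_fun D (EFin \o (fun r => (- r) `^ a * f r)).
  move=> D0 mD; apply/measurable_EFinP/measurable_funM; first exact: measurable_powRN.
  exact: measurable_funS mf.
have i1 : mu.-integrable `[- K, 0[ (EFin \o (fun r => (- r) `^ a * f r)).
  have ig : mu.-integrable `[- K, 0[ (fun r => (B%:E * ((- r) `^ a)%:E)%E).
    by apply: integrableZl => //; exact: powRN_integrable.
  apply: (le_integrable _ _ _ ig) => //.
  - exact: mfa.
  - move=> x; rewrite /= in_itv/= => /andP[_ x0].
    rewrite lee_fin !normrM (ger0_norm (powR_ge0 _ _)) (ger0_norm B0) mulrC.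
    by rewrite ler_wpM2r ?powR_ge0 ?fB.
apply/integrable_mkcond => //; move/integrable_mkcond : i1 => /(_ (measurable_itv _)).
congr (integrable _ _ _); apply/funext => x; rewrite /patch.
case: ifPn => [|xK]; first by rewrite inE => /sub xs; rewrite mem_set.
case: ifPn => // /[1!inE] x0; rewrite /= fK ?mulr0//.
move: xK x0; rewrite notin_setE /= !in_itv/= => xK x0; rewrite ltNge.
by apply/negP => Kx; apply: xK; rewrite Kx.
Qed.

End power_kernel.

Section test_path_operator.
Context {R : realType} {d : nat} (H : R).
Hypothesis hH : 0 < H < 1.
Implicit Types (w u : R -> 'rV[R]_d) (t s r e : R) (i : 'I_d).
Local Notation mu := (@lebesgue_measure R).

Let a : R := H - 2^-1.

Let pa0 : 0 < a + 1.
Proof. by rewrite /a; case/andP: hH => h0 h1; lra. Qed.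

(** Derivatives are taken at negative times only, since the extension by 0 may fail to be
    differentiable at 0. The witness is the derivative of the smooth function that [w] restricts. *)
Lemma test_path_derive w i : test_path w -> exists f : R -> R, exists B M : R,
  [/\ continuous f, forall s, s < 0 -> is_derive s 1 (fun x => w x ord0 i) (f s),
      0 <= B, forall s, s < 0 -> `|f s| <= B & forall s, s < M -> f s = 0].
Proof.
move=> [_ [M wM] [g sg wg]].
pose gi s := g s ord0 i; have si : smooth gi by exact/smoothP/sg.
pose M' := Num.min M 0 - 1.
have [B B0 HB] : exists2 B, 0 <= B & forall s, M' <= s <= 0 -> `|derive1 gi s| <= B.
  have [L L0 HL] := smooth_lipschitz M' 0 (smooth_derive si).
  exists (L * (0 - M') + `|derive1 gi M'|) => [|s sM].
    rewrite addr_ge0// mulr_ge0// /M'.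
    have : Num.min M 0 <= 0 by rewrite ge_min lexx orbT.
    by lra.
  have M0 : M' <= 0 by case/andP: sM => /le_trans; apply.
  rewrite -[derive1 gi s](subrK (derive1 gi M')) (le_trans (ler_normD _ _))//.
  rewrite lerD2r (le_trans (HL _ _ sM _)) ?lexx ?M0// ler_wpM2l//.
  by case/andP: sM => sM s0; rewrite ger0_norm ?subr_ge0// lerD2r.
have gM s : s < Num.min M 0 -> derive1 gi s = 0.
  move=> sM; rewrite derive1E -(derive_cst (0 : R) s 1).
  apply: near_eq_derive; near=> x.
  have : x < Num.min M 0 by near: x; exact: lt_nbhsl.
  by rewrite lt_min /gi => /andP[xM x0]; rewrite -wg ?ltW// wM// mxE.
exists (derive1 gi), B, (Num.min M 0); split => //.
- exact: smooth_continuous (smooth_derive si).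
- move=> s s0; apply: (@near_eq_is_derive _ _ _ gi).
    near=> x; rewrite /gi wg//; apply: ltW; near: x; exact: lt_nbhsl.
  by rewrite derive1E; apply: derivableP; exact: smooth_derivable.
- move=> s s0; have [sM|sM] := leP M' s; first by apply: HB; rewrite sM ltW.
  by rewrite gM ?normr0//; move: sM; rewrite /M'; lra.
Unshelve. all: by end_near. Qed.

Let dker (f : R -> R) t r := (- r) `^ a * (f (t + r) - f r).

Lemma DH_test_integrable w i t : test_path w -> t <= 0 ->
  mu.-integrable `]-oo, 0[ (EFin \o dker (derive1 (fun x => w x ord0 i)) t).
Proof.
move=> tw t0; have [f [B [M [cf wf B0 fB fM]]]] := test_path_derive i tw.
have wfE s : s < 0 -> derive1 (fun x => w x ord0 i) s = f s.
  by move=> s0; rewrite derive1E; have [_ ->] := wf s s0.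
suff : mu.-integrable `]-oo, 0[ (EFin \o dker f t).
  apply: eq_integrable => // r; rewrite inE/= in_itv/= => r0.
  by rewrite /= /dker !wfE//; lra.
apply: (@bounded_powRN_integrable _ _ pa0 (fun r => f (t + r) - f r) (B + B) (- M)).
- apply: measurable_funTS; apply: measurable_funB; last exact: continuous_measurable_fun.
  apply: (@measurableT_comp _ _ _ _ _ _ f) => //; first exact: continuous_measurable_fun.
  exact: measurable_funD.
- exact: addr_ge0.
- move=> r r0; rewrite (le_trans (ler_normB _ _))// lerD// fB//; lra.
- by move=> r; rewrite opprK => rM; rewrite !fM ?subrr//; lra.
Qed.

Lemma DH_testE w t i : t <= 0 -> DH_test H w t ord0 i =
  (alphaH H)^-1 * \int[mu]_(r in `]-oo, 0[) dker (derive1 (fun x => w x ord0 i)) t r.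
Proof. by move=> t0; rewrite /DH_test (ltNge 0) t0/= mxE. Qed.

Lemma DH_testD w u : test_path w -> test_path u ->
  DH_test H (w \+ u) = DH_test H w \+ DH_test H u.
Proof.
move=> tw tu; apply/funext => t; have [t0|t0] := ltP 0 t.
  by rewrite /DH_test /= t0 addr0.
have mxD (x y : 'rV[R]_d) j : (x + y) ord0 j = x ord0 j + y ord0 j by rewrite mxE.
apply/rowP => i; rewrite (DH_testE _ _ t0).
transitivity (DH_test H w t ord0 i + DH_test H u t ord0 i); last first.
  exact/esym/mxD.
rewrite [RHS](congr2 +%R (DH_testE w i t0) (DH_testE u i t0)).
have iw := DH_test_integrable i tw t0; have iu := DH_test_integrable i tu t0.
rewrite -mulrDr -(RintegralD _ iw iu)//.
congr (_ * _); apply: eq_Rintegral => r; rewrite inE/= in_itv/= => r0.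
have dE s : s < 0 -> derive1 (fun x => (w x + u x) ord0 i) s =
    derive1 (fun x => w x ord0 i) s + derive1 (fun x => u x ord0 i) s.
  move=> s0; have [f [_ [_ [_ wf _ _ _]]]] := test_path_derive i tw.
  have [g [_ [_ [_ ug _ _ _]]]] := test_path_derive i tu.
  have [dw _] := wf s s0; have [du _] := ug s s0.
  rewrite !derive1E -deriveD//; congr ('D_1 _ s).
  by apply/funext => x; rewrite !fctE mxE.
by rewrite /dker !dE; [ring|lra..].
Qed.

Variable D : noise d H -> noise d (1 - H).
Hypothesis hD : is_DH D.

Let approx (w : noise d H) e : 0 < e ->
  exists2 u, test_path u & noise_le H (u \- npath w) e.
Proof.
move=> e0; have /noise_pathP[_ /(_ e e0)[u tu wu]] := noiseP w.
by exists u => //; exact: noise_leBC.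
Qed.

Let cont (w : noise d H) e : 0 < e -> exists2 del, 0 < del &
  forall w' : noise d H, noise_le H (npath w' \- npath w) del ->
    noise_le (1 - H) (npath (D w') \- npath (D w)) e.
Proof.
move=> e0; have [del del0 Hdel] := hD.1 w _ e0.
exists (del / 2) => [|w' ww']; first by rewrite divr_gt0.
have /ltW := Hdel w' (noise_norm_lt ww' del0).
by move/noise_norm_leP; apply; exact: ltW.
Qed.

Let test_noise u (tu : test_path u) : noise d H := Noise (test_path_noise H tu).

Lemma DH_near (w : noise d H) t e : t <= 0 -> 0 < e -> exists2 del, 0 < del &
  forall u, test_path u -> noise_le H (u \- npath w) del ->
    enorm (DH_test H u t - npath (D w) t) <= e.
Proof.
move=> t0 e0.
(* The [+ 1] keeps the divisor positive at [t = 0], where the weight vanishes. *)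
have W0 : 0 < noise_weight (1 - H) t 0 + 1 by rewrite ltr_wpDl// noise_weight_ge0.
have [del del0 Hdel] := cont w (divr_gt0 e0 W0).
exists del => // u tu uw.
have := Hdel (test_noise tu) uw; rewrite hD.2//= => Hu.
have ext : extended_path (DH_test H u \- npath (D w)).
  have [h0 hp] := (noiseP (D w)).1.
  have [] := (noiseP (D (test_noise tu))).1; rewrite hD.2//= => k0 kp.
  by split => [|s s0] /=; rewrite ?h0 ?k0 ?hp ?kp// subrr.
have := noise_le0 ext Hu t0; move=> /le_trans; apply.
rewrite mulrAC ler_pdivrMr// ler_wpM2l ?(ltW e0)// lerDl//.
Qed.

(** On test paths [D] is an integral, hence additive. Test paths near [w1] and [w2] have a sum near
    [w], and continuity of [D] at the three points concludes. *)
Lemma DH_additive (w w1 w2 : noise d H) : npath w = npath w1 \+ npath w2 ->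
  npath (D w) = npath (D w1) \+ npath (D w2).
Proof.
move=> ww; apply: (@noise_le_eq _ _ (1 - H)).
- by case: (noiseP (D w)).
- by apply: extended_pathD; [case: (noiseP (D w1))|case: (noiseP (D w2))].
move=> e e0; have e3 : 0 < e / 3 by rewrite divr_gt0.
have [d0 d00 H0] := cont w e3; have [d1 d10 H1] := cont w1 e3.
have [d2 d20 H2] := cont w2 e3.
pose eta := Num.min (d0 / 2) (Num.min d1 d2).
have eta0 : 0 < eta by rewrite !lt_min divr_gt0//= d10.
have [u1 tu1 wu1] := approx w1 eta0; have [u2 tu2 wu2] := approx w2 eta0.
have h1 := H1 (test_noise tu1) (noise_leW _ wu1).
have h2 := H2 (test_noise tu2) (noise_leW _ wu2).
have h0 := H0 (test_noise (test_pathD tu1 tu2)).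
have {}h1 := h1 ltac:(by rewrite /eta !ge_min lexx !orbT).
have {}h2 := h2 ltac:(by rewrite /eta !ge_min lexx !orbT).
rewrite /= ww in h0; have {}h0 := h0 (noise_leW _ (noise_leD2 wu1 wu2)).
have {}h0 := h0 ltac:(by rewrite (splitr d0) lerD// /eta ge_min lexx).
move: h0 h1 h2; rewrite (hD.2 (test_noise tu1) tu1) (hD.2 (test_noise tu2) tu2).
rewrite (hD.2 (test_noise (test_pathD tu1 tu2)) (test_pathD tu1 tu2)) (DH_testD tu1 tu2).
move=> /noise_leBC h0 h1 h2.
have := noise_leB_trans h0 (noise_leD2 h1 h2).
by apply: noise_leW; lra.
Qed.

End test_path_operator.

(** * The fractional operator on a ramp *)

Section ramp_operator.
Context {R : realType} {d : nat} (H : R).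
Hypothesis hH : 0 < H < 1.
Implicit Types (t s r e x y : R) (i : 'I_d).
Local Notation mu := (@lebesgue_measure R).

Let a : R := H - 2^-1.

Let pa0 : 0 < a + 1.
Proof. by rewrite /a; case/andP: hH => h0 h1; lra. Qed.

Lemma smooth_derive_bounded (f : R -> R) (b c : R) : b <= c -> smooth f ->
  (forall x, x <= b -> f x = f b) -> (forall x, c <= x -> f x = f c) ->
  exists B, [/\ 0 <= B, forall x, `|derive1 f x| <= B,
    forall x y, `|derive1 f x - derive1 f y| <= B * `|x - y|,
    forall x, x < b -> derive1 f x = 0 & forall x, c < x -> derive1 f x = 0].
Proof.
move=> bc sf fb fc.
have db x : x < b -> derive1 f x = 0.
  move=> xb; rewrite derive1E -(derive_cst (f b) x 1); apply: near_eq_derive.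
  near=> z; apply: fb; apply: ltW; near: z; exact: lt_nbhsl.
have dc x : c < x -> derive1 f x = 0.
  move=> xc; rewrite derive1E -(derive_cst (f c) x 1); apply: near_eq_derive.
  near=> z; apply: fc; apply: ltW; near: z; exact: lt_nbhsr.
have [|x xb|x xc|L L0 HL] := @smooth_lipschitz_cst _ _ (b - 1) (c + 1) _ (smooth_derive sf).
- lra.
- by rewrite !db//; lra.
- by rewrite !dc//; lra.
(* [c - b + 2] is the length of [[b - 1, c + 1]], at whose left end the derivative vanishes; being
   at least 1, it lets one constant serve both as bound and as Lipschitz constant. *)
exists (L * (c - b + 2)); split => //.
- by rewrite mulr_ge0//; lra.
- move=> x; have [xb|xb] := ltP x b.
    by rewrite db// normr0 mulr_ge0//; lra.
  have [xc|xc] := ltP c x.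
    by rewrite dc// normr0 mulr_ge0//; lra.
  have := HL x (b - 1); rewrite (db (b - 1)) ?subr0; last by lra.
  move=> /le_trans; apply; rewrite ler_wpM2l// ger0_norm; lra.
- move=> x y; rewrite (le_trans (HL x y))// ler_wpM2r// ler_peMr//; lra.
Unshelve. all: by end_near. Qed.

(** For [t > 0] this is t^(H + 1/2) / (H + 1/2). The integral is the form in which it arises as a
    limit, and its sign and monotonicity can be read off. *)
Definition ramp_integral t : R :=
  \int[mu]_(r in `]-oo, 0[) ((- r) `^ a * \1_(`](- t), 0[) r).

Let indic_bound (A : set R) r : 0 <= (\1_A r : R) <= 1.
Proof. by rewrite indicE; case: (_ \in _); rewrite ?lexx ?ler01. Qed.

Let indic_int (A : set R) K : measurable A -> (forall r, A r -> - K <= r) ->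
  mu.-integrable `]-oo, 0[ (EFin \o (fun r => (- r) `^ a * \1_A r)).
Proof.
move=> mA AK; apply: (@bounded_powRN_integrable _ _ pa0 (\1_A) 1 K) => //.
  by move=> r _; rewrite ger0_norm; have /andP[] := indic_bound A r.
move=> r rK; rewrite indicE memNset// => /AK; rewrite leNgt rK//.
Qed.

Let indic_integrable (b0 b1 : bool) (x y : R) :
  mu.-integrable `]-oo, 0[ (EFin \o (\1_[set` Interval (BSide b0 x) (BSide b1 y)] : R -> R)).
Proof.
by apply: (@integrableS _ _ _ _ setT) => //; exact: integrable_indic_itv.
Qed.

Let indic_integrableZ (b0 b1 : bool) (x y c : R) : mu.-integrable `]-oo, 0[
  (EFin \o (fun r : R => c * \1_[set` Interval (BSide b0 x) (BSide b1 y)] r)).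
Proof.
rewrite (_ : _ \o _ =
  (fun r => (c%:E * (\1_[set` Interval (BSide b0 x) (BSide b1 y)] r)%:E)%E)).
  by apply: integrableZl => //; exact: indic_integrable.
by apply/funext => r /=; rewrite EFinM.
Qed.

Lemma ramp_integral_le t T : t <= T -> ramp_integral t <= ramp_integral T.
Proof.
move=> tT; apply: le_Rintegral => //.
- by apply: (indic_int (K := t)) => // r; rewrite /= in_itv/= => /andP[/ltW].
- by apply: (indic_int (K := T)) => // r; rewrite /= in_itv/= => /andP[/ltW].
move=> r _; rewrite ler_wpM2l ?powR_ge0// !indicE.
case: (boolP (r \in `](- t), 0[%classic)) => [|_]; last by case: (_ \in _).
rewrite inE/= in_itv/= => /andP[tr r0].
by rewrite mem_set//= in_itv/= r0 andbT (le_lt_trans _ tr)// lerN2.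
Qed.

Lemma ramp_integral_ge0 t : 0 <= ramp_integral t.
Proof.
by apply: Rintegral_ge0 => r _; rewrite mulr_ge0 ?powR_ge0.
Qed.

(* the factor [(- r) `^ a] is bounded away from [0] and [+oo] on [`[- t, - t / 2]] *)
Let powR_between t x : 0 < t -> t / 2 <= x <= t ->
  Num.min ((t / 2) `^ a) (t `^ a) <= x `^ a <= (t / 2) `^ a + t `^ a.
Proof.
move=> t0 /andP[tx xt]; have t2 : 0 < t / 2 by rewrite divr_gt0.
have x0 : 0 < x by exact: lt_le_trans tx.
have p1 := powR_ge0 (t / 2) a; have p2 := powR_ge0 t a.
have [a0|a0] := leP 0 a.
  have h1 : (t / 2) `^ a <= x `^ a by rewrite ge0_ler_powR ?nnegrE ?(ltW t2) ?(ltW x0).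
  have h2 : x `^ a <= t `^ a by rewrite ge0_ler_powR ?nnegrE ?(ltW t0) ?(ltW x0).
  by rewrite ge_min h1/=; lra.
have inv y z : 0 < y -> y <= z -> z `^ a <= y `^ a.
  move=> y0 yz; have z0 : 0 < z by exact: lt_le_trans yz.
  rewrite -[a]opprK powRN (powRN y) lef_pV2 ?posrE ?powR_gt0//.
  by rewrite ge0_ler_powR ?nnegrE ?(ltW y0) ?(ltW z0)// oppr_ge0 ltW.
have h1 := inv _ _ t2 tx; have h2 := inv _ _ x0 xt.
by rewrite ge_min h2 orbT/=; lra.
Qed.

Lemma ramp_integral_gt0 t : 0 < t -> 0 < ramp_integral t.
Proof.
move=> t0; pose c := Num.min ((t / 2) `^ a) (t `^ a).
have c0 : 0 < c by rewrite lt_min !powR_gt0// divr_gt0.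
pose A : set R := `](- t), (- (t / 2))[%classic.
have muA : mu A = (t / 2)%:E.
  rewrite lebesgue_measure_itv/= lte_fin ifT; last by lra.
  by rewrite -EFinB; congr EFin; field.
have : \int[mu]_(r in `]-oo, 0[) (c * \1_A r) <= ramp_integral t.
  apply: le_Rintegral => //.
  - exact: indic_integrableZ.
  - by apply: (indic_int (K := t)) => // r; rewrite /= in_itv/= => /andP[/ltW].
  move=> r _; rewrite !indicE.
  case: (boolP (r \in A)) => [|_]; last first.
    by rewrite mulr0 mulr_ge0 ?powR_ge0//; case: (_ \in _).
  rewrite inE /A /= in_itv/= => /andP[tr rt].
  rewrite mem_set/=; last by rewrite in_itv/= tr; lra.
  have pb : t / 2 <= - r <= t by apply/andP; split; lra.
  by rewrite !mulr1; have /andP[] := powR_between t0 pb.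
apply: lt_le_trans; rewrite RintegralZl//; last exact: indic_integrable.
have AD : A `&` `]-oo, 0[ = A.
  by apply/setIidPl => r; rewrite /A /= !in_itv/= => /andP[_ rt]; lra.
have IA : (\int[mu]_(x in `]-oo, 0%R[) (\1_A x)%:E)%E = (t / 2)%:E.
  by rewrite -muA integral_indic//; [congr (mu _)|exact: measurable_itv].
by apply: mulr_gt0 => //; rewrite /Rintegral IA/= divr_gt0.
Qed.

Section kernel_limit.
Variables (S : R -> R) (t : R).
Hypotheses (iS : is_step S) (t0 : 0 < t).

(* [kink_approx] of the unit ramp [s |-> max s (- t)]. *)
Definition profile e N s : R :=
  - t * S (2 + s / N) + hump S ((s + t) / e) * (Num.max s (- t) + t).

Let sS : smooth S. Proof. by case: iS. Qed.
Let S0 x : x <= 0 -> S x = 0. Proof. by case: iS => _ + _ _; apply. Qed.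
Let S1 x : 1 <= x -> S x = 1. Proof. by case: iS => _ _ + _; apply. Qed.
Let S01 x : 0 <= S x <= 1. Proof. by case: iS. Qed.

Definition dprofile e N s : R := - (t / N) * derive1 S (2 + s / N) +
  (if - t < s then derive1 (hump S) ((s + t) / e) * ((s + t) / e) + hump S ((s + t) / e)
   else 0).

Let is_derive_affine (f : R -> R) (b c s : R) : smooth f ->
  is_derive s 1 (fun x => f (b * x + c)) (b * derive1 f (b * s + c)).
Proof.
move=> sf.
have H1 : is_derive s 1 (fun x : R => b * x + c) b.
  apply: (@is_derive_eq _ _ _ _ _ _ _ _ (is_deriveD
    (is_deriveM (is_derive_cst b s 1) (is_derive_id s 1)) (is_derive_cst c s 1))).
  by rewrite /GRing.scale/= mulr0 !addr0 mulr1.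
have H2 : is_derive (b * s + c) 1 f (derive1 f (b * s + c)).
  by rewrite derive1E; apply: derivableP; exact: smooth_derivable.
rewrite mulrC; exact: (@is_derive1_comp _ f (fun x : R => b * x + c)).
Qed.

Lemma is_derive_profile e N s : 0 < e -> is_derive s 1 (profile e N) (dprofile e N s).
Proof.
move=> e0.
have d1 : is_derive s 1 (fun s => - t * S (2 + s / N)) (- (t / N) * derive1 S (2 + s / N)).
  rewrite (_ : (fun s => _) = cst (- t) * (fun s => S (N^-1 * s + 2))); last first.
    by apply/funext => x; rewrite !fctE/= (mulrC N^-1) (addrC 2).
  apply: is_derive_eq (is_deriveM (is_derive_cst (- t) s 1) (is_derive_affine N^-1 2 s sS)) _.
  by rewrite /GRing.scale/= mulr0 addr0 (mulrC N^-1 s) (addrC _ 2) mulrA mulNr.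
have [ts|st] := ltP (- t) s.
  have dh : is_derive s 1 (fun s => hump S ((s + t) / e)) (e^-1 * derive1 (hump S) ((s + t) / e)).
    rewrite (_ : (fun s => _) = (fun s => hump S (e^-1 * s + t / e))); last first.
      by apply/funext => x; rewrite (mulrC e^-1) -mulrDl.
    apply: is_derive_eq (is_derive_affine e^-1 (t / e) s (smooth_hump sS)) _.
    by rewrite (mulrC e^-1 s) -mulrDl.
  have did : is_derive s 1 (fun s : R => s + t) 1.
    have := is_deriveD (is_derive_id s 1) (is_derive_cst t s 1).
    by rewrite addr0.
  apply: (@near_eq_is_derive _ _ _ ((fun s => - t * S (2 + s / N)) +
      (fun s => hump S ((s + t) / e)) * (fun s => s + t))).
    near=> x; rewrite /profile !fctE max_l//; apply: ltW; near: x; exact: lt_nbhsr.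
  apply: is_derive_eq (is_deriveD d1 (is_deriveM dh did)) _.
  rewrite /dprofile ts /GRing.scale/= mulr1; congr (_ + _).
  by rewrite addrC; congr (_ + _); ring.
apply: (@near_eq_is_derive _ _ _ (fun s => - t * S (2 + s / N))); last first.
  by rewrite /dprofile ltNge st/= addr0.
near=> x; rewrite /profile.
(* Left of [- t] the ramp is constant; if [s = - t], the points just to its right lie where the hump
   vanishes. *)
have [tx|xt] := leP (- t) x; last by rewrite addNr mulr0 addr0.
rewrite hump0// ?mul0r ?addr0//.
rewrite -ler_norml ger0_norm ?divr_ge0 ?(ltW e0)//; last by lra.
rewrite ler_pdivrMr// mul1r.
have : x < s + e by near: x; apply: lt_nbhsl; rewrite ltrDl.
lra.
Unshelve. all: by end_near. Qed.

(** In the limit [f] is minus the indicator of [(- t, 0)]. It differs from this only on [E1], of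
    length [2 * e] next to the kink, and on [E2], where the constant is cut off. On [E1] the kernel
    is bounded as [e <= t / 4]; on [E2] the kernel may be large, but [f] is of order (t/N)^2. *)
Lemma dprofile_limit : exists2 K, 0 <= K &
  forall e m, 0 < e -> e <= t / 4 -> 1 <= m -> 2 * t <= m ->
  forall f : R -> R, (forall r, r < 0 ->
    f r = dprofile e (2 * m ^+ 2) (- t + r) - dprofile e (2 * m ^+ 2) r) ->
  mu.-integrable `]-oo, 0[ (EFin \o (fun r => (- r) `^ a * f r)) ->
  `|\int[mu]_(r in `]-oo, 0[) ((- r) `^ a * f r) + ramp_integral t| <= K * (e + m^-1).
Proof.
have [||B1 [B10 b1 l1 z1 z1']] := @smooth_derive_bounded S 0 1 ler01 sS.
- by move=> x x0; rewrite !S0.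
- by move=> x x1; rewrite !S1.
have [|||B2 [B20 b2 _ _ z2]] := @smooth_derive_bounded (hump S) (-2) 2 _ (smooth_hump sS).
- lra.
- move=> x x2; rewrite !(hump1 S0 S1)//; first by rewrite normrN ger0_norm.
  by rewrite ler0_norm; lra.
- move=> x x2; rewrite !(hump1 S0 S1)//; first by rewrite ger0_norm.
  by rewrite ger0_norm; lra.
pose A := (t / 2) `^ a + t `^ a.
have A0 : 0 <= A by rewrite addr_ge0 ?powR_ge0.
pose c1 := A * (2 * B2 + 1).
have c10 : 0 <= c1 by rewrite mulr_ge0// addr_ge0// mulr_ge0.
exists (2 * c1 + 2 * (B1 * t ^+ 2)) => [|e m e0 et m1 tm f fE0 if1].
  exact: addr_ge0 (mulr_ge0 (ler0n _ 2) c10)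
    (mulr_ge0 (ler0n _ 2) (mulr_ge0 B10 (sqr_ge0 t))).
(* With this [N] the kernel on [E2] is at most the square root of [2 * N], that is [2 * m], because
   [a < 1 / 2]. So [E2] contributes O(m N^-2 N) = O(1/m). *)
set N := 2 * m ^+ 2 in fE0.
have m0 : 0 < m by lra.
have mm : m <= m ^+ 2 by rewrite expr2 ler_peMr// ltW.
have N0 : 0 < N by rewrite mulr_gt0// exprn_gt0.
have tN : 2 * t < N.
  have : 0 < m ^+ 2 by rewrite exprn_gt0.
  rewrite /N; lra.
pose E1 : set R := `[(- t), (- t + 2 * e)]%classic.
pose E2 : set R := `[(- (2 * N)), (t - N)]%classic.
pose c2 := 2 * m * (B1 * t ^+ 2 / N ^+ 2).
have c20 : 0 <= c2.
  by rewrite !mulr_ge0 ?invr_ge0 ?sqr_ge0// ltW.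
have fbound r : r < 0 -> `|(- r) `^ a * f r + (- r) `^ a * \1_(`](- t), 0[) r| <=
    c1 * \1_E1 r + c2 * \1_E2 r.
  move=> r0; rewrite -mulrDr normrM (ger0_norm (powR_ge0 _ _)).
  have p0 : 0 <= c1 * \1_E1 r + c2 * \1_E2 r.
    by apply: addr_ge0; apply: mulr_ge0.
    have dt : dprofile e N (- t + r) = - (t / N) * derive1 S (2 + (r - t) / N).
    by rewrite /dprofile ltNge (_ : - t + r <= - t)/= ?addr0 ?(addrC (- t))//; lra.
  have [tr|rt] := ltP (- t) r.
    have S'0 x : - N < x -> derive1 S (2 + x / N) = 0.
      move=> Nx; apply: z1'.
      have : - 1 < x / N by rewrite ltr_pdivlMr// mulN1r.
      lra.
    have -> : f r = - (derive1 (hump S) ((r + t) / e) * ((r + t) / e) + hump S ((r + t) / e)).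
      rewrite fE0// dt S'0; last by lra.
      by rewrite /dprofile tr S'0 ?mulr0 ?add0r ?sub0r//; lra.
    have -> : (\1_(`](- t), 0[) r : R) = 1 by rewrite indicE mem_set//= in_itv/= tr r0.
    have [re|re] := ltP 2 ((r + t) / e).
      rewrite z2// mul0r add0r (hump1 S0 S1) ?addNr ?normr0 ?mulr0//.
      by rewrite ger0_norm; lra.
    have rE1 : E1 r.
      by move: re; rewrite ler_pdivrMr// /E1 /= in_itv/= (ltW tr) => re; lra.
    rewrite (@le_trans _ _ c1)//; last first.
      by rewrite indicE mem_set// mulr1 lerDl; apply: mulr_ge0.
    rewrite ler_pM ?powR_ge0//.
      have pb : t / 2 <= - r <= t.
        by move: rE1; rewrite /E1 /= in_itv/= => /andP[? ?]; apply/andP; split; lra.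
      by have /andP[] := powR_between t0 pb.
    have q0 : 0 <= (r + t) / e by rewrite divr_ge0 ?(ltW e0)//; lra.
    have /andP[h0 h1] := hump01 S0 S01 ((r + t) / e).
    rewrite opprD -addrA (le_trans (ler_normD _ _))// lerD//.
      by rewrite normrN normrM mulrC ler_pM// ger0_norm.
    by rewrite ger0_norm; lra.
  have -> : (\1_(`](- t), 0[) r : R) = 0.
    by rewrite indicE memNset//= in_itv/= ltNge rt.
  rewrite addr0.
  have fE : f r = - (t / N) * (derive1 S (2 + (r - t) / N) - derive1 S (2 + r / N)).
    by rewrite fE0// dt /dprofile ltNge rt/= addr0 mulrBr.
  have [rN|rN] := ltP r (- (2 * N)).
    have r2 : r / N < - 2 by rewrite ltr_pdivrMr//; lra.
    have r2' : (r - t) / N < - 2 by rewrite ltr_pdivrMr//; lra.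
    by rewrite fE !z1 ?subrr ?mulr0 ?normr0 ?mulr0//; lra.
  have [rN'|rN'] := ltP (t - N) r.
    have r2 : - 1 < r / N by rewrite ltr_pdivlMr//; lra.
    have r2' : - 1 < (r - t) / N by rewrite ltr_pdivlMr//; lra.
    by rewrite fE !z1' ?subrr ?mulr0 ?normr0 ?mulr0//; lra.
  have rE2 : E2 r by rewrite /E2 /= in_itv/= rN rN'.
  rewrite (@le_trans _ _ c2)//; last first.
    by rewrite (indicE _ E2) mem_set// mulr1 lerDr; apply: mulr_ge0.
  rewrite ler_pM ?powR_ge0//.
    have r1 : 1 <= - r.
      have : 2 * m <= N by rewrite /N ler_wpM2l.
      lra.
    rewrite (@le_trans _ _ ((- r) `^ 2^-1))//.
      by rewrite ler_powR// /a; case/andP: hH => _; lra.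
    rewrite powR12_sqrt; last by lra.
    rewrite -[leRHS](ger0_norm (_ : 0 <= 2 * m)); last by rewrite mulr_ge0// ltW.
    rewrite -sqrtr_sqr ler_wsqrtr// exprMn (_ : 2 ^+ 2 = 4); last by ring.
    by rewrite /N in rN; lra.
  rewrite fE normrM normrN (ger0_norm (_ : 0 <= t / N)) ?divr_ge0 ?(ltW t0) ?(ltW N0)//.
  rewrite (@le_trans _ _ (t / N * (B1 * `|2 + (r - t) / N - (2 + r / N)|)))//.
    by rewrite ler_wpM2l// divr_ge0 ?(ltW t0) ?(ltW N0).
  rewrite (_ : 2 + (r - t) / N - (2 + r / N) = - (t / N)); last by ring.
  rewrite normrN ger0_norm ?divr_ge0 ?(ltW t0) ?(ltW N0)//.
  rewrite le_eqVlt; apply/orP; left; apply/eqP; field; exact: lt0r_neq0.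
have if2 : mu.-integrable `]-oo, 0[ (EFin \o (fun r => (- r) `^ a * \1_(`](- t), 0[) r)).
  by apply: (indic_int (K := t)) => // r; rewrite /= in_itv/= => /andP[/ltW].
have ig : mu.-integrable `]-oo, 0[ (EFin \o (fun r => c1 * \1_E1 r + c2 * \1_E2 r)).
  have i1 := indic_integrableZ true false (- t) (- t + 2 * e) c1.
  have i2 := indic_integrableZ true false (- (2 * N)) (t - N) c2.
  by apply: (integrableD _ i1 i2).
have ifs : mu.-integrable `]-oo, 0[
    (EFin \o (fun r => (- r) `^ a * f r + (- r) `^ a * \1_(`](- t), 0[) r)).
  by apply: (integrableD _ if1 if2).
rewrite /ramp_integral -RintegralD//.
apply: le_trans (le_normr_Rintegral _ ifs) _ => //.
apply: (@le_trans _ _ (\int[mu]_(r in `]-oo, 0[) (c1 * \1_E1 r + c2 * \1_E2 r))).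
  by apply: le_Rintegral => //; exact: integrable_norm.
have Iind x y : x <= y -> (\int[mu]_(r in `]-oo, 0[) \1_(`[x, y]) r <= y - x)%R.
  move=> xy; rewrite /Rintegral integral_indic//=.
  have le1 : (mu (`[x, y] `&` `]-oo, 0%R[) <= (y - x)%:E)%E.
    apply: (@le_trans _ _ (mu `[x, y])).
      by apply: le_measure; rewrite ?inE//; exact: measurableI.
    rewrite lebesgue_measure_itv/= lte_fin; case: ifPn => // _.
    by rewrite lee_fin subr_ge0.
  rewrite -lee_fin fineK// ge0_fin_numE//.
  by rewrite (le_lt_trans le1)// ltry.
rewrite RintegralD//; [|exact: indic_integrableZ..].
rewrite !RintegralZl//; [|exact: indic_integrable..].
have i1 : \int[mu]_(r in `]-oo, 0[) \1_E1 r <= 2 * e.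
  rewrite (le_trans (Iind _ _ _))//; lra.
have i2 : \int[mu]_(r in `]-oo, 0[) \1_E2 r <= 2 * N.
  rewrite (le_trans (Iind _ _ _))//; lra.
rewrite (le_trans (lerD (ler_wpM2l c10 i1) (ler_wpM2l c20 i2)))//.
have -> : c2 * (2 * N) = 2 * B1 * t ^+ 2 * m^-1.
  rewrite /c2 /N; field; exact: lt0r_neq0.
have q1 : 0 <= c1 * m^-1 by rewrite mulr_ge0// invr_ge0 ltW.
have q2 : 0 <= B1 * t ^+ 2 * e by rewrite !mulr_ge0 ?sqr_ge0// ltW.
rewrite -subr_ge0 [X in 0 <= X](_ : _ = 2 * (c1 * m^-1) + 2 * (B1 * t ^+ 2 * e)); last by ring.
by rewrite addr_ge0// mulr_ge0.
Qed.

End kernel_limit.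

Lemma alphaH_gt0 : 0 < alphaH H.
Proof.
rewrite /alphaH sqrtr_gt0 ltr_wpDr//.
  by apply: Rintegral_ge0 => s _; exact: sqr_ge0.
by rewrite invr_gt0; case/andP: hH => h0 _; rewrite mulr_gt0.
Qed.

Variable D : noise d H -> noise d (1 - H).
Hypothesis hD : is_DH D.

(** Both sides are compared with [DH_test] of a smoothed ramp: continuity of [D] controls one
    difference, [dprofile_limit] the other, each up to [eta / 2]. *)
Lemma DH_ramp t (c : 'rV[R]_d) (w : noise d H) : 0 < t -> npath w = ramp t c ->
  D w (- t) = - ((alphaH H)^-1 * ramp_integral t) *: c.
Proof.
move=> t0 wc; have [S iS] := @smooth_step R.
have al0 := alphaH_gt0.
have [K1 K10 HK1] := dprofile_limit iS t0.
have kr := ramp_kinked c t0.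
have [K2 K20 HK2] := kink_path_close hH iS t0 kr.
have nt : - t <= 0 by rewrite oppr_le0 ltW.
apply/eqP; rewrite -subr_eq0 -enorm_eq0 -normr_le0 (ger0_norm (enorm_ge0 _)).
apply/ler_addgt0Pr => eta eta0; rewrite add0r.
have eta2 : 0 < eta / 2 by rewrite divr_gt0.
have [del del0 Hdel] := DH_near hD w nt eta2.
have [e0 [N0 [e00 N00 HeN]]] := kink_params_small hH K20 del0.
pose C := (alphaH H)^-1 * K1 * (\sum_i `|c ord0 i|).
have C0 : 0 <= C by rewrite !mulr_ge0 ?invr_ge0 ?(ltW al0)// sumr_ge0.
(* Once [e] and [m^-1] are at most [z], the error [C * (e + m^-1)] is at most [eta / 2]. *)
pose z := eta / 2 / (2 * (C + 1)).
have z0 : 0 < z by rewrite divr_gt0// mulr_gt0// ltr_wpDl.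
pose e := Num.min (Num.min e0 (t / 4)) z.
have ep : 0 < e by rewrite !lt_min e00 z0 divr_gt0.
pose m := Num.max (Num.max 1 (2 * t)) (Num.max N0 z^-1).
have m1 : 1 <= m by rewrite /m !le_max lexx.
have mt : 2 * t <= m by rewrite /m !le_max lexx orbT.
have mN : N0 <= m by rewrite /m !le_max lexx !orbT.
have mz : z^-1 <= m by rewrite /m !le_max lexx !orbT.
have m0 : 0 < m by lra.
have NN : N0 <= 2 * m ^+ 2.
  have : m <= m ^+ 2 by rewrite expr2 ler_peMr// ltW.
  lra.
have N2 : 0 < 2 * m ^+ 2 by rewrite mulr_gt0// exprn_gt0.
pose u := kink_path S t (ramp t c) e (2 * m ^+ 2).
have ee0 : e <= e0 by rewrite /e !ge_min lexx.
have et4 : e <= t / 4 by rewrite /e !ge_min lexx orbT.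
have ez : e <= z by rewrite /e ge_min lexx orbT.
have tu : test_path u by apply: kink_path_test => //; lra.
have uw : noise_le H (u \- w) del.
  apply: noise_leBC; rewrite wc; apply: noise_leW (HK2 e (2 * m ^+ 2) ep N2).
  exact: HeN.
have Hu := Hdel _ tu uw.
set target := (- _ *: c).
have Ht : enorm (DH_test H u (- t) - target) <= eta / 2.
  rewrite (le_trans (enorm_le_sum _))//.
  have Hi i : `|(DH_test H u (- t) - target) ord0 i| <=
      (alphaH H)^-1 * K1 * (e + m^-1) * `|c ord0 i|.
    have -> : (DH_test H u (- t) - target) ord0 i = DH_test H u (- t) ord0 i - target ord0 i.
      by rewrite [LHS]mxE; congr (_ + _); rewrite mxE.
    have -> : target ord0 i = - ((alphaH H)^-1 * ramp_integral t) * c ord0 i by rewrite mxE.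
    rewrite (DH_testE H u i nt).
    have dprof (c' : 'rV[R]_d) s : s < 0 ->
        derive1 (fun x => kink_path S t (ramp t c') e (2 * m ^+ 2) x ord0 i) s =
        c' ord0 i * dprofile S t e (2 * m ^+ 2) s.
      move=> s0; rewrite derive1E.
      rewrite (@near_eq_derive _ _ _ _ (fun x => c' ord0 i * profile S t e (2 * m ^+ 2) x)).
        have := is_derive_profile t iS (2 * m ^+ 2) s ep => -[dp <-].
        by rewrite deriveMl.
      near=> x; have x0 : x < 0 by near: x; exact: lt_nbhsl.
      rewrite /kink_path (ltNge 0) (ltW x0)/= mxE /ramp !(ltNge 0) nt (ltW x0)/= maxxx.
      by rewrite !mxE /profile; ring.
    pose f r := dprofile S t e (2 * m ^+ 2) (- t + r) - dprofile S t e (2 * m ^+ 2) r.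
    have if1 : mu.-integrable `]-oo, 0[ (EFin \o (fun r => (- r) `^ a * f r)).
      (* The coordinate [c ord0 i] may vanish and cannot be divided out, so integrability for the
         unit profile is read off the ramp with all slopes 1. *)
      have kr1 := ramp_kinked (const_mx 1 : 'rV[R]_d) t0.
      have et2 : e <= t / 2 by lra.
      have tu1 := kink_path_test iS t0 kr1 ep et2 N2.
      have := DH_test_integrable hH i tu1 nt.
      apply: eq_integrable => // r; rewrite inE/= in_itv/= => r0.
      by rewrite /= !dprof ?mxE ?mul1r//; lra.
    have -> : \int[mu]_(r in `]-oo, 0[) ((- r) `^ (H - 2^-1) *
        (derive1 (fun x => u x ord0 i) (- t + r) - derive1 (fun x => u x ord0 i) r)) =
        c ord0 i * \int[mu]_(r in `]-oo, 0[) ((- r) `^ a * f r).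
      rewrite -RintegralZl//; apply: eq_Rintegral => r; rewrite inE/= in_itv/= => r0.
      by rewrite !dprof; [rewrite /f /a; ring|lra..].
    have := HK1 e m ep et4 m1 mt f (fun r _ => erefl) if1.
    set I := \int[mu]_(_ in _) _ => HI.
    rewrite (_ : _ - _ = (alphaH H)^-1 * (I + ramp_integral t) * c ord0 i); last by ring.
    rewrite !normrM (ger0_norm (_ : 0 <= (alphaH H)^-1)) ?invr_ge0 ?(ltW al0)//.
    by rewrite ler_wpM2r// -mulrA ler_wpM2l// invr_ge0 ltW.
  rewrite (le_trans (ler_sum _ (fun i _ => Hi i)))// -mulr_sumr mulrAC -/C.
  have mz' : m^-1 <= z by rewrite -[z]invrK lef_pV2 ?posrE ?invr_gt0.
  rewrite (@le_trans _ _ ((C + 1) * (2 * z)))//.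
    by rewrite ler_pM// ?lerDl//; [rewrite addr_ge0 ?invr_ge0 ?ltW|lra].
  by rewrite /z le_eqVlt; apply/orP; left; apply/eqP; field; rewrite gt_eqF// ltr_wpDl.
rewrite -(subrKA (DH_test H u (- t))) (le_trans (enormD _ _))// enormBC.
by rewrite (splitr eta) lerD.
Unshelve. all: by end_near. Qed.

End ramp_operator.

(** * Independence and Gaussian shifts *)

Section weighted_pushforward.
Local Open Scope ereal_scope.
Context d d' (T : measurableType d) (T' : measurableType d') (R : realType).
Variables (P : {measure set T -> \bar R}) (nu : {measure set T' -> \bar R}).
Variables (g : T -> R) (X : T -> T').
Hypotheses (g0 : forall x, (0 <= g x)%R) (mg : measurable_fun setT g)
  (mX : measurable_fun setT X)
  (gnu : forall B, measurable B -> \int[P]_x (g x * \1_B (X x))%:E = nu B).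

Import HBNNSimple.

Let weighted_nnsfun (h : {nnsfun T' >-> R}) :
  \int[P]_x (g x * h (X x))%:E = \int[nu]_y (h y)%:E.
Proof.
have mpre r : measurable (h @^-1` [set r]) by exact: measurable_sfunP.
have mi r : measurable_fun setT (fun x => \1_(h @^-1` [set r]) (X x) : R).
  by apply: measurableT_comp => //; exact: measurable_indic.
transitivity (\int[nu]_y (\sum_(r \in range h) (r * \1_(h @^-1` [set r]) y)%:E)); last first.
  by apply: eq_integral => t _; rewrite /= (fimfunE h) -fsumEFin.
rewrite ge0_integral_fsum//; last 2 first.
- by move=> r; apply/measurable_EFinP/measurable_funM => //; exact: measurable_indic.
- by move=> n y _; exact: nnfun_muleindic_ge0.
transitivity (\int[P]_x (\sum_(r \in range h) (g x * (r * \1_(h @^-1` [set r]) (X x)))%:E)).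
  apply: eq_integral => x _; rewrite (fimfunE h (X x)) fsumEFin// -fsumEFin//.
  by rewrite fsumEFin// mulr_fsumr.
rewrite ge0_integral_fsum//; last 2 first.
- move=> r; apply/measurable_EFinP/measurable_funM => //.
  exact: measurable_funM.
- move=> r x _; rewrite lee_fin mulr_ge0//.
  by have := nnfun_muleindic_ge0 h r (X x); rewrite lee_fin.
apply: eq_fsbigr => r rh.
have r0 : (0 <= r)%R by move: rh; rewrite inE => -[y _ <-].
under [LHS]eq_integral do rewrite mulrCA EFinM.
rewrite ge0_integralZl//; last 2 first.
- by apply/measurable_EFinP/measurable_funM.
- by move=> x _; rewrite lee_fin mulr_ge0.
rewrite gnu//; under [RHS]eq_integral do rewrite EFinM.
rewrite ge0_integralZl//; first by rewrite integral_indic// setIT.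
by apply/measurable_EFinP; exact: measurable_indic.
Qed.

(** [gnu] says that [nu] is the image under [X] of the measure with density [g]; simple functions
    and monotone convergence extend it from indicators. It covers densities and translations, and in
    [integral_prod_independent] the integration of one factor against all others. *)
Lemma weighted_integral_pushforward (f : T' -> R) : (forall y, (0 <= f y)%R) ->
  measurable_fun setT f ->
  \int[P]_x (g x * f (X x))%:E = \int[nu]_y (f y)%:E.
Proof.
move=> f0 mf; have mf' : measurable_fun setT (EFin \o f) by exact/measurable_EFinP.
pose h := nnsfun_approx measurableT mf'.
have hf y : (h n y)%:E @[n --> \oo] --> (f y)%:E.
  by apply: cvg_nnsfun_approx => // ? _; rewrite lee_fin.
have nh y : {homo (fun n => h n y) : m n / (m <= n)%N >-> (m <= n)%R}.
  by move=> m n mn; exact/lefP/nd_nnsfun_approx.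
transitivity (limn (fun n => \int[P]_x (g x * h n (X x))%:E)).
  rewrite -monotone_convergence//.
  - apply: eq_integral => x _; apply/esym/cvg_lim => //.
    under eq_fun do rewrite EFinM.
    rewrite EFinM; apply: cvgeZl => //; exact: hf.
  - move=> n; apply/measurable_EFinP/measurable_funM => //.
    exact: measurableT_comp.
  - by move=> n x _; rewrite lee_fin mulr_ge0.
  - by move=> x _ m n mn; rewrite lee_fin ler_wpM2l// nh.
transitivity (limn (fun n => \int[nu]_y (h n y)%:E)).
  by congr (limn _); apply/funext => n; exact: weighted_nnsfun.
rewrite -monotone_convergence//.
- by apply: eq_integral => y _; apply/cvg_lim => //; exact: hf.
- by move=> n; exact/measurable_EFinP.
- by move=> n y _; rewrite lee_fin.
- by move=> y _ m n mn; rewrite lee_fin nh.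
Qed.

End weighted_pushforward.

Section independent_product.
Local Open Scope ereal_scope.
Context d (T : measurableType d) (R : realType) (I : finType).
Variables (P : {measure set T -> \bar R}) (X : I -> T -> measurableTypeR R).
Variable Q : I -> {measure set (measurableTypeR R) -> \bar R}.
Hypotheses (mX : forall i, measurable_fun setT (X i))
  (Qfin : forall i, Q i setT < +oo)
  (PX : forall A : I -> set R, (forall i, measurable (A i)) ->
     P [set x | forall i, A i (X i x)] = \prod_i Q i (A i)).

Lemma integral_prod_independent (f : I -> R -> R) :
  (forall i x, (0 <= f i x)%R) ->
  (forall i, measurable_fun setT (f i : measurableTypeR R -> R)) ->
  (forall i, \int[Q i]_x (f i x)%:E < +oo) ->
  \int[P]_x (\prod_i f i (X i x))%:E = \prod_i \int[Q i]_x (f i x)%:E.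
Proof.
move=> f0 mf foo.
have mfX i (s : seq I) B : measurable B ->
    measurable_fun setT (fun x => if i \in s then f i (X i x) else \1_B (X i x) : R).
  move=> mB; case: (i \in s); first exact: measurableT_comp.
  by apply: measurableT_comp => //; exact: measurable_indic.
(* Indicators are replaced by the functions [f i] one index at a time: [s] lists the indices already
   treated, and the sets [A i] stay arbitrary so that the next index can be treated. *)
suff H (s : seq I) (A : I -> set R) : (forall i, measurable (A i)) ->
    \int[P]_x (\prod_i (if i \in s then f i (X i x) else \1_(A i) (X i x)))%:E =
    \prod_i (if i \in s then \int[Q i]_x (f i x)%:E else Q i (A i)).
  have := H (enum I) (fun=> setT) (fun=> measurableT).
  under eq_integral do under eq_bigr do rewrite mem_enum.
  by under eq_bigr do rewrite mem_enum.
elim: s A => [|j s IH] A mA.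
  rewrite -PX// -[X in _ = _ X]setIT -integral_indic//; last first.
    rewrite (_ : [set x | _] = \bigcap_(i in [set: I]) (X i @^-1` A i)).
      apply: fin_bigcap_measurable => // i _.
      by rewrite -[X in measurable X]setTI; exact: (mX i measurableT (mA i)).
    by apply/seteqP; split=> [x Hx i _|x Hx i]; exact: Hx.
  apply: eq_integral => x _ /=; congr EFin.
  have [Ax|/existsNP[i Ai]] := pselect (forall i, A i (X i x)).
    rewrite indicE mem_set//= big1// => i _.
    by rewrite indicE mem_set.
  rewrite [in RHS]indicE memNset//=.
  by rewrite (bigD1 i)//= indicE memNset// mul0r.
have [js|js] := boolP (j \in s).
  have E i : (i \in j :: s) = (i \in s) by rewrite inE; case: eqP => // ->.
  under eq_integral do under eq_bigr do rewrite E.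
  by under eq_bigr do rewrite E; exact: IH.
pose c := \prod_(i | i != j) (if i \in s then \int[Q i]_x (f i x)%:E else Q i (A i)).
have c0 : 0 <= c.
  apply: prode_ge0 => i _; case: ifP => _ //.
  by apply: integral_ge0 => x _; rewrite lee_fin.
have cfin : c \is a fin_num.
  apply: prode_fin_num => i _; case: ifP => _; rewrite ge0_fin_numE//.
    by apply: integral_ge0 => x _; rewrite lee_fin.
  apply: le_lt_trans (Qfin i); apply: le_measure; rewrite ?inE//; exact: mA.
have k0 : (0 <= fine c)%R by exact: fine_ge0.
pose g x : R := (\prod_(i | i != j) (if i \in s then f i (X i x) else \1_(A i) (X i x)))%R.
have g0 x : (0 <= g x)%R by apply: prodr_ge0 => i _; case: ifP.
have mg : measurable_fun setT g.
  rewrite /g; under eq_fun do rewrite big_mkcond.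
  by apply: measurable_prod => i _; case: (i != j); [exact: (mfX i s (A i) (mA i))|exact: measurable_cst].
have jE i : i != j -> (i \in j :: s) = (i \in s) by move=> /negbTE ij; rewrite inE ij.
(* Weighted by the other factors, the law of [X j] is a multiple of [Q j]; this is the induction
   hypothesis with [A j] replaced by [B]. *)
have gB B : measurable B -> \int[P]_x (g x * \1_B (X j x))%:E =
    mscale (NngNum k0) (Q j) B.
  move=> mB; pose A' i : set R := if i == j then B else A i.
  have mA' i : measurable (A' i) by rewrite /A'; case: (i == j); [exact: mB|exact: mA].
  rewrite /mscale/= fineK// -(_ : \prod_i (if i \in s then \int[Q i]_x (f i x)%:E
      else Q i (A' i)) = c * Q j B); last first.
    rewrite (bigD1 j)//= (negbTE js) /A' eqxx muleC; congr (_ * _).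
    by apply: eq_bigr => i /negbTE ->.
  rewrite -IH//; apply: eq_integral => x _; congr EFin.
  rewrite [in RHS](bigD1 j)//= (negbTE js) /A' eqxx mulrC; congr (_ * _)%R.
  by apply: eq_bigr => i /negbTE ->.
have := weighted_integral_pushforward g0 mg (mX j) gB (f0 j) (mf j).
rewrite ge0_integral_mscale//; last 2 first.
- by apply/measurable_EFinP; exact: mf.
- by move=> x _; rewrite lee_fin.
rewrite /= fineK// => Hj.
rewrite [RHS](bigD1 j)//= mem_head muleC.
under [in RHS]eq_bigr => i ij do rewrite (jE i ij).
rewrite -Hj; apply: eq_integral => x _; congr EFin.
rewrite (bigD1 j)//= mem_head mulrC; congr (_ * _)%R.
by apply: eq_bigr => i ij; rewrite (jE i ij).
Qed.

End independent_product.

Section normal_shift.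
Context (R : realType).
Local Open Scope ereal_scope.
Local Notation leb := (@lebesgue_measure R).

Lemma lebesgue_measure_shift (m : R) (A : set R) : measurable A ->
  leb [set x | A (x - m)%R] = leb A.
Proof.
move=> mA; apply/esym.
have mf : measurable_fun setT (fun x : measurableTypeR R => (x - m)%R : measurableTypeR R).
  by apply: measurable_funB.
have := @lebesgue_measure_unique R (pushforward leb (fun x : measurableTypeR R => (x - m)%R : measurableTypeR R)).
apply => // _ [[a b]] _ <-.
transitivity (leb `](a + m)%R, (b + m)%R]%classic).
  rewrite !lebesgue_measure_itv/= !lte_fin ltrD2r.
  by case: ifPn => // _; rewrite -!EFinB; congr EFin; ring.
congr (leb _); apply/seteqP; split => x; rewrite /= !in_itv/= ltrBrDr lerBlDr//.
Qed.

(** The one-dimensional Cameron-Martin formula: the exponential is the density of N(- c v, v) with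
    respect to N(0, v). *)
Lemma normal_prob_shift (v c : R) (A : set R) : (0 < v)%R -> measurable A ->
  normal_prob 0 (Num.sqrt v) [set x | A (x - c * v)%R] =
  \int[normal_prob 0 (Num.sqrt v)]_x ((expR (- c * x - c ^+ 2 * v / 2) * \1_A x)%R)%:E.
Proof.
move=> v0 mA; set s := Num.sqrt v.
have s0 : s != 0%R by rewrite gt_eqF// sqrtr_gt0.
have sv : (s ^+ 2 = v)%R by rewrite sqr_sqrtr// ltW.
pose p := @normal_pdf R 0 s.
have p0 x : (0 <= p x)%R by exact: normal_pdf_ge0.
have mp : measurable_fun setT p by exact: measurable_normal_pdf.
pose h x := (expR (- c * x - c ^+ 2 * v / 2) * \1_A x)%R.
have h0 x : (0 <= h x)%R by rewrite mulr_ge0// expR_ge0.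
have mh : measurable_fun setT (h : measurableTypeR R -> R).
  apply: measurable_funM; last exact: measurable_indic.
  by apply: measurableT_comp => //; apply: measurable_funB => //.
have pB (B : set (measurableTypeR R)) : measurable B -> \int[leb]_x (p x * \1_B (id x))%:E =
    normal_prob 0 s B.
  move=> mB; rewrite /normal_prob [RHS]integral_mkcond.
  apply: eq_integral => x _; rewrite patchE /= indicE.
  by case: ifP => _; rewrite ?mulr1 ?mulr0.
have mid : measurable_fun setT (id : measurableTypeR R -> measurableTypeR R) by [].
rewrite -(@weighted_integral_pushforward _ _ _ _ _ leb (normal_prob 0 s) p id p0 mp mid pB h h0 mh) /=.
have mt : measurable_fun setT (fun x : measurableTypeR R => (x - c * v)%R : measurableTypeR R).
  by apply: measurable_funB.
have ph x : (p x * h x = p (x + c * v) * \1_A x)%R.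
  rewrite /p !normal_pdfE// /normal_fun /h mulrA -!mulrA; congr (_ * _)%R.
  rewrite mulrA -expRD; congr (expR _ * _)%R.
  by rewrite !subr0 sv -mulr_natl; field; rewrite gt_eqF.
transitivity (\int[leb]_x (p (x + c * v) * \1_A x)%:E); last first.
  by apply: eq_integral => x _; rewrite ph.
have q0 x : (0 <= p (x + c * v) * \1_A x)%R by rewrite mulr_ge0.
have mq : measurable_fun setT (fun x : measurableTypeR R => (p (x + c * v) * \1_A x)%R).
  apply: measurable_funM; last exact: measurable_indic.
  apply: (@measurableT_comp _ _ _ _ _ _ p) => //.
  exact: measurable_funD.
have one0 x : (0 <= (cst 1%R : measurableTypeR R -> R) x)%R by [].
rewrite -(@weighted_integral_pushforward _ _ _ _ _ leb leb (cst 1%R) _ one0 _ mt _ _ q0 mq)//; last first.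
  move=> B mB; rewrite -[RHS](lebesgue_measure_shift (c * v) mB).
  under eq_integral do rewrite mul1r.
  rewrite -[X in _ = _ X]setIT -integral_indic//.
  rewrite -[X in measurable X]setTI; exact: mt.
rewrite /normal_prob [LHS]integral_mkcond; apply: eq_integral => x _.
rewrite patchE /= mul1r subrK indicE.
rewrite (_ : (x \in [set x | A (x - c * v)%R]) = ((x - c * v)%R \in A)).
  by case: ifP => _; rewrite ?mulr1 ?mulr0.
by apply/idP/idP; rewrite !inE.
Qed.

End normal_shift.

(** * The Cameron-Martin formula along ramps *)

Section cameron_martin.
Context {R : realType} {d : nat} (H : R).
Hypothesis hH : 0 < H < 1.
Variable W : probability (noise d H) R.
Hypothesis hW : wiener W.
Variables (T : R) (T0 : 0 < T).
Implicit Types (w : noise d H) (c : 'rV[R]_d) (l : seq R).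

Lemma measurable_noise_eval t (i : 'I_d) :
  measurable_fun setT (fun w => npath w t ord0 i).
Proof.
move=> _ B mB; rewrite setTI; apply: sub_sigma_algebra.
exists t, [set x | B (x ord0 i)]; split => //.
by rewrite -[X in measurable X]setTI; exact: (measurable_coord i measurableT).
Qed.

Lemma measurable_fun_noise d' (T' : measurableType d') (f : T' -> noise d H) :
  (forall t i, measurable_fun setT (fun x => npath (f x) t ord0 i)) ->
  measurable_fun setT f.
Proof.
move=> mf; apply: (@measurability _ _ _ _ _ _ (@noise_cylinders R d H)) => //.
move=> _ [_ [t [B [mB ->]]] <-]; rewrite setTI.
have := measurable_fun_rV (fun i => mf t i); move=> /(_ measurableT B mB).
by rewrite setTI.
Qed.

Definition add_ramp c w : noise d H := Noise (noise_pathD (noiseP w) (ramp_noise hH c T0)).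

Lemma add_rampE c w t : npath (add_ramp c w) t = npath w t + ramp T c t.
Proof. by []. Qed.

Lemma measurable_add_ramp c : measurable_fun setT (add_ramp c).
Proof.
apply: measurable_fun_noise => t i.
rewrite (_ : (fun w => _) = (fun w => npath w t ord0 i + ramp T c t ord0 i)).
  by apply: measurable_funD => //; exact: measurable_noise_eval.
by apply/funext => w; rewrite add_rampE mxE.
Qed.

(** The Cameron-Martin density for the ramp. Its slope is constant on [[- T, 0]], so the stochastic
    integral in the exponent reduces to the end value [w (- T)]. *)
Definition shift_density c w : R :=
  expR (\sum_i (- c ord0 i * npath w (- T) ord0 i - c ord0 i ^+ 2 * T / 2)).

Lemma measurable_shift_density c : measurable_fun setT (shift_density c).
Proof.
apply: measurableT_comp => //; apply: measurable_sum => i.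
apply: measurable_funB => //; apply: measurable_funM => //.
exact: measurable_noise_eval.
Qed.

Let good c (E : set (noise d H)) := measurable E /\
  W [set w | E (add_ramp c w)] = (\int[W]_(w in E) (shift_density c w)%:E)%E.

Let mpre c E : measurable E -> measurable [set w | E (add_ramp c w)].
Proof.
by move=> mE; rewrite -[X in measurable X]setTI; exact: (measurable_add_ramp c measurableT mE).
Qed.

(** Stability under complements requires the density to have total mass 1, which is the formula for
    [setT]. *)
Let good_dynkin c : good c setT -> dynkin (good c).
Proof.
move=> [_ gT].
have mD := measurable_shift_density c.
have D0 w : (0%R <= (shift_density c w)%:E)%E by rewrite lee_fin expR_ge0.
split => [|E [mE gE]|F tF gF]; first by split.
- split; first exact: measurableC.
  have -> : [set w | (~` E) (add_ramp c w)] = ~` [set w | E (add_ramp c w)] by [].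
  rewrite probability_setC; last exact: mpre.
  have gT1 : (\int[W]_(w in setT) (shift_density c w)%:E = 1)%E.
    rewrite -gT; have -> : [set w | [set: noise d H] (add_ramp c w)] = setT by apply/seteqP; split.
    exact: probability_setT.
  have := @ge0_integral_setU _ _ _ W E (~` E) mE (measurableC mE)
    (fun w => (shift_density c w)%:E).
  rewrite setUv gT1 => ->//; last 2 first.
  - exact/measurable_EFinP.
  - by apply/disj_setPS; rewrite setICr.
  rewrite -gE addeAC subee ?add0e//.
  by apply: fin_num_measure; exact: mpre.
- split; first by apply: bigcup_measurable => k _; case: (gF k).
  rewrite ge0_integral_bigcup//; last 2 first.
  - by move=> k; case: (gF k).
  - by apply: measurable_funTS; exact/measurable_EFinP.
  have -> : [set w | (\bigcup_k F k) (add_ramp c w)] =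
      \bigcup_k [set w | F k (add_ramp c w)] by [].
  rewrite measure_bigcup//; last 2 first.
  - by move=> k _; apply: mpre; case: (gF k).
  - apply/trivIsetP => i j _ _ ij; move/trivIsetP : tF => /(_ i j I I ij).
    by rewrite -!subset0 => + w [] => /(_ (add_ramp c w)) + ? ?; apply.
  transitivity (\sum_(0 <= k <oo) W [set w | F k (add_ramp c w)])%E.
    by apply: eq_eseriesl => k; rewrite in_setT.
  by apply: eq_eseriesr => k _; case: (gF k).
Qed.

Section grid.
Variables (n : nat) (t : nat -> R).
(* [T] is a grid point, so that the ramp is affine between grid points. *)
Hypotheses (t00 : t 0%N = 0) (tlt : forall k, (k < n)%N -> t k < t k.+1)
  (tT : exists2 j, (j <= n)%N & t j = T).

Let incr (k : 'I_n) (i : 'I_d) w := npath w (- t k.+1) ord0 i - npath w (- t k) ord0 i.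

Let box (A : 'I_n -> 'I_d -> set R) : set (noise d H) :=
  [set w | forall k i, A k i (incr k i w)].

Definition increment_boxes : set (set (noise d H)) :=
  [set E | exists A : 'I_n -> 'I_d -> set R,
    (forall k i, measurable (A k i)) /\ E = box A].

Let measurable_incr k i : measurable_fun setT (incr k i).
Proof. by apply: measurable_funB; exact: measurable_noise_eval. Qed.

Let measurable_box (A : 'I_n -> 'I_d -> set R) : (forall k i, measurable (A k i)) -> measurable (box A).
Proof.
move=> mA; rewrite (_ : box A = \bigcap_(p in [set: 'I_n * 'I_d])
    (incr p.1 p.2 @^-1` A p.1 p.2)).
  apply: fin_bigcap_measurable => // -[k i] _.
  by rewrite -[X in measurable X]setTI; exact: (measurable_incr k i measurableT (mA k i)).
by apply/seteqP; split=> [w Hw [k i] _|w Hw k i]; [exact: Hw|exact: (Hw (k, i))].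
Qed.

Let tle j k : (j <= k)%N -> (k <= n)%N -> t j <= t k.
Proof.
elim: k => [|k IH]; first by rewrite leqn0 => /eqP ->.
rewrite leq_eqVlt => /predU1P[->//|jk] kn.
by rewrite (le_trans (IH _ _))// ?(ltW (tlt _))// ltnW.
Qed.

(** The time that the sloping part of the ramp spends in the grid cell [k]: the increment over it is
    shifted by [- c * dt k]. *)
Let dt k := Num.min (t k.+1) T - Num.min (t k) T.

Let tT_or k : (k < n)%N -> t k.+1 <= T \/ T <= t k.
Proof.
move=> kn; have [j jn <-] := tT; have [jk|kj] := leqP j k.
  by right; apply: tle => //; exact: ltnW.
by left; exact: tle.
Qed.

Let ramp_grid c k (i : 'I_d) : (k <= n)%N ->
  ramp T c (- t k) ord0 i = - Num.min (t k) T * c ord0 i.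
Proof.
move=> kn; have tk0 : 0 <= t k by rewrite -t00 tle.
by rewrite /ramp ltNge oppr_le0 tk0/= mxE; congr (_ * _); rewrite -oppr_min.
Qed.

Let telescope (V : zmodType) (f : R -> V) :
  \sum_(k < n) (f (Num.min (t k.+1) T) - f (Num.min (t k) T)) = f T - f 0.
Proof.
have [j jn tj] := tT.
rewrite -(big_mkord xpredT (fun k => f (Num.min (t k.+1) T) - f (Num.min (t k) T))).
rewrite telescope_sumr// t00 (min_l (ltW T0)); congr (f _ - _).
by rewrite min_r// -tj tle.
Qed.

Let factor c (p : 'I_n * 'I_d) (A : 'I_n -> 'I_d -> set R) (x : R) : R :=
  (if t p.1.+1 <= T then expR (- c ord0 p.2 * x - c ord0 p.2 ^+ 2 * (t p.1.+1 - t p.1) / 2)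
   else 1) * \1_(A p.1 p.2) x.

Let prod_factor c (A : 'I_n -> 'I_d -> set R) w :
  \prod_p factor c p A (incr p.1 p.2 w) = shift_density c w * \1_(box A) w.
Proof.
rewrite big_split/=; congr (_ * _); last first.
  have [Ax|] := pselect (box A w).
    rewrite indicE mem_set// big1// => -[k i] _.
    by rewrite indicE mem_set//; exact: Ax.
  move=> nAx; rewrite [RHS]indicE memNset//.
  have /existsNP[k /existsNP[i Ai]] : ~ (forall k i, A k i (incr k i w)) := nAx.
  by rewrite (bigD1 (k, i))//= indicE memNset// mul0r.
rewrite /shift_density expR_sum -(pair_bigA _ (fun (k : 'I_n) (i : 'I_d) => if t k.+1 <= T then
  expR (- c ord0 i * incr k i w - c ord0 i ^+ 2 * (t k.+1 - t k) / 2) else 1))/=.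
rewrite exchange_big/=; apply: eq_bigr => i _.
(* With [Num.min], cells beyond [T] get the factor 1 without a case distinction, and the exponents
   telescope to [w (- T)] and [T]. *)
transitivity (\prod_(k < n) expR (- c ord0 i *
   (npath w (- Num.min (t k.+1) T) ord0 i - npath w (- Num.min (t k) T) ord0 i)
   - c ord0 i ^+ 2 * (Num.min (t k.+1) T - Num.min (t k) T) / 2)).
  apply: eq_bigr => k _; have [tk|tk] := tT_or (ltn_ord k).
    rewrite tk !min_l// (le_trans _ tk)// ltW// tlt//.
  rewrite leNgt (le_lt_trans tk)/=; last exact: tlt.
  rewrite !min_r// ?(le_trans tk) ?(ltW (tlt _))//.
  by rewrite !subrr !mulr0 mul0r subr0 expR0.
rewrite -expR_sum; congr expR; rewrite sumrB -mulr_sumr.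
rewrite (telescope (fun x => npath w (- x) ord0 i)).
have -> : npath w (- 0) ord0 i = 0 by rewrite oppr0 (noiseP w).1.1 mxE.
rewrite subr0; congr (_ - _).
by rewrite -mulr_suml -mulr_sumr (telescope id) subr0.
Qed.

Let integral_factor (c : 'rV[R]_d) (p : 'I_n * 'I_d) (A : 'I_n -> 'I_d -> set R) : (forall k i, measurable (A k i)) ->
  (\int[normal_prob 0 (Num.sqrt (t p.1.+1 - t p.1))]_x (factor c p A x)%:E =
   normal_prob 0 (Num.sqrt (t p.1.+1 - t p.1))
     [set x | A p.1 p.2 (x - c ord0 p.2 * dt p.1)%R])%E.
Proof.
move=> mA; rewrite /factor /dt; have pn := ltn_ord p.1; have [tk|tk] := tT_or pn.
  rewrite tk !min_l ?(le_trans _ tk) ?(ltW (tlt pn))//.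
  by rewrite normal_prob_shift// subr_gt0 tlt.
rewrite leNgt (le_lt_trans tk) ?tlt//= !min_r// ?(le_trans tk) ?(ltW (tlt pn))//.
rewrite subrr mulr0; under eq_integral do rewrite mul1r.
rewrite integral_indic//; last exact: mA.
by rewrite setIT; congr (normal_prob _ _ _); apply/seteqP; split => x /=; rewrite subr0.
Qed.

(** By independence of the increments both sides are products over cells and coordinates, and
    [normal_prob_shift] matches them factor by factor. *)
Let good_box c (A : 'I_n -> 'I_d -> set R) : (forall k i, measurable (A k i)) -> good c (box A).
Proof.
move=> mA; split; first exact: measurable_box.
pose Q (p : 'I_n * 'I_d) : {measure set (measurableTypeR R) -> \bar R} :=
  normal_prob 0 (Num.sqrt (t p.1.+1 - t p.1)).
have mA' k i : measurable [set x : R | A k i (x - c ord0 i * dt k)].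
  have mf : measurable_fun setT (fun x : R => x - c ord0 i * dt k) by exact: measurable_funB.
  by rewrite -[X in measurable X]setTI; exact: (mf measurableT _ (mA k i)).
have t0 : 0 <= t 0%N by rewrite t00.
transitivity (\prod_(p : 'I_n * 'I_d) Q p [set x | A p.1 p.2 (x - c ord0 p.2 * dt p.1)%R])%E.
  rewrite -(pair_bigA _ (fun k i => Q (k, i) [set x | A k i (x - c ord0 i * dt k)%R]))/=.
  rewrite -(hW t0 tlt mA'); congr (W _); apply/seteqP; split=> w /= Hw k i.
    have := Hw k i; rewrite /incr !add_rampE !mxE.
    rewrite !ramp_grid//; last exact: ltnW.
    by congr (A k i _); rewrite /dt; ring.
  have := Hw k i; congr (A k i _); rewrite /incr !add_rampE !mxE.
  rewrite !ramp_grid//; last exact: ltnW.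
  by rewrite /dt; ring.
transitivity (\prod_(p : 'I_n * 'I_d) \int[Q p]_x (factor c p A x)%:E)%E.
  by apply: eq_bigr => p _; rewrite integral_factor.
rewrite -(@integral_prod_independent _ _ _ _ W (fun p => incr p.1 p.2) Q _ _ _ (fun p => factor c p A)).
- rewrite [RHS]integral_mkcond; apply: eq_integral => w _; rewrite prod_factor patchE indicE.
  by case: (w \in box A); rewrite ?mulr1 ?mulr0.
- by move=> p; exact: measurable_incr.
- move=> p; apply: (@le_lt_trans _ _ 1%E); last exact: ltry.
  exact: (probability_le1 (normal_prob 0 (Num.sqrt (t p.1.+1 - t p.1)))).
- move=> B mB; transitivity (\prod_(k < n) \prod_(i < d) Q (k, i) (B (k, i)))%E; last first.
    by rewrite pair_bigA; apply: eq_bigr => -[].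
  rewrite -(hW t0 tlt (fun k i => mB (k, i))); congr (W _); apply/seteqP; split=> w /= Hw.
    by move=> k i; exact: (Hw (k, i)).
  by move=> [k i]; exact: Hw.
- by move=> p x; rewrite /factor mulr_ge0//; case: ifP => // _; exact: expR_ge0.
- move=> p; apply: measurable_funM; last exact: (measurable_indic (mA p.1 p.2)).
  case: (t p.1.+1 <= T) => //; apply: measurableT_comp => //.
  by apply: measurable_funB => //.
- move=> p; rewrite integral_factor// (@le_lt_trans _ _ 1%E) ?ltry//.
  exact: (probability_le1 (normal_prob 0 (Num.sqrt (t p.1.+1 - t p.1))) (mA' p.1 p.2)).
Qed.

Lemma shift_good_boxes c : <<s increment_boxes >> `<=` good c.
Proof.
have bT : increment_boxes setT.
  exists (fun _ _ => setT); split => //.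
  by apply/seteqP; split.
have gb : increment_boxes `<=` good c by move=> _ [A [mA ->]]; exact: good_box.
apply: lambda_system_subset => //.
- move=> _ _ [A [mA ->]] [B [mB ->]]; exists (fun k i => A k i `&` B k i); split.
    by move=> k i; apply: measurableI; [exact: mA|exact: mB].
  apply/seteqP; split => w; first by move=> [HA HB] k i; split; [exact: HA|exact: HB].
  by move=> HAB; split=> k i; have [] := HAB k i.
- by apply/dynkin_lambda_system/good_dynkin/gb.
Qed.

Lemma grid_eval_measurable k (i : 'I_d) (B : set R) : (k <= n)%N -> measurable B ->
  <<s increment_boxes >> [set w | B (npath w (- t k) ord0 i)].
Proof.
move=> kn mB.
pose GT := g_sigma_algebraType increment_boxes.
have mincr (j : 'I_n) : measurable_fun setT (incr j i : GT -> R).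
  move=> _ C mC; rewrite setTI; apply: sub_sigma_algebra.
  exists (fun j' i' => if (j' == j) && (i' == i) then C else setT); split.
    by move=> j' i'; case: ifP => _ //; exact: measurableT.
  apply/seteqP; split => w /=; last by move=> /(_ j i); rewrite !eqxx.
  by move=> Cw j' i'; case: ifP => // /andP[/eqP -> /eqP ->].
have msum m : (m <= n)%N -> measurable_fun setT (fun w : GT => npath w (- t m) ord0 i).
  elim: m => [_|m IH mn].
    rewrite (_ : (fun w => _) = cst 0)//.
    by apply/funext => w; rewrite t00 oppr0 (noiseP w).1.1 mxE.
  rewrite (_ : (fun w => _) =
      (fun w : GT => npath w (- t m) ord0 i + incr (Ordinal mn) i w)).
    by apply: measurable_funD => //; apply: IH; exact: ltnW.
  by apply/funext => w; rewrite /incr addrC subrK.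
by have := msum k kn measurableT B mB; rewrite setTI.
Qed.

End grid.

Let evals l : set (set (noise d H)) := [set E | exists t (i : 'I_d) (B : set R),
  [/\ t \in l, 0 <= t, measurable B & E = [set w | B (npath w (- t) ord0 i)]]].

(** Adding 0 and [T] to the times in [l] and sorting gives an admissible grid; a value at a grid
    time is a sum of increments from 0, so [evals l] lies in the sigma-algebra of the increment
    boxes. *)
Let good_evals c l : <<s evals l >> `<=` good c.
Proof.
pose l' := undup (0 :: T :: [seq x <- l | 0 <= x]).
pose m := sort <=%O l'; pose t := nth 0 m.
have sm : sorted <%O m by rewrite sort_lt_sorted undup_uniq.
have mE x : (x \in m) = (x == 0) || (x == T) || (x \in l) && (0 <= x).
  by rewrite mem_sort mem_undup !inE mem_filter orbA andbC.
have sz : (0 < size m)%N.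
  by rewrite lt0n size_eq0; apply/eqP => m0; have := mE 0; rewrite m0 eqxx.

have t_in k : (k < size m)%N -> t k \in m by move=> km; exact: mem_nth.
have t_index x : x \in m -> t (index x m) = x by move=> xm; exact: nth_index.
pose n := (size m).-1.
have nS k : (k <= n)%N = (k < size m)%N by rewrite -[in RHS](prednK sz) ltnS.
have tlt k : (k < n)%N -> t k < t k.+1.
  move=> kn; have kn' : (k.+1 < size m)%N by rewrite -nS.
  apply: (sorted_ltn_nth lt_trans 0 sm) => //; rewrite inE//.
  exact: ltnW.
have t00 : t 0%N = 0.
  have m0 : 0 \in m by rewrite mE eqxx.
  apply/eqP; rewrite eq_le; apply/andP; split.
    apply: (@le_trans _ _ (t (index 0 m))); last by rewrite t_index.
    apply: (sorted_leq_nth le_trans le_refl 0 (sort_le_sorted l')) => //; rewrite inE//.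
    by rewrite index_mem.
  have := t_in _ sz; rewrite mE => /orP[/orP[/eqP ->//|/eqP ->]|/andP[]//].
  exact: ltW.
have tT : exists2 j, (j <= n)%N & t j = T.
  have mT : T \in m by rewrite mE eqxx orbT.
  by exists (index T m); [rewrite nS index_mem|exact: t_index].
apply: subset_trans (shift_good_boxes t00 tlt tT c).
apply: smallest_sub; first exact: smallest_sigma_algebra.
move=> _ [x [i [B [xl x0 mB ->]]]].
have xm : x \in m by rewrite mE xl x0 !orbT.
rewrite -{1}(t_index _ xm); apply: grid_eval_measurable => //.
by rewrite nS index_mem.
Qed.

(** The union [G] over finite lists of times generates the sigma-algebra and is stable under
    intersection, by concatenation of lists. The Dynkin argument is thus used twice: inside each
    grid, and on [G]. *)
Theorem cameron_martin c E : measurable E ->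
  W [set w | E (add_ramp c w)] = (\int[W]_(w in E) (shift_density c w)%:E)%E.
Proof.
move=> mE; suff [] : good c E by [].
pose G := \bigcup_l <<s evals l>>.
have Ggood : G `<=` good c by move=> A [l _ /good_evals]; exact.
have GT : G setT.
  by exists [::] => //; exact: (@measurableT _ (g_sigma_algebraType (evals [::]))).
suff : <<s G>> `<=` good c.
  apply; move: E mE; apply: smallest_sub; first exact: smallest_sigma_algebra.
  move=> _ [t [B [mB ->]]]; apply: sub_sigma_algebra; exists [:: - t] => //.
  pose V := g_sigma_algebraType (evals [:: - t]).
  suff : measurable_fun setT (fun w : V => npath w t) by move=> /(_ measurableT B mB); rewrite setTI.
  apply: measurable_fun_rV => i; have [t0|t0] := ltP 0 t.
    rewrite (_ : (fun w => _) = cst 0)//.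
    by apply/funext => w; rewrite (noiseP w).1.2// mxE.
  move=> _ C mC; rewrite setTI; apply: sub_sigma_algebra.
  by exists (- t), i, C; rewrite mem_head oppr_ge0 opprK.
apply: lambda_system_subset => //.
- move=> A B [l1 _ A1] [l2 _ B2]; exists (l1 ++ l2) => //.
  have sub l l3 : {subset l <= l3} -> <<s evals l>> `<=` <<s evals l3>>.
    move=> ll; apply: sub_sigma_algebra2 => _ [t [i [C [tl t0 mC ->]]]].
    by exists t, i, C; rewrite ll.
  apply: (@measurableI _ (g_sigma_algebraType (evals (l1 ++ l2)))).
    by apply: (sub l1) A1 => x xl; rewrite mem_cat xl.
  by apply: (sub l2) B2 => x xl; rewrite mem_cat xl orbT.
- by apply/dynkin_lambda_system/good_dynkin/Ggood.
Qed.

End cameron_martin.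

(** * Concentration under the Wiener measure *)

Section concentration.
Context {R : realType} {d : nat} (H : R).
Hypothesis hH : 0 < H < 1.
Variable W : probability (noise d H) R.
Hypothesis hW : wiener W.
Variables (T : R) (T0 : 0 < T).

Let I : set 'rV[R]_d := [set c | forall i, `[-1, 1]%classic (c ord0 i)].

Lemma measurable_rV_box n (A : 'I_n -> set R) : (forall i, measurable (A i)) ->
  measurable [set c : 'rV[R]_n | forall i, A i (c ord0 i)].
Proof.
move=> mA; rewrite (_ : [set c | _] = \bigcap_(i in [set: 'I_n])
    ((fun c : 'rV[R]_n => c ord0 i) @^-1` A i)).
  apply: fin_bigcap_measurable => // i _.
  by rewrite -[X in measurable X]setTI; exact: (measurable_coord i measurableT (mA i)).
by apply/seteqP; split=> c Hc i; [move=> _|]; exact: Hc.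
Qed.

Let mI : measurable I.
Proof. exact: (@measurable_rV_box d (fun=> `[(-1)%R, 1%R]%classic) (fun i => measurable_itv _)). Qed.

Let quad (a x : R) : -1 <= a <= 1 -> 0 <= - a * x ->
  - (T / 2) <= - a * x - a ^+ 2 * T / 2.
Proof.
move=> /andP[a1 a2] ax; have : 0 <= (1 - a) * (1 + a) * T.
  by apply: mulr_ge0; [apply: mulr_ge0; lra|exact: ltW].
by lra.
Qed.

(** On the unit cube [J] of those [c] whose coordinates have signs opposite to those of [w (- T)],
    the linear term is nonnegative, which leaves a lower bound independent of [w]. *)
Let density_integral (w : noise d H) :
  ((expR (- (d%:R * T / 2)))%:E <=
   \int[lebesgue_rV d]_(c in I) (shift_density T c w)%:E)%E.
Proof.
pose A (i : 'I_d) : set R :=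
  if 0 <= npath w (- T) ord0 i then `[(-1)%R, 0%R]%classic else `[0%R, 1%R]%classic.
pose J : set 'rV[R]_d := [set c | forall i, A i (c ord0 i)].
have mA i : measurable (A i) by rewrite /A; case: ifP => _; exact: measurable_itv.
have mJ : measurable J by exact: measurable_rV_box.
have JI : J `<=` I.
  move=> c Jc i; have := Jc i; rewrite /A; case: ifP => _ /=; rewrite !in_itv/= => /andP[h1 h2];
  by apply/andP; split => //; lra.
have leJ : lebesgue_rV d J = 1%E.
  rewrite lebesgue_rV_box// big1// => i _; rewrite /A; case: ifP => _;
  by rewrite lebesgue_measure_itv/= lte_fin ?ltrN10 ?ltr01 -EFinB; congr EFin; lra.
have mD : measurable_fun setT (fun c => shift_density T c w).
  apply: measurableT_comp => //; apply: measurable_sum => i.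
  apply: measurable_funB => //; apply: measurable_funM => //.
    by apply: measurableT_comp => //; exact: measurable_coord.
  by apply: measurable_funM => //; apply: measurable_funX; exact: measurable_coord.
apply: (@le_trans _ _ (\int[lebesgue_rV d]_(c in J) (shift_density T c w)%:E)%E).
  rewrite -[leLHS]mule1 -leJ -integral_cst//; apply: ge0_le_integral => //.
  - by move=> c _; rewrite lee_fin expR_ge0.
  - by apply: measurable_funTS; exact/measurable_EFinP.
  move=> c Jc; rewrite lee_fin ler_expR.
  have -> : - (d%:R * T / 2) = \sum_(i < d) - (T / 2).
    by rewrite sumr_const card_ord -mulr_natl; ring.
  apply: ler_sum => i _; have := Jc i; rewrite /A.
  case: leP => x0; rewrite /= in_itv/= => /andP[h1 h2]; apply: quad; rewrite ?h1 ?h2 ?andbT.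
  - exact: le_trans h2 _.
  - by rewrite mulr_ge0// oppr_ge0.
  - by apply: le_trans h1; rewrite lerN10.
  - by rewrite mulNr -mulrN mulr_ge0// oppr_ge0 ltW.
apply: ge0_subset_integral => //.
- by apply: measurable_funTS; exact/measurable_EFinP.
- by move=> c _; rewrite lee_fin expR_ge0.
Qed.

Let measurable_pair_coord i :
  measurable_fun setT (fun z : noise d H * 'rV[R]_d => z.2 ord0 i).
Proof. exact: (measurableT_comp (measurable_coord i) measurable_snd). Qed.

Let measurable_pair_eval t i :
  measurable_fun setT (fun z : noise d H * 'rV[R]_d => npath z.1 t ord0 i).
Proof. exact: (measurableT_comp (measurable_noise_eval (H := H) t i) measurable_fst). Qed.

Lemma measurable_add_ramp_pair : measurable_fun setT
  (fun z : noise d H * 'rV[R]_d => add_ramp hH T0 z.2 z.1).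
Proof.
apply: measurable_fun_noise => t i.
rewrite (_ : (fun x => _) = (fun z : noise d H * 'rV[R]_d =>
    npath z.1 t ord0 i + ramp T z.2 t ord0 i)).
  apply: measurable_funD => //.
  rewrite (_ : (fun x => _) = (fun z : noise d H * 'rV[R]_d =>
      (if 0 < t then 0 else Num.max t (- T)) * z.2 ord0 i)); first exact: measurable_funM.
  by apply/funext => z; rewrite /ramp; case: (0 < t); rewrite mxE// mul0r.
by apply/funext => z; rewrite add_rampE mxE.
Qed.

Lemma measurable_ramp_section w (E : set (noise d H)) : measurable E ->
  measurable [set c | E (add_ramp hH T0 c w)].
Proof.
move=> mE; have := measurableT_comp measurable_add_ramp_pair
  (measurable_pair1 (T2 := 'rV[R]_d) w).
by move=> /(_ measurableT E mE); rewrite setTI.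
Qed.

(** By [density_integral] the left side is at most the integral of the density over [E] and [I].
    Tonelli and Cameron-Martin turn this into the mean over [w] of the volume of those slopes in [I]
    whose ramps carry [w] into [E]. *)
Lemma wiener_concentration (E : set (noise d H)) (b : \bar R) : measurable E ->
  (forall w, (lebesgue_rV d (I `&` [set c | E (add_ramp hH T0 c w)]) <= b)%E) ->
  ((expR (- (d%:R * T / 2)))%:E * W E <= b)%E.
Proof.
move=> mE hb; pose L := lebesgue_rV (R := R) d.
have mco := measurable_pair_coord; have mev := measurable_pair_eval.
have mD : measurable_fun setT (fun z : noise d H * 'rV[R]_d => shift_density T z.2 z.1).
  apply: measurableT_comp => //; apply: measurable_sum => i.
  apply: measurable_funB => //; apply: measurable_funM => //.
    exact: measurableT_comp.
  by apply: measurable_funM => //; exact: measurable_funX.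
have madd := measurable_add_ramp_pair.
have m1 : measurable_fun setT (fun z : noise d H * 'rV[R]_d =>
    (shift_density T z.2 z.1 * (\1_E z.1 * \1_I z.2))%:E).
  apply/measurable_EFinP; apply: measurable_funM => //; apply: measurable_funM.
    by apply: measurableT_comp => //; exact: measurable_indic.
  by apply: measurableT_comp => //; exact: measurable_indic.
have m2 : measurable_fun setT (fun z : noise d H * 'rV[R]_d =>
    (\1_E (add_ramp hH T0 z.2 z.1) * \1_I z.2 : R)%:E).
  apply/measurable_EFinP; apply: measurable_funM.
    by apply: measurableT_comp => //; exact: measurable_indic.
  by apply: measurableT_comp => //; exact: measurable_indic.
have ge01 z : (0 <= (shift_density T z.2 z.1 * (\1_E z.1 * \1_I z.2))%:E)%E.
  by rewrite lee_fin mulr_ge0 ?expR_ge0// mulr_ge0.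
have ge02 z : (0 <= (\1_E (add_ramp hH T0 z.2 z.1) * \1_I z.2 : R)%:E)%E.
  by rewrite lee_fin mulr_ge0.
apply: (@le_trans _ _ (\int[W]_w \int[L]_c (shift_density T c w * (\1_E w * \1_I c))%:E)%E).
  rewrite -integral_cst// integral_mkcond; apply: ge0_le_integral => //.
  - by move=> w _; rewrite patchE; case: ifP => // _; rewrite lee_fin expR_ge0.
  - apply/(measurable_restrictT _ _).1 => //.
  - exact: (@measurable_fun_fubini_tonelli_F _ _ _ _ _ L
      (fun z => (shift_density T z.2 z.1 * (\1_E z.1 * \1_I z.2))%:E)).
  move=> w _; rewrite patchE; case: ifPn => [wE|wE]; last first.
    by apply: integral_ge0 => c _; exact: (ge01 (w, c)).
  apply: le_trans (density_integral w) _.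
  rewrite integral_mkcond le_eqVlt; apply/orP; left; apply/eqP; apply: eq_integral => c _.
  rewrite patchE [\1_E w]indicE wE mul1r indicE.
  by case: ifPn => cI; rewrite ?mulr1 ?mulr0.
rewrite (@fubini_tonelli _ _ _ _ _ W L
  (fun z => (shift_density T z.2 z.1 * (\1_E z.1 * \1_I z.2))%:E))//=.
have step c : (\int[W]_w (shift_density T c w * (\1_E w * \1_I c))%:E =
    \int[W]_w (\1_E (add_ramp hH T0 c w) * \1_I c : R)%:E)%E.
  rewrite [\1_I c]indicE; case: (c \in I); last first.
    by apply: eq_integral => w _; rewrite !mulr0.
  have [] := (cameron_martin hH hW T0 c mE, mE) => + _.
  have -> : (\int[W]_(w in E) (shift_density T c w)%:E =
      \int[W]_w (shift_density T c w * (\1_E w * 1))%:E)%E.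
    rewrite integral_mkcond; apply: eq_integral => w _; rewrite patchE indicE.
    by case: ifPn => wE; rewrite ?mulr1 ?mulr0.
  move=> <-; rewrite -[in LHS](setIT [set w | _]) -integral_indic//; last first.
    rewrite -[X in measurable X]setTI.
    exact: (measurable_add_ramp hH T0 c measurableT mE).
  by apply: eq_integral => w _; rewrite mulr1.
rewrite (eq_integral _ _ (fun c _ => step c)).
rewrite -(@fubini_tonelli _ _ _ _ _ W L
  (fun z => (\1_E (add_ramp hH T0 z.2 z.1) * \1_I z.2 : R)%:E))//=.
rewrite -[leRHS]mule1 -(probability_setT W) -integral_cst//.
apply: ge0_le_integral => //.
- by move=> w _; apply: integral_ge0 => c _; exact: (ge02 (w, c)).
- exact: (@measurable_fun_fubini_tonelli_F _ _ _ _ _ L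
      (fun z => (\1_E (add_ramp hH T0 z.2 z.1) * \1_I z.2 : R)%:E)).
move=> w _; apply: le_trans (hb w).
have mS : measurable (I `&` [set c | E (add_ramp hH T0 c w)]).
  by apply: measurableI => //; exact: measurable_ramp_section.
rewrite -[X in (_ <= L X)%E]setIT -integral_indic//.
rewrite le_eqVlt; apply/orP; left; apply/eqP; apply: eq_integral => c _.
by rewrite !indicE in_setI; case: (c \in I); rewrite ?mulr1 ?mulr0.
Qed.

End concentration.

(** * Singular values *)

Section rayleigh.
Context {R : realType} {d : nat}.
Implicit Types (M s : 'M[R]_d) (u v x : 'rV[R]_d).

Lemma edot_mulmxC M x v : edot (x *m M) v = edot x (v *m M^T).
Proof.
rewrite /edot; under eq_bigr do rewrite mxE mulr_suml.
rewrite exchange_big/=; apply: eq_bigr => i _; rewrite mxE mulr_sumr.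
by apply: eq_bigr => j _; rewrite mxE; ring.
Qed.

Lemma enorm_gt0 v : v != 0 -> 0 < enorm v.
Proof. by move=> v0; rewrite lt_neqAle enorm_ge0 eq_sym enorm_eq0 v0. Qed.

Lemma continuous_quadratic M : continuous (fun v => edot (v *m M) v).
Proof.
apply: continuous_big => [|i _ v]; first exact: add_continuous.
apply: (@cvgM R _ (nbhs v) (nbhs_filter v)); last exact: coord_continuous.
have c : continuous (fun x => \sum_j x ord0 j * M j i).
  apply: continuous_big => [|j _ x]; first exact: add_continuous.
  by apply: (@cvgM R _ (nbhs x) (nbhs_filter x)); [exact: coord_continuous|exact: cvg_cst].
rewrite (_ : (fun x => _) = (fun x => \sum_j x ord0 j * M j i)).
  by have := c v; rewrite /continuous_at; congr (_ --> _); rewrite mxE.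
by apply/funext => x; rewrite mxE.
Qed.

(* At a minimum v0 of the Rayleigh quotient the nonnegative quadratic form
   x |-> x M x - mu |x|^2 vanishes, so v0 lies in its kernel. *)
Lemma rayleigh_min M : (0 < d)%N -> M^T = M ->
  exists mu : R, exists v0, [/\ v0 != 0, v0 *m M = mu *: v0 &
    forall v, mu * enorm v ^+ 2 <= edot (v *m M) v].
Proof.
move=> d0 symM; pose S := [set v : 'rV[R]_d | edot (v *m 1%:M) v = 1].
have SE v : S v <-> enorm v = 1.
  rewrite /S/= mulmx1 -sqr_enorm; split=> [/eqP|->]; last by rewrite expr1n.
  by rewrite sqrp_eq1 ?enorm_ge0// => /eqP.
have unit v : v != 0 -> S ((enorm v)^-1 *: v).
  move=> v0; apply/SE; rewrite enormZ ger0_norm ?invr_ge0 ?enorm_ge0//.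
  by rewrite mulVf// enorm_eq0.
have [v1 v10] : exists v : 'rV[R]_d, v != 0.
  exists (const_mx 1); apply/eqP => /rowP/(_ (Ordinal d0)).
  by rewrite !mxE => /eqP; rewrite oner_eq0.
have cS : compact S.
  apply: bounded_closed_compact.
    exists 1; split; first exact: num_real.
    move=> r r1 v /SE v1E; apply: (le_trans (mx_norm_le_enorm _)).
    by rewrite v1E ltW.
  apply: (@closed_comp _ _ (fun v => edot (v *m 1%:M) v) [set 1]).
    by move=> v _; exact: continuous_quadratic.
  exact: closed_eq.
have cf : {within S, continuous (fun v => edot (v *m M) v)}.
  by apply: continuous_subspaceT; exact: continuous_quadratic.
have [v0 /set_mem v0S v0min] := compact_EVT_min (ex_intro _ _ (unit _ v10)) cS cf.
pose mu := edot (v0 *m M) v0.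
have v00 : v0 != 0.
  by apply/eqP => v00; move/SE : v0S; rewrite v00 enorm0 => /eqP; rewrite eq_sym oner_eq0.
have low v : mu * enorm v ^+ 2 <= edot (v *m M) v.
  have [->|vn0] := eqVneq v 0.
    by rewrite mul0mx enorm0 expr0n mulr0 edot_ge0.
  have := v0min _ (mem_set (unit _ vn0)); rewrite -/mu -scalemxAl edotZl edotZr mulrA.
  rewrite -expr2 exprVn mulrC ler_pdivlMr// exprn_gt0// enorm_gt0//.
exists mu, v0; split => //.
(* Half the gradient of the form at [v0]. Along [v0 + t *: u] the form equals 2 t |u|^2 + t^2 q,
   which is nonnegative for all t only if [u = 0]. *)
have [u uE] : exists u, u = v0 *m M - mu *: v0 by eexists.
pose q := edot (u *m M) u - mu * enorm u ^+ 2.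
suff /eqP : edot u u = 0 by rewrite -sqr_enorm sqrf_eq0 enorm_eq0 uE subr_eq0 => /eqP.
have q0 : 0 <= q by rewrite subr_ge0.
have ineq (t : R) : 0 <= t * (2 * edot u u) + t ^+ 2 * q.
  have := low (v0 + t *: u); rewrite -subr_ge0; congr (0 <= _).
  rewrite sqr_enorm mulmxDl -scalemxAl !edotDl !edotDr !edotZl !edotZr.
  rewrite (edot_mulmxC M u v0) symM (edotC u (v0 *m M)) -[edot (v0 *m M) v0]/mu.
  have -> : edot v0 v0 = 1 by rewrite -sqr_enorm (SE v0).1// expr1n.
  rewrite (edotC u v0) /q sqr_enorm.
  have -> : edot (v0 *m M) u = edot u u + mu * edot v0 u.
    by rewrite -edotZl -edotDl uE subrK.
  by ring.
have [q00|qn0] := eqVneq q 0.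
  by have := ineq (- 1); rewrite q00 mulr0 addr0; have := edot_ge0 u; lra.
have qgt : 0 < q by rewrite lt_neqAle eq_sym qn0.
have := ineq (- (edot u u / q)).
have -> : - (edot u u / q) * (2 * edot u u) + (- (edot u u / q)) ^+ 2 * q =
  - (edot u u ^+ 2 / q) by field.
rewrite oppr_ge0 pmulr_lle0 ?invr_gt0// => h.
by apply/eqP; rewrite -sqrf_eq0 eq_le h sqr_ge0.
Qed.

(** The least stretch of [s] is its smallest singular value, at least the largest one over [theta],
    hence at least [opnorm s / theta]. Both extreme singular values come from [rayleigh_min],
    applied to [M] and to [- M]. *)
Lemma Ttheta_noise_ge (theta : R) s v : (0 < d)%N -> Ttheta theta s ->
  0 < opnorm s /\ enorm v <= theta * enorm (v *m (rescaled_noise s)^T).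
Proof.
move=> d0 [su hs]; pose M := s^T *m s.
have symM : M^T = M by rewrite trmx_mul trmxK.
have ME x : edot (x *m M) x = enorm (x *m s^T) ^+ 2.
  by rewrite mulmxA edot_mulmxC sqr_enorm.
have sn0 x : x != 0 -> 0 < enorm (x *m s^T).
  move=> x0; apply: enorm_gt0; apply: contra_neq x0 => xs.
  have sT : s^T \in unitmx by rewrite unitmx_tr.
  by rewrite -(mulmxK sT x) xs mul0mx.
have [mu [v0 [v00 eig0 low]]] := rayleigh_min d0 symM.
have symN : (- M)^T = - M by rewrite linearN/= symM.
have [nu [v1 [v10 eig1 high]]] := rayleigh_min d0 symN.
have eigE x a : x *m M = a *: x -> enorm (x *m s^T) ^+ 2 = a * enorm x ^+ 2.
  by move=> xa; rewrite -ME xa edotZl sqr_enorm.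
have mu0 : 0 < mu.
  have := eigE _ _ eig0 => h.
  by have := exprn_gt0 2 (sn0 _ v00); rewrite h pmulr_lgt0// exprn_gt0// enorm_gt0.
pose nu' := - nu.
have eig1' : v1 *m M = nu' *: v1 by rewrite /nu' scaleNr -eig1 mulmxN opprK.
have high' x : edot (x *m M) x <= nu' * enorm x ^+ 2.
  by have := high x; rewrite mulmxN -scaleN1r edotZl mulN1r /nu' mulNr lerNr.
have nu0 : 0 < nu'.
  have := eigE _ _ eig1' => h.
  by have := exprn_gt0 2 (sn0 _ v10); rewrite h pmulr_lgt0// exprn_gt0// enorm_gt0.
have sv x a : 0 <= a -> x != 0 -> x *m M = a *: x -> singular_values s (Num.sqrt a).
  move=> a0 x0 xa; split; first exact: sqrtr_ge0.
  by rewrite sqr_sqrtr//; apply/eigenvalueP; exists x.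
have svmu := sv _ _ (ltW mu0) v00 eig0.
have svnu := sv _ _ (ltW nu0) v10 eig1'.
have svb b : singular_values s b -> Num.sqrt mu <= b <= Num.sqrt nu'.
  move=> [b0 /eigenvalueP[x xb x0]].
  have x2 : 0 < enorm x ^+ 2 by rewrite exprn_gt0// enorm_gt0.
  have e : edot (x *m M) x = b ^+ 2 * enorm x ^+ 2 by rewrite xb edotZl sqr_enorm.
  have := low x; have := high' x; rewrite e !ler_pM2r// => h1 h2.
  by rewrite -(ger0_norm b0) -sqrtr_sqr !ler_wsqrtr.
have infE : inf (singular_values s) = Num.sqrt mu.
  apply/eqP; rewrite eq_le; apply/andP; split.
    by apply: ge_inf => //; exists (Num.sqrt mu) => b /svb/andP[].
  by apply: lb_le_inf; [exists (Num.sqrt mu)|move=> b /svb/andP[]].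
have supE : sup (singular_values s) = Num.sqrt nu'.
  apply/eqP; rewrite eq_le; apply/andP; split.
    by apply: ge_sup; [exists (Num.sqrt mu)|move=> b /svb/andP[]].
  by apply: ub_le_sup => //; exists (Num.sqrt nu') => b /svb/andP[].
have smu : 0 < Num.sqrt mu by rewrite sqrtr_gt0.
have st : Num.sqrt nu' <= theta * Num.sqrt mu.
  by move: hs; rewrite infE supE ler_pdivrMr.
have lo x : Num.sqrt mu * enorm x <= enorm (x *m s^T).
  rewrite -(ler_pXn2r (n := 2)) ?nnegrE ?enorm_ge0 ?mulr_ge0 ?enorm_ge0 ?sqrtr_ge0//.
  by rewrite -[leRHS]ME exprMn sqr_sqrtr ?(ltW mu0)//; exact: low.
have hi x : enorm (x *m s^T) <= Num.sqrt nu' * enorm x.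
  rewrite -(ler_pXn2r (n := 2)) ?nnegrE ?enorm_ge0 ?mulr_ge0 ?enorm_ge0 ?sqrtr_ge0//.
  by rewrite -[leLHS]ME exprMn sqr_sqrtr ?(ltW nu0)//; exact: high'.
have opub : ubound [set enorm (x *m s^T) | x in [set x | enorm x <= 1]] (Num.sqrt nu').
  move=> _ [x /= x1 <-]; apply: (le_trans (hi x)).
  by rewrite ler_piMr// sqrtr_ge0.
have op_le : opnorm s <= Num.sqrt nu'.
  apply: ge_sup => //; exists (enorm (0 *m s^T)); exists 0 => //=.
  by rewrite enorm0 ler01.
have op0 : 0 < opnorm s.
  have y1 : enorm ((enorm v0)^-1 *: v0) = 1.
    by rewrite enormZ ger0_norm ?invr_ge0 ?enorm_ge0// mulVf// enorm_eq0.
  apply: (@lt_le_trans _ _ (enorm ((enorm v0)^-1 *: v0 *m s^T))).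
    by apply: lt_le_trans (lo _); rewrite y1 mulr1.
  by apply: ub_le_sup; [exists (Num.sqrt nu')|exists ((enorm v0)^-1 *: v0); rewrite //= y1].
split => //; rewrite /rescaled_noise linearZ/= -scalemxAr enormZ.
rewrite ger0_norm ?invr_ge0 ?(ltW op0)// mulrCA ler_pdivlMl//.
apply: (@le_trans _ _ (Num.sqrt nu' * enorm v)); first by rewrite ler_wpM2r ?enorm_ge0.
apply: (@le_trans _ _ (theta * Num.sqrt mu * enorm v)); first by rewrite ler_wpM2r ?enorm_ge0.
rewrite -mulrA ler_wpM2l//.
by rewrite -(pmulr_lge0 _ smu) (le_trans _ st)// sqrtr_ge0.
Qed.

End rayleigh.

(** * Separation of solutions *)

Section drift.
Context {R : realType} {d : nat}.
Implicit Types (F : 'rV[R]_d -> 'rV[R]_d) (x y v : 'rV[R]_d).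

Lemma coord_mulmx_le v (M : 'M[R]_d) i : `|(v *m M) ord0 i| <= d%:R * `|M| * `|v|.
Proof.
rewrite mxE (le_trans (ler_norm_sum _ _ _))//.
apply: (@le_trans _ _ (\sum_(j < d) (`|M| * `|v|))).
  apply: ler_sum => j _; rewrite normrM mulrC ler_pM//; last exact: coord_le_mx_norm.
  rewrite [leRHS]/Num.Def.normr/= mx_normrE; exact: (le_bigmax _ (fun p => `|M p.1 p.2|) (j, i)).
by rewrite sumr_const card_ord -mulrA mulr_natl.
Qed.

Lemma C1_bounded_lipschitz F : C1_bounded_derivative F ->
  exists2 L : R, 0 < L & forall x y, `|F x - F y| <= L * `|x - y|.
Proof.
(* The factor [d] comes from a row-by-matrix product in the sup norm; the [+ 1] makes [L] positive,
   so that 1 / (4 L) is a valid time. *)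
move=> [dF _ [K HK]]; pose L := d%:R * `|K| + 1.
have L0 : 0 < L by rewrite ltr_wpDl// mulr_ge0.
exists L => // x y; rewrite mx_norm_leP; last by rewrite mulr_ge0// ltW.
move=> i; pose v := x - y; pose g (u : R) := F (y + u *: v) ord0 i.
have dg (u : R) : is_derive u (1 : R) g ((v *m jacobian F (y + u *: v)) ord0 i).
  have dFi : derivable (fun p => F p ord0 i) (y + u *: v) v.
    by have /derivable_mxP := @diff_derivable _ _ _ F (y + u *: v) v (dF _); apply.
  have eqg : (fun h : R => h^-1 *: (g (h *: (1 : R) + u) - g u)) =
      (fun h : R => h^-1 *: (F (h *: v + (y + u *: v)) ord0 i - F (y + u *: v) ord0 i)).
    apply/funext => h; rewrite /g; congr (_ *: (F _ _ _ - _)).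
    by rewrite -[h *: 1]/(h * 1) mulr1 scalerDl addrCA.
  split; first by rewrite /derivable eqg.
  rewrite /derive eqg -deriveEjacobian; last exact: dF.
  by rewrite derive_mx ?mxE//; exact: diff_derivable.
have [c _] : exists2 c, c \in `[0, 1]%R &
    g 1 - g 0 = (v *m jacobian F (y + c *: v)) ord0 i * (1 - 0).
  apply: (@MVT_segment R g (fun u => (v *m jacobian F (y + u *: v)) ord0 i)) => //.
  apply: continuous_subspaceT => u; apply: differentiable_continuous.
  by apply/derivable1_diffP; case: (dg u).
have yv : y + v = x by rewrite /v addrC subrK.
rewrite subr0 mulr1 /g scale1r scale0r addr0 yv => h.
have -> : (F x - F y) ord0 i = F x ord0 i - F y ord0 i by rewrite !mxE.
rewrite h.
apply: (le_trans (coord_mulmx_le _ _ _)); rewrite ler_wpM2r//.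
rewrite /L; apply: (@le_trans _ _ (d%:R * `|K|)); last by rewrite lerDl.
by rewrite ler_wpM2l// (le_trans (HK _))// ler_norm.
Qed.

(** The factors [opnorm s] inside and outside [F] cancel, so one time [T] suits all matrices. *)
Lemma rescaled_drift_lipschitz F (s : 'M[R]_d) (L : R) : 0 < opnorm s ->
  (forall x y, `|F x - F y| <= L * `|x - y|) ->
  forall x y, `|rescaled_drift F s x - rescaled_drift F s y| <= L * `|x - y|.
Proof.
move=> s0 HL x y; rewrite /rescaled_drift -scalerBr normrZ ger0_norm ?invr_ge0 ?(ltW s0)//.
rewrite ler_pdivrMl// (le_trans (HL _ _))// -scalerBr normrZ gtr0_norm//.
by rewrite mulrCA.
Qed.

End drift.

Section gronwall.
Context {R : realType} {d : nat}.
Variables (G : 'rV[R]_d -> 'rV[R]_d) (A : 'M[R]_d) (L T : R).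
Hypotheses (L0 : 0 < L) (T0 : 0 < T) (LT : L * T <= 4^-1)
  (GL : forall x y, `|G x - G y| <= L * `|x - y|).
Let leb : set (measurableTypeR R) -> \bar R := lebesgue_measure.

Let continuousG : continuous G.
Proof.
move=> x; apply/(@cvgrPdist_lt _ _ _ (nbhs x) (nbhs_filter x)) => e e0; near=> y.
rewrite (le_lt_trans (GL _ _))// -ltr_pdivlMl//.
near: y; apply: (@cvgr_dist_lt _ _ _ (nbhs x) _ id x) => //.
by rewrite mulr_gt0// invr_gt0.
Unshelve. all: by end_near. Qed.

Let drift_integrable b x Z t i : solves G A b x Z -> 0 <= t ->
  lebesgue_measure.-integrable `[0, t] (EFin \o (fun s => G (Z s) ord0 i)).
Proof.
move=> [cZ _] t0; apply: continuous_compact_integrable; first exact: segment_compact.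
have cZt : {within `[0, t], continuous Z}.
  apply: continuous_subspaceW cZ => s /=; rewrite !in_itv/= => /andP[-> _]//.
have cGi : continuous (fun p => G p ord0 i).
  move=> p; apply: (@continuous_comp _ _ _ G (fun q => q ord0 i)); first exact: continuousG.
  exact: coord_continuous.
by move=> s; exact: (cvg_comp _ _ (cZt s) (cGi (Z s))).
Qed.

(* For L T <= 1/4 the drift contributes less to Z_T - Z'_T than half of the
   difference of the driving paths. *)
Lemma solves_separation b b' x Z Z' (e : 'rV[R]_d) (k : R) : 0 <= k ->
  solves G A b x Z -> solves G A b' x Z' ->
  (forall t, 0 <= t <= T -> exists2 a : R, `|a| <= k & b t - b' t = a *: e) ->
  b T - b' T = k *: e ->
  k * `|e *m A^T| <= 2 * `|Z T - Z' T|.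
Proof.
move=> k0 sZ sZ' bb bT; have [cZ eZ] := sZ; have [cZ' eZ'] := sZ'.
pose D t := Z t - Z' t.
have sub0T : `[0, T] `<=` `[0, +oo[%classic.
  by move=> s /=; rewrite !in_itv/= => /andP[-> _].
have cD : {within `[0, T], continuous (fun t => `|D t|)}.
  move=> s; have cDs : {for s, continuous (D : subspace `[0, T] -> _)}.
    by apply: continuousB; [exact: (continuous_subspaceW sub0T cZ)|
      exact: (continuous_subspaceW sub0T cZ')].
  exact: (cvg_comp _ _ cDs (@norm_continuous _ _ (D s))).
have [t0 t0T Dmax] := EVT_max (ltW T0) cD.
set M := `|D t0| in Dmax.
have M0 : 0 <= M by exact: normr_ge0.
have DE t : 0 <= t <= T -> `|D t - (b t - b' t) *m A^T| <= 4^-1 * M.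
  move=> /andP[t_ge0 tT]; rewrite mx_norm_leP ?mulr_ge0 ?invr_ge0// => i.
  rewrite /D eZ// eZ'// mulmxBl !mxE.
  set I := Rintegral _ _ _; set I' := Rintegral _ _ _.
  rewrite (_ : _ - _ = I - I'); last by ring.
  rewrite /I /I' -RintegralB//; [|exact: drift_integrable sZ _|exact: drift_integrable sZ' _].
  have int : lebesgue_measure.-integrable `[0, t]
      (EFin \o (fun s => G (Z s) ord0 i - G (Z' s) ord0 i)).
    rewrite (_ : EFin \o _ = ((EFin \o (fun s => G (Z s) ord0 i)) \-
        (EFin \o (fun s => G (Z' s) ord0 i)))%E); last by apply/funext => s; rewrite /= EFinB.
    by apply: integrableB => //; [exact: drift_integrable sZ _|exact: drift_integrable sZ' _].
  apply: (le_trans (le_normr_Rintegral _ int)) => //.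
  apply: (@le_trans _ _ (\int[lebesgue_measure]_(s in `[0, t]) (L * M))).
    apply: le_Rintegral => //.
    - exact: integrable_norm int.
    - by apply: continuous_compact_integrable; [exact: segment_compact|
        apply: continuous_subspaceT => ?; exact: cvg_cst].
    move=> s /=; rewrite in_itv/= => /andP[s0 st].
    apply: (@le_trans _ _ `|G (Z s) - G (Z' s)|).
      by have := coord_le_mx_norm (G (Z s) - G (Z' s)) i; rewrite !mxE.
    apply: (le_trans (GL _ _)); rewrite ler_pM2l//.
    by apply: Dmax; rewrite in_itv/= s0 (le_trans st).
  rewrite Rintegral_cst//= lebesgue_measure_itv/= lte_fin.
  case: ifPn => [tpos|_]; last by rewrite mulr0 mulr_ge0// invr_ge0.
  rewrite -EFinB/= subr0 mulrAC ler_wpM2r//.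
  by apply: le_trans LT; rewrite ler_pM2l.
have t0T' : 0 <= t0 <= T by move: t0T; rewrite in_itv.
have [a ak ba] := bb _ t0T'.
(* Hence [M] is at most 4/3 of [k * |e *m A^T|], and the drift takes away at most a third of it at
   time [T]. *)
have M1 : M <= 4^-1 * M + k * `|e *m A^T|.
  have := DE _ t0T'; rewrite ba -scalemxAl => h.
  rewrite {1}/M -(subrK (a *: (e *m A^T)) (D t0)) (le_trans (ler_normD _ _))//.
  by rewrite lerD// normrZ ler_wpM2r.
have M2 : k * `|e *m A^T| - `|D T| <= 4^-1 * M.
  have := DE T; rewrite lexx ltW// => /(_ isT); rewrite bT -scalemxAl.
  rewrite distrC; apply: le_trans.
  have -> : k * `|e *m A^T| = `|k *: (e *m A^T)| by rewrite normrZ ger0_norm.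
  exact: lerB_dist.
by rewrite -/(D T); lra.
Qed.

End gronwall.

(** * Effect of a ramp on the fractional Brownian motion *)

Section fractional_shift.
Context {R : realType} {d : nat} (H : R).
Hypothesis hH : 0 < H < 1.
Variable D : noise d H -> noise d (1 - H).
Hypothesis hD : is_DH D.
Variables (T : R) (T0 : 0 < T).

(** Additivity of [D] reduces this to the ramp alone. The shift reverses the slope, [DH_ramp] brings
    a second sign and the definition of [fBm] a third, which leaves [- c]. *)
Lemma fBm_add_ramp t (wm wp : noise d H) (c : 'rV[R]_d) : 0 < t -> t <= T ->
  fBm D wm (add_ramp hH T0 c wp) t =
  fBm D wm wp t - ((alphaH H)^-1 * ramp_integral H t) *: c.
Proof.
move=> t0 tT; rewrite /fBm.
have shiftE (w : noise d H) : npath (Defs.shift t wm w) = shift_fun t (npath wm) (npath w).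
  rewrite /Defs.shift /to_noise; case: pselect => // h; exfalso; apply: h.
  exact: (shift_fun_noise hH t0 (noiseP wm) (noiseP w)).
pose v := Noise (ramp_noise hH (- c) t0).
have Dv := DH_ramp hH hD (w := v) (c := - c) t0 erefl.
have Ds : npath (D (Defs.shift t wm (add_ramp hH T0 c wp))) = npath (D (Defs.shift t wm wp)) \+ npath (D v).
  have e : npath (Defs.shift t wm (add_ramp hH T0 c wp)) =
      npath (Defs.shift t wm wp) \+ npath v.
    apply: (etrans (shiftE (add_ramp hH T0 c wp))).
    apply: (etrans (shift_fun_ramp (npath wm) (npath wp) c t0 tT)).
    exact: (f_equal (fun f : R -> 'rV[R]_d => f \+ ramp t (- c)) (esym (shiftE wp))).
  exact: (DH_additive hH hD e).
have e := f_equal (fun f : R -> 'rV[R]_d => - f (- t)) Ds.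
apply: (etrans e); apply: (etrans (f_equal (fun z => - (_ + z)) Dv)).
by rewrite scalerN scaleNr opprK opprD.
Qed.

Lemma fBm0 (wm wp : noise d H) : fBm D wm wp 0 = 0.
Proof. by rewrite /fBm oppr0 (noiseP (D _)).1.1 oppr0. Qed.

End fractional_shift.

(** * Concentration of the stationary law *)

Section lower_integral.
Context d {T : measurableType d} {R : realType} (P : probability T R).
Local Open Scope ereal_scope.
Import HBNNSimple.

(* The integral of a nonnegative function, measurable or not, is the supremum of
   the integrals of the simple functions below it. *)
Lemma integral_le_of_simple (f : T -> \bar R) (b : \bar R) : (forall x, 0 <= f x) ->
  (forall h : {nnsfun T >-> R}, (forall x, (h x)%:E <= f x) ->
     \int[P]_x (h x)%:E <= b) ->
  \int[P]_x f x <= b.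
Proof.
move=> f0 hb; rewrite ge0_integralTE//; apply: ge_ereal_sup => _ [h /= hf <-].
by have := hb h hf; rewrite integral_nnsfun// patch_setT.
Qed.

Lemma integral_le_cst (f : T -> \bar R) (b : \bar R) : (forall x, 0 <= f x <= b) ->
  \int[P]_x f x <= b.
Proof.
move=> fb; apply: integral_le_of_simple => [x|h hf]; first by have /andP[] := fb x.
rewrite -[leRHS]mule1 -(probability_setT P) -integral_cst//.
apply: ge0_le_integral => //.
- by move=> x _; rewrite lee_fin; exact: fun_ge0.
- exact/measurable_EFinP.
by move=> x _; apply: (le_trans (hf x)); have /andP[] := fb x.
Qed.

(** [S] may be non-measurable: the positivity set of a simple function below its indicator is a
    measurable subset of [S]. It is applied to noise events defined through [solution]. *)
Lemma integral_indic_le (S : set T) (b : \bar R) :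
  (forall E, measurable E -> E `<=` S -> P E <= b) ->
  \int[P]_x (\1_S x)%:E <= b.
Proof.
move=> Sb; apply: integral_le_of_simple => [x|h hS]; first by rewrite lee_fin.
pose E := [set x | (0 < h x)%R].
have mE : measurable E.
  rewrite -[E]setTI (_ : E = h @^-1` `]0%R, +oo[%classic).
    exact: (measurable_funP h measurableT _ (measurable_itv _)).
  by apply/seteqP; split => x; rewrite /E /= in_itv/= andbT.
have ES : E `<=` S.
  move=> x hx; apply: contrapT => nS; have := hS x.
  by rewrite indicE memNset// lee_fin leNgt hx.
apply: le_trans (Sb _ mE ES); rewrite -[X in P X]setIT -integral_indic//.
apply: ge0_le_integral => //.
- by move=> x _; rewrite lee_fin; exact: fun_ge0.
- exact/measurable_EFinP.
- by apply/measurable_EFinP; exact: measurable_indic.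
move=> x _; rewrite lee_fin [leRHS]indicE; case: (boolP (x \in E)) => xE.
  by have := hS x; rewrite lee_fin => /le_trans; apply; rewrite indicE; case: (_ \in _).
by rewrite leNgt; apply: contra xE => hx; exact: mem_set.
Qed.

End lower_integral.

Section diameter.
Context {R : realType} {d : nat}.

Lemma lebesgue_rV_diameter (S : set 'rV[R]_d) (delta : R) : measurable S -> 0 <= delta ->
  (forall c c', S c -> S c' -> `|c - c'| <= delta) ->
  (lebesgue_rV d S <= ((2 * delta) ^+ d)%:E)%E.
Proof.
move=> mS d0 diam; have [->|/set0P[c0 Sc0]] := eqVneq S set0.
  by rewrite measure0 lee_fin exprn_ge0// mulr_ge0.
pose A (i : 'I_d) : set R := `[c0 ord0 i - delta, c0 ord0 i + delta]%classic.
apply: (@le_trans _ _ (lebesgue_rV d [set c : 'rV[R]_d | forall i, A i (c ord0 i)])).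
  apply: le_measure; rewrite ?inE//.
    by apply: measurable_rV_box => i; exact: measurable_itv.
  move=> c Sc i; rewrite /A/= in_itv/= -ler_distl.
  have := diam c c0 Sc Sc0; rewrite mx_norm_leP// => /(_ i).
  by rewrite !mxE.
rewrite lebesgue_rV_box; last by move=> i; exact: measurable_itv.
rewrite (eq_bigr (fun=> (2 * delta)%:E)) => [|i _]; last first.
  rewrite /A lebesgue_measure_itv/= lte_fin -EFinB; case: ltP => h; congr EFin; lra.
by rewrite prodEFin prodr_const card_ord.
Qed.

End diameter.

Section transition.
Context {R : realType} {d : nat} (H : R).
Hypothesis hH : 0 < H < 1.
Variable W : probability (noise d H) R.
Hypothesis hW : wiener W.
Variable D : noise d H -> noise d (1 - H).
Hypothesis hD : is_DH D.
Variables (F : 'rV[R]_d -> 'rV[R]_d) (L : R).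
Hypotheses (L0 : 0 < L) (FL : forall x y, `|F x - F y| <= L * `|x - y|).
Variables (T : R) (T0 : 0 < T) (LT : L * T <= 4^-1).
Variables (s : 'M[R]_d) (theta : R).
Hypotheses (theta0 : 0 < theta) (s0 : 0 < opnorm s)
  (s_ge : forall v, enorm v <= theta * enorm (v *m (rescaled_noise s)^T)).

Definition ramp_gain : R := (alphaH H)^-1 * ramp_integral H T.

Lemma ramp_gain_gt0 : 0 < ramp_gain.
Proof. by rewrite mulr_gt0 ?invr_gt0 ?alphaH_gt0 ?ramp_integral_gt0. Qed.

Let solvable x (wm wp : noise d H) :=
  exists Z, solves (rescaled_drift F s) (rescaled_noise s) (fBm D wm wp) x Z.

Let solution_separation x wm w c c' :
  solvable x wm (add_ramp hH T0 c w) -> solvable x wm (add_ramp hH T0 c' w) ->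
  `|c - c'| <= 2 * theta * d%:R / ramp_gain *
    `|solution D F s x wm (add_ramp hH T0 c w) T -
      solution D F s x wm (add_ramp hH T0 c' w) T|.
Proof.
move=> /getPex sZ /getPex sZ'; have k0 := ramp_gain_gt0.
have fBmB t : 0 < t -> t <= T -> fBm D wm (add_ramp hH T0 c w) t -
    fBm D wm (add_ramp hH T0 c' w) t = ((alphaH H)^-1 * ramp_integral H t) *: (c' - c).
  move=> t0 tT; rewrite !(fBm_add_ramp hH hD T0 wm w _ t0 tT).
  by rewrite scalerBr opprB addrC addrA subrK addrC.
(* The constant [k] is the gain at [T]; by [ramp_integral_le] the gains at earlier times do not
   exceed it. *)
have sep := solves_separation L0 T0 LT (rescaled_drift_lipschitz s0 FL) (ltW k0) sZ sZ'
  (e := c' - c) _ (fBmB T T0 (lexx T)).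
set Z := solution _ _ _ _ _ _ in sep *; set Z' := solution _ _ _ _ _ (add_ramp hH T0 c' w) in sep *.
have {}sep : ramp_gain * `|(c' - c) *m (rescaled_noise s)^T| <= 2 * `|Z T - Z' T|.
  apply: sep => t /andP[t_ge0 tT].
  move: t_ge0; rewrite le_eqVlt => /predU1P[<-|t_gt0].
    by exists 0; [rewrite normr0 ltW|rewrite !fBm0 subrr scale0r].
  exists ((alphaH H)^-1 * ramp_integral H t); last exact: fBmB.
  rewrite ger0_norm ?mulr_ge0 ?invr_ge0 ?(ltW (alphaH_gt0 hH)) ?ramp_integral_ge0//.
  by rewrite ler_wpM2l ?invr_ge0 ?(ltW (alphaH_gt0 hH))// ramp_integral_le.
rewrite distrC (le_trans (mx_norm_le_enorm _))// (le_trans (s_ge _))//.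
apply: (@le_trans _ _ (theta * (d%:R * `|(c' - c) *m (rescaled_noise s)^T|))).
  by rewrite ler_pM2l// enorm_le_mx_norm.
rewrite -[leRHS]mulrA [2 * theta]mulrC -!mulrA ler_pM2l// mulrCA ler_wpM2l//.
by rewrite mulrCA ler_pdivlMl.
Qed.

(* If no solution exists, the value of the solution at T is that of the default
   path, which Q is assumed to avoid. *)
Lemma solution_concentration x wm (Q : set 'rV[R]_d) (rho : R) (E : set (noise d H)) :
  0 <= rho -> (forall y z, Q y -> Q z -> `|y - z| <= rho) ->
  ~ Q ((point : R -> 'rV[R]_d) T) ->
  measurable E -> (forall w, E w -> Q (solution D F s x wm w T)) ->
  (W E <= (expR (d%:R * T / 2) *
    (2 * (2 * theta * d%:R / ramp_gain * rho)) ^+ d)%:E)%E.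
Proof.
move=> rho0 Qrho Qp mE EQ; have k0 := ramp_gain_gt0.
have Esol w : E w -> solvable x wm w.
  move=> Ew; apply: contrapT => nsol; apply: Qp; have := EQ w Ew.
  have -> : solution D F s x wm w = point.
    by apply: xgetPN => Z sZ; apply: nsol; exists Z.
  by [].
have h0 : 0 <= 2 * theta * d%:R / ramp_gain * rho.
  by rewrite !mulr_ge0// ?invr_ge0 ltW.
rewrite EFinM -lee_pdivrMl ?expR_gt0// -expRN.
apply: (wiener_concentration (hH := hH) (T0 := T0) hW mE) => w.
apply: lebesgue_rV_diameter => //.
  apply: measurableI.
    exact: (@measurable_rV_box R d (fun=> `[(-1)%R, 1%R]%classic) (fun i => measurable_itv _)).
  exact: measurable_ramp_section.
(* Two ramps that carry [w] into [E] bring the solution at [T] into [Q], so by separation their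
   slopes differ by at most a multiple of [rho]. *)
move=> c c' [_ Ec] [_ Ec'].
apply: (le_trans (solution_separation (Esol _ Ec) (Esol _ Ec'))).
rewrite ler_wpM2l//; last exact: Qrho (EQ _ Ec) (EQ _ Ec').
by rewrite !mulr_ge0// ?invr_ge0 ltW.
Qed.

Definition concentration_bound (rho : R) : R :=
  expR (d%:R * T / 2) * (2 * (2 * theta * d%:R / ramp_gain * rho)) ^+ d.

(** The bound on the kernel is uniform in the starting point and the past noise, so it survives
    integration against any invariant [mu]. *)
Lemma stationary_concentration mu (Q : set 'rV[R]_d) (rho : R) :
  invariant_measure W D F s mu -> measurable Q ->
  0 <= rho -> (forall y z, Q y -> Q z -> `|y - z| <= rho) ->
  ~ Q ((point : R -> 'rV[R]_d) T) ->
  (mu (Q `*` setT) <= (concentration_bound rho)%:E)%E.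
Proof.
move=> [_ inv] mQ rho0 Qrho Qp.
rewrite -(inv T (ltW T0)); last exact: measurableX.
have k0 z : (0 <= sds_kernel W D F s T z (Q `*` setT))%E.
  by apply: integral_ge0 => w _; rewrite lee_fin.
apply: integral_le_cst => -[x wm]; rewrite k0/=.
rewrite /sds_kernel/=.
pose S := [set w | Q (solution D F s x wm w T)].
rewrite (_ : (fun wp => _) = (fun w => (\1_S w)%:E)); last first.
  apply/funext => w; congr EFin; rewrite !indicE; congr (nat_of_bool _)%:R.
  by apply/idP/idP => /set_mem h; apply/mem_set; [case: h|split].
apply: integral_indic_le => E mE ES.
exact: (solution_concentration rho0 Qrho Qp mE ES).
Qed.

End transition.

(** * Dyadic approximation *)

Section dyadic.
Context {R : realType} {d : nat}.
Implicit Types (x y : 'rV[R]_d) (A B : set 'rV[R]_d).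

Definition dyadic_cell (n : nat) x : {ffun 'I_d -> int} :=
  [ffun i => Num.floor (2 ^+ n * x ord0 i)].

(** Unions, possibly infinite, of half-open cubes of side 2^-n. Stated as saturation, the notion is
    immediately stable under complements. *)
Definition dyadic n B := forall x y, dyadic_cell n x = dyadic_cell n y -> B x -> B y.

Lemma dyadic_cellS n x y : dyadic_cell n.+1 x = dyadic_cell n.+1 y ->
  dyadic_cell n x = dyadic_cell n y.
Proof.
move=> /ffunP xy; apply/ffunP => i; have := xy i; rewrite !ffunE exprS -!mulrA.
set a := _ * x ord0 i; set b := _ * y ord0 i => ab.
suff H (u v : R) : Num.floor (2 * u) = Num.floor (2 * v) -> Num.floor u <= Num.floor v.
  by apply/eqP; rewrite eq_le !H.
move=> uv; rewrite floor_ge_int; have : ((Num.floor u) * 2)%:~R <= 2 * v.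
  rewrite -floor_ge_int -uv floor_ge_int intrM mulrC ler_pM2l//; exact: floor_le.
by rewrite intrM mulrC ler_pM2l.
Qed.

Lemma dyadicW n k B : (n <= k)%N -> dyadic n B -> dyadic k B.
Proof.
move=> nk nB x y xy; apply: nB; elim: k nk xy => [|k IH].
  by rewrite leqn0 => /eqP ->.
by rewrite leq_eqVlt => /predU1P[->//|nk] /dyadic_cellS; exact: IH.
Qed.

Lemma dyadicC n B : dyadic n B -> dyadic n (~` B).
Proof. by move=> nB x y xy nBx By; apply: nBx; exact: nB By. Qed.

Lemma dyadicU n k A B : dyadic n A -> dyadic k B -> dyadic (maxn n k) (A `|` B).
Proof.
move=> nA kB x y xy [Ax|Bx]; [left|right].
  by apply: (dyadicW (leq_maxl n k) nA) Ax.
by apply: (dyadicW (leq_maxr n k) kB) Bx.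
Qed.

Let cube n (z : {ffun 'I_d -> int}) : set 'rV[R]_d := dyadic_cell n @^-1` [set z].

Let side n (z : {ffun 'I_d -> int}) (i : 'I_d) : set R :=
  `[(z i)%:~R / 2 ^+ n, (z i + 1)%:~R / 2 ^+ n[%classic.

Let cubeE n z : cube n z = [set x | forall i, side n z i (x ord0 i)].
Proof.
have p2 : (0 : R) < 2 ^+ n by rewrite exprn_gt0.
have H x i : (Num.floor (2 ^+ n * x ord0 i) == z i) =
    (x ord0 i \in `[(z i)%:~R / 2 ^+ n, (z i + 1)%:~R / 2 ^+ n[).
  by rewrite floor_eq in_itv/= ler_pdivrMr// ltr_pdivlMr// ![_ * 2 ^+ n]mulrC.
apply/seteqP; split=> x.
  by move=> xz i; rewrite /side/= -H; apply/eqP; rewrite -xz ffunE.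
by move=> xz; apply/ffunP => i; rewrite ffunE; apply/eqP; rewrite H; exact: xz.
Qed.

Let measurable_cube n z : measurable (cube n z).
Proof. by rewrite cubeE; exact: (measurable_rV_box (A := side n z) (fun i => measurable_itv _)). Qed.

Let lebesgue_cube n z : lebesgue_rV d (cube n z) = ((2^-1 ^+ n) ^+ d)%:E.
Proof.
rewrite cubeE (lebesgue_rV_box (A := side n z) (fun i => measurable_itv _)).
rewrite (eq_bigr (fun=> (2^-1 ^+ n)%:E)) => [|i _].
  by rewrite prodEFin prodr_const card_ord.
have p2 : (0 : R) < 2 ^+ n by rewrite exprn_gt0.
rewrite lebesgue_measure_itv/= lte_fin ltr_pM2r ?invr_gt0// ltr_int ltzD1 lexx -EFinB.
by rewrite -mulrBl intrD addrAC subrr add0r mul1r exprVn.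
Qed.

Let cube_diameter n z x y : cube n z x -> cube n z y -> `|x - y| <= 2^-1 ^+ n.
Proof.
rewrite cubeE => xz yz; rewrite mx_norm_leP ?exprn_ge0 ?invr_ge0// => i.
have := xz i; have := yz i; rewrite /side/= !in_itv/= intrD mulrDl mul1r exprVn !mxE.
set a := _ / _; set b := (2 ^+ n)^-1 => /andP[h1 h2] /andP[h3 h4].
by rewrite ler_norml; apply/andP; split; lra.
Qed.

(** [pickle_inv] enumerates the countably many cells; a number that codes no cell gives the empty
    set. *)
Let piece n B (k : nat) : set 'rV[R]_d :=
  if pickle_inv k is Some z then B `&` cube n z else set0.

Let piece_cup n B : B = \bigcup_k piece n B k.
Proof.
apply/seteqP; split=> x; last by move=> [k _]; rewrite /piece; case: pickle_inv => // z [].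
by move=> Bx; exists (pickle (dyadic_cell n x)) => //; rewrite /piece pickleK_inv.
Qed.

Let piece_triv n B : trivIset setT (piece n B).
Proof.
have H k x : piece n B k x -> k = pickle (dyadic_cell n x).
  rewrite /piece; have := @pickle_invK {ffun 'I_d -> int} k; case: pickle_inv => //= z zk [_ xz].
  by rewrite -zk -xz.
apply/trivIsetP => i j _ _ ij; rewrite -subset0 => x [/H xi /H xj].
by move: ij; rewrite xi xj eqxx.
Qed.

Let piece_cube n B k : dyadic n B -> piece n B k = set0 \/ exists z, piece n B k = cube n z.
Proof.
move=> nB; rewrite /piece; case: pickle_inv => [z|]; last by left.
have [->|/set0P[x [Bx xz]]] := eqVneq (B `&` cube n z) set0; first by left.
right; exists z; apply/seteqP; split=> [y []//|y yz]; split => //.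
by apply: nB Bx; rewrite xz yz.
Qed.

Let measurable_piece n B k : dyadic n B -> measurable (piece n B k).
Proof. by move=> /(piece_cube k)[->|[z ->]]. Qed.

Lemma measurable_dyadic n B : dyadic n B -> measurable B.
Proof.
by move=> nB; rewrite (piece_cup n B); apply: bigcup_measurable => k _; exact: measurable_piece.
Qed.

(** A cell of side [rho] has diameter at most [rho] in the sup norm and volume [rho ^+ d], so the
    hypothesis is domination on cells; countable additivity does the rest. *)
Lemma dyadic_dominated (nu : {measure set 'rV[R]_d -> \bar R}) (K : R) : 0 <= K ->
  (forall (Q : set 'rV[R]_d) rho, measurable Q -> 0 <= rho ->
     (forall y z, Q y -> Q z -> `|y - z| <= rho) -> (nu Q <= (K * rho ^+ d)%:E)%E) ->
  forall n B, dyadic n B -> (nu B <= K%:E * lebesgue_rV d B)%E.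
Proof.
move=> K0 nuK n B nB; rewrite (piece_cup n B).
have mp k : measurable (piece n B k) by exact: measurable_piece.
have sumE (mm : {measure set 'rV[R]_d -> \bar R}) :
    mm (\bigcup_k piece n B k) = (\sum_(0 <= k <oo) mm (piece n B k))%E.
  by apply: measure_semi_bigcup => //; exact: bigcup_measurable.
rewrite !sumE.
rewrite -nneseriesZl//; apply: lee_nneseries => // k _.
have [->|[z ->]] := piece_cube k nB; first by rewrite !measure0 mule0.
rewrite [X in (_ * X)%E](lebesgue_cube n z) -EFinM; apply: nuK; [exact: measurable_cube|by rewrite exprn_ge0// invr_ge0|exact: cube_diameter].
Qed.

Section approximation.
Variable m : {measure set 'rV[R]_d -> \bar R}.
Hypothesis moo : (m setT < +oo)%E.

Let approximable A := measurable A /\ forall e, 0 < e ->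
  exists n, exists2 B, dyadic n B & (m (A `\` B) <= e%:E)%E /\ (m (B `\` A) <= e%:E)%E.

Let approximable_dyadic n B : dyadic n B -> approximable B.
Proof.
move=> nB; split; first exact: measurable_dyadic nB.
by move=> e e0; exists n, B => //; rewrite setDv measure0 lee_fin ltW.
Qed.

Let approximableC A : approximable A -> approximable (~` A).
Proof.
move=> [mA apA]; split; first exact: measurableC.
move=> e /apA[n [B nB [AB BA]]]; exists n, (~` B); first exact: dyadicC.
by rewrite !setDE !setCK ![~` _ `&` _]setIC -!setDE.
Qed.

Let approximableU A A' : approximable A -> approximable A' -> approximable (A `|` A').
Proof.
move=> [mA apA] [mA' apA']; split; first exact: measurableU.
move=> e e0; have e2 : 0 < e / 2 by rewrite divr_gt0.
have [n [B nB [AB BA]]] := apA _ e2; have [n' [B' nB' [AB' BA']]] := apA' _ e2.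
have mB := measurable_dyadic nB; have mB' := measurable_dyadic nB'.
exists (maxn n n'), (B `|` B'); first exact: dyadicU.
have sub (X X' Y Y' : set 'rV[R]_d) : measurable X -> measurable X' -> measurable Y ->
    measurable Y' -> (m (X `\` Y) <= (e / 2)%:E)%E -> (m (X' `\` Y') <= (e / 2)%:E)%E ->
    (m ((X `|` X') `\` (Y `|` Y')) <= e%:E)%E.
  move=> mX mX' mY mY' h h'.
  apply: (@le_trans _ _ (m ((X `\` Y) `|` (X' `\` Y')))).
    apply: le_measure; rewrite ?inE.
    - by apply: measurableD; apply: measurableU.
    - by apply: measurableU; apply: measurableD.
    by move=> x [[Xx|Xx] nY]; [left|right]; split => // Yx; apply: nY; [left|right].
  rewrite (splitr e) EFinD; apply: le_trans (leeD h h').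
  by apply: measureU2; exact: measurableD.
by split; exact: sub.
Qed.

Let approximable_bigcup (F : (set 'rV[R]_d)^nat) :
  (forall k, approximable (F k)) -> approximable (\bigcup_k F k).
Proof.
move=> apF; pose U n := \big[setU/set0]_(k < n) F k.
have apU n : approximable (U n).
  rewrite /U; elim: n => [|n IH]; last by rewrite big_ord_recr; exact: approximableU.
  by rewrite big_ord0; apply: (@approximable_dyadic 0%N).
have mF k : measurable (F k) by case: (apF k).
have mU n : measurable (U n) by case: (apU n).
have mcup : measurable (\bigcup_k F k) by exact: bigcup_measurable.
split => // e e0; have e2 : 0 < e / 2 by rewrite divr_gt0.
have Usub n : U n `<=` \bigcup_k F k.
  by move=> x; rewrite /U -bigcup_mkord => -[k _ Fk]; exists k.
have fin X : measurable X -> m X \is a fin_num.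
  move=> mX; rewrite ge0_fin_numE//; apply: le_lt_trans moo.
  by apply: le_measure; rewrite ?inE.
(* As [m] is finite, continuity from above lets a finite union replace the countable one; a dyadic
   approximant of [U N] then suffices. *)
have [N mN] : exists N, (m (\bigcup_k F k `\` U N) <= (e / 2)%:E)%E.
  have cv : m (\bigcup_k F k `\` U n) @[n --> \oo] --> 0%E.
    have cap0 : \bigcap_n (\bigcup_k F k `\` U n) = set0.
      rewrite -subset0 => x h; have [[k _ Fkx] _] := h 0%N I.
      have [_] := h k.+1 I; apply; rewrite /U big_ord_recr/=; by right.
    rewrite -(measure0 m) -cap0; apply: nonincreasing_cvg_mu.
    - by rewrite -ge0_fin_numE// fin//; exact: measurableD.
    - by move=> n; exact: measurableD.
    - by rewrite cap0.
    - move=> a b ab; apply/subsetPset => x [Fx nU]; split => // Ux; apply: nU.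
      by move: x {Fx} Ux; exact: subset_bigsetU.
  apply: contrapT => /forallNP H.
  have : ((e / 2)%:E <= limn (fun n => m (\bigcup_k F k `\` U n)))%E.
    apply: lime_ge; first by apply/cvg_ex; exists 0%E.
    by apply: nearW => n; apply/ltW; rewrite ltNge; apply/negP; exact: H.
  by rewrite (cvg_lim _ cv)// lee_fin leNgt e2.
have [_ /(_ _ e2)[n [B nB [UB BU]]]] := apU N; exists n, B => //.
have mB := measurable_dyadic nB.
split.
  apply: (@le_trans _ _ (m ((\bigcup_k F k `\` U N) `|` (U N `\` B)))).
    apply: le_measure; rewrite ?inE.
    - exact: measurableD.
    - by apply: measurableU; exact: measurableD.
    by move=> x [Fx nB']; have [Ux|nU] := pselect (U N x); [right|left].
  rewrite (splitr e) EFinD; apply: le_trans (leeD mN UB).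
  by apply: measureU2; exact: measurableD.
apply: (@le_trans _ _ (e / 2)%:E); last by rewrite lee_fin; lra.
apply: le_trans BU; apply: le_measure; rewrite ?inE; [exact: measurableD..|].
by move=> x [Bx nF]; split => // Ux; apply: nF; exact: Usub Ux.
Qed.

(** The floors of [2 ^+ n * a] and [2 ^+ n * x ord0 i] differ as soon as
    [2 ^+ n * (x ord0 i - a) >= 1], so the open half-space is a countable union of dyadic sets. *)
Let approximable_ray i (a : R) : approximable [set x | a < x ord0 i].
Proof.
rewrite [X in approximable X](_ : _ = \bigcup_n
    [set x : 'rV[R]_d | Num.floor (2 ^+ n * a) < Num.floor (2 ^+ n * x ord0 i)]).
  apply: approximable_bigcup => n; apply: (@approximable_dyadic n) => x y xy.
  by move/ffunP : xy => /(_ i); rewrite !ffunE /= => ->.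
apply/seteqP; split => x /=.
  move=> ax; have xa0 : 0 < x ord0 i - a by rewrite subr_gt0.
  pose n := Num.truncn (x ord0 i - a)^-1; exists n => //=.
  have nP : 1 <= 2 ^+ n * (x ord0 i - a).
    rewrite -ler_pdivrMr// mul1r; apply: (@le_trans _ _ n.+1%:R).
      by rewrite ltW// truncnS_gt.
    by rewrite -natrX ler_nat ltn_expl.
  rewrite floor_lt_int; have := floorD1_gt (2 ^+ n * x ord0 i); rewrite intrD.
  by move: nP; rewrite mulrBr; lra.
move=> [n _]; apply: contraTT; rewrite -!leNgt => xa; apply: le_floor.
by rewrite ler_pM2l// exprn_gt0.
Qed.

(** Approximable sets form a sigma-algebra, and open rays in each coordinate generate the Borel
    sets. *)
Lemma dyadic_approximation A : measurable A -> forall e, 0 < e ->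
  exists n, exists2 B, dyadic n B & (m (A `\` B) <= e%:E)%E /\ (m (B `\` A) <= e%:E)%E.
Proof.
move=> mA; suff [] : approximable A by [].
have app_sigma : sigma_algebra setT approximable.
  split.
  - by apply: (@approximable_dyadic 0%N).
  - by move=> X; rewrite setTD; exact: approximableC.
  - exact: approximable_bigcup.
move: A mA; apply: smallest_sub => // A; rewrite -bigcup_seq => -[i _ [Y mY <-]].
rewrite setTI; have {mY} : (@ocitv R).-sigma.-measurable Y by [].
rewrite RGenOInfty.measurableE; move: Y.
have sig : sigma_algebra setT [set Y : set R | approximable ((fun x : 'rV[R]_d => x ord0 i) @^-1` Y)].
  case: app_sigma => a0 aC aU; split => /=.
  - by rewrite preimage_set0.
  - by move=> Y; rewrite !setTD preimage_setC; exact: approximableC.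
  - by move=> Y aY; rewrite preimage_bigcup; exact: aU.
apply: smallest_sub => // _ [a ->] /=.
have := approximable_ray i a; congr approximable.
by apply/seteqP; split => x; rewrite /= in_itv/= andbT.
Qed.

End approximation.

End dyadic.

(** * Boundedness of the density *)

Section bounded_density.
Context {R : realType} {d : nat}.
Implicit Types (x y : 'rV[R]_d) (A B : set 'rV[R]_d).
Let leb := lebesgue_rV (R := R) d.

Let box (N : nat) : set 'rV[R]_d :=
  [set x | forall i, - N%:Z <= dyadic_cell 0 x i < N%:Z].

Let dyadic_box N : dyadic 0 (box N).
Proof. by move=> x y xy Bx i; rewrite -xy; exact: Bx. Qed.

Let measurable_box N : measurable (box N).
Proof. exact: measurable_dyadic (@dyadic_box N). Qed.

Let box_mem x : exists N, forall n, (N <= n)%N -> box n x.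
Proof.
exists (\max_(i < d) `|dyadic_cell 0 x i|.+1)%N => n Nn i.
have := leq_trans (leq_bigmax (F := fun i => `|dyadic_cell 0 x i|.+1%N) i) Nn.
by rewrite -ltz_nat abszE ltr_norml => /andP[/ltW -> ->].
Qed.

Let lebesgue_box_fin N : (leb (box N) < +oo)%E.
Proof.
pose A (i : 'I_d) : set R := `[- N%:R, N%:R]%classic.
have mA i : measurable (A i) by exact: measurable_itv.
apply: (@le_lt_trans _ _ (leb [set x : 'rV[R]_d | forall i, A i (x ord0 i)])).
  apply: le_measure; rewrite ?inE//; first exact: measurable_rV_box.
  move=> x Bx i; have := Bx i; rewrite ffunE expr0 mul1r floor_ge_int floor_lt_int.
  by rewrite /A/= in_itv/= intrN => /andP[-> /ltW ->].
rewrite lebesgue_rV_box// (eq_bigr (fun i => (fine (lebesgue_measure (A i)))%:E)).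
  by rewrite prodEFin ltry.
by move=> i _; rewrite fineK// /A lebesgue_measure_itv/=; case: ifP.
Qed.

Lemma dyadicI n k A B : dyadic n A -> dyadic k B -> dyadic (maxn n k) (A `&` B).
Proof.
move=> nA kB; rewrite -[A]setCK -[B]setCK -setCU.
by apply: dyadicC; apply: dyadicU; exact: dyadicC.
Qed.

Variables (nu : {measure set 'rV[R]_d -> \bar R}) (K : R).
Hypotheses (nuoo : (nu setT < +oo)%E) (K0 : 0 <= K).
Hypothesis nuK : forall n B, dyadic n B -> (nu B <= K%:E * leb B)%E.

(** [A] is approximated for [nu] and for Lebesgue measure on the box at once, through their sum [m],
    which is finite. The two errors enter with the factors 1 and [K], whence the tolerance
    [e / (1 + K)]. *)
Let dominated N A : measurable A -> A `<=` box N -> (nu A <= K%:E * leb A)%E.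
Proof.
move=> mA AN; apply/lee_addgt0Pr => e e0.
have K1 : 0 < 1 + K by rewrite ltr_pwDl.
have [m mE] : exists m : {measure set 'rV[R]_d -> \bar R},
    forall X, m X = (nu X + leb (X `&` box N))%E.
  exists (measure_add nu (mrestr leb (measurable_box N))) => X.
  exact: measure_addE.
have moo : (m setT < +oo)%E.
  by rewrite mE; apply: lte_add_pinfty => //; rewrite setTI lebesgue_box_fin.
have e1 : 0 < e / (1 + K) by rewrite divr_gt0.
have [n [B nB [AB BA]]] := dyadic_approximation moo mA e1.
have mB := measurable_dyadic nB.
pose B' := B `&` box N; have mB' : measurable B' by exact: measurableI.
have hA : (nu (A `\` B) <= (e / (1 + K))%:E)%E.
  by apply: le_trans AB; rewrite mE leeDl.
have hB : (leb (B' `\` A) <= (e / (1 + K))%:E)%E.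
  apply: le_trans BA; rewrite mE (@le_trans _ _ (leb ((B `\` A) `&` box N)))//.
    apply: le_measure; rewrite ?inE.
    - exact: measurableD.
    - by apply: measurableI => //; exact: measurableD.
    by move=> x [[]].
  by rewrite leeDr.
have h1 : (nu A <= nu (A `\` B) + nu B')%E.
  apply: (@le_trans _ _ (nu ((A `\` B) `|` B'))).
    apply: le_measure; rewrite ?inE//; first by apply: measurableU => //; exact: measurableD.
    by move=> x Ax; have [Bx|nBx] := pselect (B x); [right; split => //; exact: AN|left].
  by apply: measureU2 => //; exact: measurableD.
have h2 : (leb B' <= leb A + leb (B' `\` A))%E.
  apply: (@le_trans _ _ (leb (A `|` (B' `\` A)))).
    apply: le_measure; rewrite ?inE//; first by apply: measurableU => //; exact: measurableD.
    by move=> x Bx; have [Ax|nAx] := pselect (A x); [left|right].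
  by apply: measureU2 => //; exact: measurableD.
apply: (le_trans h1); apply: (@le_trans _ _ ((e / (1 + K))%:E + K%:E * (leb A + (e / (1 + K))%:E))%E).
  apply: leeD => //; apply: (le_trans (nuK (dyadicI nB (@dyadic_box N)))).
  by apply: lee_wpmul2l; rewrite ?lee_fin// (le_trans h2)// leeD2l.
rewrite ge0_muleDr//; last by rewrite lee_fin ltW.
rewrite addeCA leeD2l// -EFinM -EFinD lee_fin.
by rewrite -{1}[e / _]mul1r -mulrDl mulrCA divff ?mulr1// gt_eqF.
Qed.

(** On [A n] the density exceeds [K] by a fixed amount, so domination forces [A n] to be null; the
    box makes its volume finite, so that it can be cancelled. *)
Lemma density_le_ae (p : 'rV[R]_d -> R) : measurable_fun setT p -> (forall y, 0 <= p y) ->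
  (forall A, measurable A -> nu A = (\int[leb]_(y in A) (p y)%:E)%E) ->
  leb.-negligible [set y | K < p y].
Proof.
move=> mp p0 nup.
pose A n := box n `&` [set y | K + n.+1%:R^-1 <= p y].
have mA n : measurable (A n).
  apply: measurableI => //.
  rewrite -[X in measurable X]setTI (_ : [set y | _] = p @^-1` `[K + n.+1%:R^-1, +oo[%classic).
    exact: (mp measurableT _ (measurable_itv _)).
  by apply/seteqP; split => x; rewrite /= in_itv/= andbT.
have A0 n : leb (A n) = 0%E.
  have oo : (leb (A n) < +oo)%E.
    by apply: le_lt_trans (lebesgue_box_fin n); apply: le_measure; rewrite ?inE// => x [].
  have fin : leb (A n) \is a fin_num by rewrite ge0_fin_numE.
  have : ((K + n.+1%:R^-1)%:E * leb (A n) <= K%:E * leb (A n))%E.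
    apply: (@le_trans _ _ (nu (A n))); last by apply: (@dominated n) => // x [].
    rewrite nup// -integral_cst//; apply: ge0_le_integral => //.
    - by move=> x _; rewrite lee_fin addr_ge0.
    - by apply/measurable_EFinP; exact: measurable_funTS.
    by move=> x [_ h]; rewrite lee_fin.
  rewrite -(fineK fin) -!EFinM lee_fin mulrDl gerDl pmulr_rle0 ?invr_gt0// => h.
  by congr EFin; apply/eqP; rewrite eq_le h fine_ge0.
have neg : leb.-negligible (\bigcup_n A n).
  by apply: negligible_bigcup => n; exact: (negligibleP leb (mA n)).2 (A0 n).
apply: negligibleS neg => x /= Kp; have [N HN] := box_mem x.
pose M := Num.truncn (p x - K)^-1; exists (maxn N M) => //; split.
  exact: HN (leq_maxl _ _).
rewrite /= addrC -lerBrDr invf_ple ?posrE ?subr_gt0// ltW//.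
by apply: (lt_le_trans (truncnS_gt _)); rewrite ler_nat ltnS leq_maxr.
Qed.

End bounded_density.

(** * The marginal law on R^d and the uniform density bound *)

Section first_marginal.
Context d1 d2 (T1 : measurableType d1) (T2 : measurableType d2) (R : realType).
Variable mu : {measure set (T1 * T2)%type -> \bar R}.
Local Open Scope ereal_scope.

Definition first_marginal (A : set T1) := mu (A `*` setT).

Let first_marginal0 : first_marginal set0 = 0.
Proof. by rewrite /first_marginal set0X measure0. Qed.

Let first_marginal_ge0 A : 0 <= first_marginal A.
Proof. exact: measure_ge0. Qed.

Let first_marginal_sigma_additive : semi_sigma_additive first_marginal.
Proof.
move=> F mF tF mUF; rewrite /first_marginal setX_bigcupl.
apply: measure_semi_sigma_additive.
- by move=> k; exact: measurableX.
- apply/trivIsetP => i j _ _ ij; move/trivIsetP : tF => /(_ i j I I ij) Fij.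
  by rewrite -subset0 => -[x y] /= [[Fi _] [Fj _]]; rewrite -[False]/(set0 x) -Fij.
- by rewrite -setX_bigcupl; exact: measurableX.
Qed.

HB.instance Definition _ := isMeasure.Build _ _ _ first_marginal
  first_marginal0 first_marginal_ge0 first_marginal_sigma_additive.

End first_marginal.

Section singleton.
Context {R : realType} {d : nat} (y : 'rV[R]_d).

Let coords (i : 'I_d) : set R := [set y ord0 i].

Let mcoords i : measurable (coords i). Proof. exact: measurable_set1. Qed.

Let set1E : [set y] = [set x : 'rV[R]_d | forall i, coords i (x ord0 i)].
Proof.
apply/seteqP; split => x; first by move=> -> i.
by move=> xy; apply/rowP => i; exact: xy.
Qed.

Lemma measurable_rV_set1 : measurable [set y].
Proof. by rewrite set1E; exact: measurable_rV_box. Qed.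

Lemma lebesgue_rV_set1 : (0 < d)%N -> lebesgue_rV d [set y] = 0%E.
Proof.
move=> d0; rewrite set1E lebesgue_rV_box//.
by rewrite (bigD1 (Ordinal d0))//= /coords lebesgue_measure_set1 mul0e.
Qed.

End singleton.

Lemma stationary_density_le (R : realType) (d : nat) (H theta : R)
    (F : 'rV[R]_d -> 'rV[R]_d)
    (W : probability (noise d H) R) (D : noise d H -> noise d (1 - H)) :
  (0 < d)%N -> 0 < H < 1 -> 1 <= theta -> C1_bounded_derivative F -> wiener W -> is_DH D ->
  exists2 C : R, 0 < C & forall s p, Ttheta theta s -> stationary_density W D F s p ->
    (lebesgue_rV d).-negligible [set y | C < p y].
Proof.
move=> d0 hH theta1 hF hW hD; have [L L0 FL] := C1_bounded_lipschitz hF.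
have theta0 : 0 < theta by exact: lt_le_trans theta1.
(* This time depends on [F] alone, so that the constant [C] below is the same for all [s] in
   [Ttheta theta]. *)
pose T := (4 * L)^-1; have T0 : 0 < T by rewrite invr_gt0 mulr_gt0.
have LT : L * T <= 4^-1.
  by rewrite /T invfM mulrCA divff ?mulr1// gt_eqF.
pose C := expR (d%:R * T / 2) * (2 * (2 * theta * d%:R / ramp_gain H T)) ^+ d.
have C0 : 0 < C.
  rewrite mulr_gt0 ?expR_gt0// exprn_gt0// !mulr_gt0 ?ltr0n// invr_gt0.
  exact: ramp_gain_gt0.
exists C => // s p sT [mp p0 [mu hmu mup]].
have [s0 s_ge] : 0 < opnorm s /\ forall v, enorm v <= theta * enorm (v *m (rescaled_noise s)^T).
  by split=> [|v]; [have [] := Ttheta_noise_ge 0 d0 sT|have [] := Ttheta_noise_ge v d0 sT].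
pose nu : {measure set 'rV[R]_d -> \bar R} := first_marginal mu.
have nup A : measurable A -> nu A = (\int[lebesgue_rV d]_(y in A) (p y)%:E)%E by exact: mup.
have nuoo : (nu setT < +oo)%E.
  by rewrite /nu/= /first_marginal setXTT probability_setT ltry.
apply: (density_le_ae nuoo (ltW C0) _ mp p0 nup).
apply: dyadic_dominated; first exact: ltW.
move=> Q rho mQ rho0 Qrho.
(* The value that [stationary_concentration] must avoid. The point [z] is null for [nu], which has a
   density, because [0 < d]. *)
pose z := (point : R -> 'rV[R]_d) T.
have mz := measurable_rV_set1 z.
apply: (@le_trans _ _ (nu ((Q `\ z) `|` [set z]))).
  apply: le_measure; rewrite ?inE//.
    by apply: measurableU => //; exact: measurableD.
  by move=> x Qx; have [->|xz] := eqVneq x z; [right|left; split => //; exact/eqP].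
apply: (@le_trans _ _ (nu (Q `\ z) + nu [set z])%E).
  by apply: measureU2 => //; exact: measurableD.
have -> : nu [set z] = 0%E.
  rewrite nup//; apply: null_set_integral => //; last exact: lebesgue_rV_set1.
  by apply: measurable_funTS; exact/measurable_EFinP.
rewrite adde0 /C -mulrA -exprMn -[2 * _ * rho]mulrA.
apply: (stationary_concentration hH hW hD L0 FL T0 LT theta0 s0 s_ge hmu _ rho0) => //.
- exact: measurableD.
- by move=> x y [Qx _] [Qy _]; exact: Qrho.
- by move=> [_]; apply.
Qed.

Theorem proposition5p18 (R : realType) (d : nat) (H theta kappa : R)
    (F : 'rV[R]_d -> 'rV[R]_d)
    (W : probability (noise d H) R) (D : noise d H -> noise d (1 - H))
    (hd : (0 < d)%N) (hH : 0 < H < 1) (htheta : 1 <= theta)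
    (hkappa : 0 < kappa) (hF : C1_bounded_derivative F)
    (hFmon : eventually_strictly_monotone F) (hW : wiener W) (hD : is_DH D)
    (r : R) (hr : 0 < r) :
  exists C1 C2 : R, [/\ 0 < C1, 0 < C2 &
    forall p : 'M[R]_d -> 'rV[R]_d -> R,
      (forall s, Tthetakappa theta kappa s -> stationary_density W D F s (p s)) ->
      exists q : 'M[R]_d -> 'rV[R]_d -> R,
        (forall s, Tthetakappa theta kappa s ->
           stationary_density W D F s (q s) /\
           {ae lebesgue_rV d, forall y, q s y = p s y}) /\
        forall y, enorm y < r ->
          (ereal_sup [set (q s y)%:E | s in Tthetakappa theta kappa] <=
             (C1 * expR (- C2 * enorm y ^+ 2))%:E)%E].
Proof.
have [C C0 HC] := stationary_density_le hd hH htheta hF hW hD.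
(* On the ball the Gaussian is at least [expR (- r ^+ 2)], which the factor [expR (r ^+ 2)]
   compensates. *)
exists (C * expR (r ^+ 2)), 1; split => //; first by rewrite mulr_gt0 ?expR_gt0.
(* The null set where [p s] exceeds [C] depends on [s], and the supremum runs over uncountably many
   [s]; the version cut to 0 there is bounded by [C] at every point. *)
move=> p hp; pose q s y := p s y * \1_[set z | p s z <= C] y.
exists q; split=> [s hs|y yr]; last first.
  apply: ge_ereal_sup => _ [s hs <-]; rewrite lee_fin.
  apply: (@le_trans _ _ C).
    rewrite /q indicE; case: (boolP (y \in _)) => [/set_mem/= h|_]; first by rewrite mulr1.
    by rewrite mulr0 ltW.
  rewrite -mulrA ler_peMr ?(ltW C0)// -expRD -[leLHS]expR0 ler_expR mulN1r subr_ge0.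
  by rewrite ler_pXn2r ?nnegrE ?enorm_ge0 ?ltW.
have sd := hp s hs; have [mp p0 [mu hmu mup]] := sd.
have mC : measurable [set z | p s z <= C].
  rewrite -[X in measurable X]setTI (_ : [set z | _] = p s @^-1` `]-oo, C]%classic).
    exact: (mp measurableT _ (measurable_itv _)).
  by apply/seteqP; split => x; rewrite /= in_itv.
have mq : measurable_fun setT (q s).
  by apply: measurable_funM => //; exact: measurable_indic.
have qp : {ae lebesgue_rV d, forall y, q s y = p s y}.
  apply: negligibleS (HC s (p s) hs.1 sd) => y /=; apply: contra_notP => /negP.
  by rewrite -leNgt => h; rewrite /q indicE mem_set// mulr1.
split => //; split => //; first by move=> y; rewrite /q mulr_ge0.
exists mu => // A mA; rewrite mup//; apply: ae_eq_integral => //.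
- by apply: measurable_funTS; exact/measurable_EFinP.
- by apply: measurable_funTS; exact/measurable_EFinP.
by apply: filterS qp => y qpy _; rewrite qpy.
Qed.
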